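(* (a) Let $G$ be a maximal infinite virtually cyclic subgroup of $B_4(\mathbb{S}^2)$. Then $G$ is isomorphic to one of the following groups: $\mathcal{Q}_8\rtimes\mathbb{Z}$ for one of the three possible actions (i.e. $\mathcal{Q}_8\rtimes_j\mathbb{Z}$ for some $j\in\{1,2,3\}$), or $\mathcal{Q}_{16}\ast_{\mathcal{Q}_8}\mathcal{Q}_{16}$. (b) If $G$ is a subgroup of $B_4(\mathbb{S}^2)$ isomorphic to $T^{*}$ then it is maximal as a virtually cyclic subgroup. (c) For each $j\in\{1,2,3\}$, there are subgroups of $B_4(\mathbb{S}^2)$ isomorphic to $\mathcal{Q}_8\rtimes_j\mathbb{Z}$ that are maximal as virtually cyclic subgroups, and others that are non maximal. (d) There exist subgroups of $B_4(\mathbb{S}^2)$ isomorphic to $\mathcal{Q}_{16}\ast_{\mathcal{Q}_8}\mathcal{Q}_{16}$ that are maximal as virtually cyclic subgroups, and others that are non maximal.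
   Context: $B_4(\mathbb{S}^2)$ is the $4$-string braid group of the $2$-sphere; it has a presentation with generators $\sigma_1,\sigma_2,\sigma_3$ and relations $\sigma_1\sigma_3=\sigma_3\sigma_1$, $\sigma_1\sigma_2\sigma_1=\sigma_2\sigma_1\sigma_2$, $\sigma_2\sigma_3\sigma_2=\sigma_3\sigma_2\sigma_3$, $\sigma_1\sigma_2\sigma_3^2\sigma_2\sigma_1=1$. A group is virtually cyclic if it has a cyclic subgroup of finite index (finite groups are included). A virtually cyclic subgroup is maximal if it is maximal (for inclusion) in the family of virtually cyclic subgroups of $B_4(\mathbb{S}^2)$. $T^{*}$ is the binary tetrahedral group, of order $24$. $\mathcal{Q}_8=\langle x,y\mid x^2=y^2,\ yxy^{-1}=x^{-1}\rangle$ and $\mathcal{Q}_{16}=\langle x,y\mid x^4=y^2,\ yxy^{-1}=x^{-1}\rangle$. For $j\in\{1,2,3\}$, $\mathcal{Q}_8\rtimes_j\mathbb{Z}$ is the semi-direct product in which a generator $z$ of $\mathbb{Z}$ acts on $\mathcal{Q}_8$ by: $zxz^{-1}=x$, $zyz^{-1}=y$ if $j=1$ (so the group is $\mathcal{Q}_8\times\mathbb{Z}$); $zxz^{-1}=y$, $zyz^{-1}=x$ if $j=2$; $zxz^{-1}=y$, $zyz^{-1}=xy$ if $j=3$. Up to isomorphism these are all the groups of the form $\mathcal{Q}_8\rtimes\mathbb{Z}$. A group is of the form $\mathcal{Q}_{16}\ast_{\mathcal{Q}_8}\mathcal{Q}_{16}$ if it is an amalgamated product of two copies of $\mathcal{Q}_{16}$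 along a common subgroup isomorphic to $\mathcal{Q}_8$ (of index $2$ in each factor); abstractly there are exactly two isomorphism classes of such groups. *)

(* Defs.v *)
From HB Require Import structures.
From mathcomp Require Import all_boot all_order all_algebra.
From mathcomp Require Import boolp classical_sets functions cardinality.

Set Implicit Arguments.
Unset Strict Implicit.
Unset Printing Implicit Defensive.

Local Open Scope classical_set_scope.
Local Open Scope group_scope.

(* Formal group expressions over the generators [X].  No group axiom holds for
   them: the structures declared below only give access to the notations
   [u * v], [1], [u^-1] and [u ^+ n]. *)
Inductive word (X : Type) : Type :=
  | Gen of X
  | WOne
  | WMul of word X & word X
  | WInv of word X.
Arguments WOne {X}.

HB.instance Definition _ (X : Type) := gen_eqMixin (word X).
HB.instance Definition _ (X : Type) := gen_choiceMixin (word X).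
HB.instance Definition _ (X : Type) := hasMul.Build (word X) (@WMul X).
HB.instance Definition _ (X : Type) := hasOne.Build (word X) (@WOne X).
HB.instance Definition _ (X : Type) := hasInv.Build (word X) (@WInv X).

Section Presentation.
Variables (X : Type) (R : word X -> word X -> Prop).

(* The least congruence containing [R] whose quotient is a group. *)
Inductive pres_cong : word X -> word X -> Prop :=
  | cong_rel u v : R u v -> pres_cong u v
  | cong_refl u : pres_cong u u
  | cong_sym u v : pres_cong u v -> pres_cong v u
  | cong_trans v u w : pres_cong u v -> pres_cong v w -> pres_cong u w
  | cong_mul u u' v v' :
      pres_cong u u' -> pres_cong v v' -> pres_cong (u * v) (u' * v')
  | cong_inv u u' : pres_cong u u' -> pres_cong u^-1 u'^-1
  | cong_mulA u v w : pres_cong (u * (v * w)) (u * v * w)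
  | cong_mul1 u : pres_cong (1 * u) u
  | cong_mulr1 u : pres_cong (u * 1) u
  | cong_mulV u : pres_cong (u^-1 * u) 1
  | cong_mulrV u : pres_cong (u * u^-1) 1.

Definition pres_congb : rel (word X) := fun u v => `[< pres_cong u v >].

Lemma pres_congb_refl : reflexive pres_congb.
Proof. by move=> u; apply/asboolP/cong_refl. Qed.

Lemma pres_congb_sym : symmetric pres_congb.
Proof. by move=> u v; apply/asboolP/asboolP => /cong_sym. Qed.

Lemma pres_congb_trans : transitive pres_congb.
Proof.
by move=> v u w /asboolP uv /asboolP vw; apply/asboolP/(cong_trans uv vw).
Qed.

Canonical pres_equiv :=
  EquivRel pres_congb pres_congb_refl pres_congb_sym pres_congb_trans.

Local Open Scope quotient_scope.

Definition presented : Type := {eq_quot pres_equiv}.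

HB.instance Definition _ := Choice.on presented.
HB.instance Definition _ := EqQuotient.on presented.

Lemma presented_eq (u v : word X) :
  pres_cong u v -> \pi_presented u = \pi_presented v.
Proof. by move=> uv; apply/eqmodP/asboolP. Qed.

Lemma presented_eqP (u v : word X) :
  \pi_presented u = \pi_presented v -> pres_cong u v.
Proof. by move=> /eqmodP/asboolP. Qed.

Lemma repr_cong (u : word X) : pres_cong (repr (\pi_presented u)) u.
Proof. by apply: presented_eqP; rewrite reprK. Qed.

Definition pres_mul (a b : presented) : presented := \pi_presented (repr a * repr b).
Definition pres_one : presented := \pi_presented WOne.
Definition pres_inv (a : presented) : presented := \pi_presented (repr a)^-1.

Lemma pres_mulE (u v : word X) :
  pres_mul (\pi_presented u) (\pi_presented v) = \pi_presented (u * v).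
Proof. by apply/presented_eq/cong_mul; apply: repr_cong. Qed.

Lemma pres_invE (u : word X) : pres_inv (\pi_presented u) = \pi_presented u^-1.
Proof. exact/presented_eq/cong_inv/repr_cong. Qed.

Fact pres_mulA : associative pres_mul.
Proof.
elim/quotW=> u; elim/quotW=> v; elim/quotW=> w.
rewrite (pres_mulE u v) (pres_mulE v w) (pres_mulE u) (pres_mulE _ w).
exact/presented_eq/cong_mulA.
Qed.

Fact pres_mul1g : left_id pres_one pres_mul.
Proof. by elim/quotW=> u; rewrite (pres_mulE 1 u); apply/presented_eq/cong_mul1. Qed.

Fact pres_mulg1 : right_id pres_one pres_mul.
Proof. by elim/quotW=> u; rewrite (pres_mulE u 1); apply/presented_eq/cong_mulr1. Qed.

Fact pres_mulVg : left_inverse pres_one pres_inv pres_mul.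
Proof.
elim/quotW=> u; rewrite (pres_invE u) (pres_mulE u^-1 u).
exact/presented_eq/cong_mulV.
Qed.

Fact pres_mulgV : right_inverse pres_one pres_inv pres_mul.
Proof.
elim/quotW=> u; rewrite (pres_invE u) (pres_mulE u u^-1).
exact/presented_eq/cong_mulrV.
Qed.

HB.instance Definition _ := isGroup.Build presented
  pres_mulA pres_mul1g pres_mulg1 pres_mulVg pres_mulgV.

Definition pgen (x : X) : presented := \pi_presented (Gen x).

End Presentation.

Fixpoint weval (X : Type) (G : groupType) (f : X -> G) (w : word X) : G :=
  match w with
  | Gen x => f x
  | WOne => 1
  | WMul u v => weval f u * weval f v
  | WInv u => (weval f u)^-1
  end.

Lemma weval_pgen (X : Type) (R : word X -> word X -> Prop) (w : word X) :
  weval (pgen R) w = \pi_(presented R)%qT w.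
Proof.
elim: w => //= [u IHu v IHv|u IHu].
- by rewrite IHu IHv; apply: pres_mulE.
- by rewrite IHu; apply: pres_invE.
Qed.

Lemma pgen_rel (X : Type) (R : word X -> word X -> Prop) (u v : word X) :
  R u v -> weval (pgen R) u = weval (pgen R) v.
Proof. by move=> uv; rewrite !weval_pgen; apply/presented_eq/cong_rel. Qed.

Section UniversalProperty.
Variables (X : Type) (R : word X -> word X -> Prop) (G : groupType).
Variable f : X -> G.
Hypothesis fR : forall u v, R u v -> weval f u = weval f v.

Lemma weval_cong u v : pres_cong R u v -> weval f u = weval f v.
Proof.
elim=> {u v} //=.
- by move=> u v w _ -> _ ->.
- by move=> u u' v v' _ -> _ ->.
- by move=> u u' _ ->.
- by move=> u v w; rewrite mulgA.
- by move=> u; rewrite mul1g.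
- by move=> u; rewrite mulg1.
- by move=> u; rewrite mulVg.
- by move=> u; rewrite mulgV.
Qed.

Definition pres_lift & (forall u v, R u v -> weval f u = weval f v) :
  presented R -> G := fun a => weval f (repr a).

Lemma pres_liftE (u : word X) : pres_lift fR (\pi_(presented R)%qT u) = weval f u.
Proof. exact/weval_cong/repr_cong. Qed.

Lemma pres_lift_gen (x : X) : pres_lift fR (pgen R x) = f x.
Proof. exact: pres_liftE. Qed.

Lemma pres_liftM : {morph pres_lift fR : a b / a * b}.
Proof.
elim/quotW=> u; elim/quotW=> v.
by rewrite [X in pres_lift _ X]pres_mulE !pres_liftE.
Qed.

HB.instance Definition _ :=
  isMultiplicative.Build (presented R) G (pres_lift fR) pres_liftM.

End UniversalProperty.

Lemma mulhom1 (G H : groupType) (f : {multiplicative G -> H}) : f 1 = 1.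
Proof. by apply: (mulgI (f 1)); rewrite -gmulfM !mulg1. Qed.

Lemma mulhomV (G H : groupType) (f : {multiplicative G -> H}) a :
  f a^-1 = (f a)^-1.
Proof. by apply: (mulgI (f a)); rewrite -gmulfM !mulgV mulhom1. Qed.

Lemma pres_hom_eq (X : Type) (R : word X -> word X -> Prop) (G : groupType)
    (g h : {multiplicative presented R -> G}) :
  (forall x, g (pgen R x) = h (pgen R x)) -> g =1 h.
Proof.
move=> gh; elim/quotW=> w; rewrite -weval_pgen.
by elim: w => /= [x||u IHu v IHv|u IHu];
  rewrite ?gh ?mulhom1 ?gmulfM ?mulhomV ?IHu ?IHv.
Qed.

Inductive B4_gen : Type := sigma1 | sigma2 | sigma3.

Inductive B4_rel : word B4_gen -> word B4_gen -> Prop :=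
  | B4_comm : B4_rel (Gen sigma1 * Gen sigma3) (Gen sigma3 * Gen sigma1)
  | B4_braid12 : B4_rel (Gen sigma1 * Gen sigma2 * Gen sigma1)
                        (Gen sigma2 * Gen sigma1 * Gen sigma2)
  | B4_braid23 : B4_rel (Gen sigma2 * Gen sigma3 * Gen sigma2)
                        (Gen sigma3 * Gen sigma2 * Gen sigma3)
  | B4_sphere : B4_rel
      (Gen sigma1 * Gen sigma2 * Gen sigma3 ^+ 2 * Gen sigma2 * Gen sigma1) 1.

(* The 4-string braid group of the 2-sphere, by its classical presentation. *)
Definition B4S2 : groupType := presented B4_rel.

Inductive quat_gen : Type := qx | qy.

(* <x, y | x^m = y^2, y x y^-1 = x^-1>, the dicyclic group of order 4m. *)
Inductive quat_rel (m : nat) : word quat_gen -> word quat_gen -> Prop :=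
  | quat_pow : quat_rel m (Gen qx ^+ m) (Gen qy ^+ 2)
  | quat_conj : quat_rel m (Gen qy * Gen qx * (Gen qy)^-1) (Gen qx)^-1.

Definition Q8 : groupType := presented (quat_rel 2).
Definition Q16 : groupType := presented (quat_rel 4).

Inductive tet_gen : Type := tr2 | ts3 | tt3.

(* The binary polyhedral presentation <r, s, t | r^2 = s^3 = t^3 = rst>. *)
Inductive tet_rel : word tet_gen -> word tet_gen -> Prop :=
  | tet_r : tet_rel (Gen tr2 ^+ 2) (Gen tr2 * Gen ts3 * Gen tt3)
  | tet_s : tet_rel (Gen ts3 ^+ 3) (Gen tr2 * Gen ts3 * Gen tt3)
  | tet_t : tet_rel (Gen tt3 ^+ 3) (Gen tr2 * Gen ts3 * Gen tt3).

Definition Tstar : groupType := presented tet_rel.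

Record group_aut (N : groupType) := GroupAut {
  aut_map : {multiplicative N -> N};
  aut_inv : N -> N;
  aut_mapK : cancel aut_map aut_inv;
  aut_invK : cancel aut_inv aut_map }.

(* [(a, k)] stands for [a z^k], where the generator [z = (1, 1)] of the infinite
   cyclic factor acts by [z a z^-1 = phi a]. *)
Definition sdprodZ (N : groupType) (phi : group_aut N) : Type := (N * int)%type.

Section SdprodZ.
Variables (N : groupType) (phi : group_aut N).

Definition aut_zpow (k : int) : N -> N :=
  match k with
  | Posz n => iter n (aut_map phi)
  | Negz n => iter n.+1 (aut_inv phi)
  end.

Lemma aut_zpowS k a : aut_zpow (k + 1)%R a = aut_map phi (aut_zpow k a).
Proof.
case: k => [n|[|n]]; first by rewrite -PoszD addn1.
  by rewrite /= aut_invK.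
rewrite (_ : (Negz n.+1 + 1)%R = Negz n) /=; first by rewrite aut_invK.
by rewrite !NegzE -addn1 PoszD GRing.opprD GRing.addrNK.
Qed.

Lemma aut_zpowP k a : aut_zpow (k - 1)%R a = aut_inv phi (aut_zpow k a).
Proof.
by rewrite -{2}(GRing.subrK 1%R k) aut_zpowS aut_mapK.
Qed.

Lemma aut_zpowD k l a : aut_zpow (k + l)%R a = aut_zpow k (aut_zpow l a).
Proof.
elim/int_rec: k => [|n IHn|n IHn]; first by rewrite GRing.add0r.
- by rewrite -addn1 PoszD GRing.addrAC !aut_zpowS IHn.
- by rewrite -addn1 PoszD GRing.opprD GRing.addrAC !aut_zpowP IHn.
Qed.

Lemma aut_invM : {morph aut_inv phi : a b / a * b}.
Proof.
by move=> a b; rewrite -{1}(aut_invK phi a) -{1}(aut_invK phi b) -gmulfM aut_mapK.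
Qed.

Lemma aut_zpowM k : {morph aut_zpow k : a b / a * b}.
Proof.
move=> a b; elim/int_rec: k => [//|n IHn|n IHn].
- by rewrite -addn1 PoszD !aut_zpowS IHn gmulfM.
- by rewrite -addn1 PoszD GRing.opprD !aut_zpowP IHn aut_invM.
Qed.

Lemma aut_zpow1 k : aut_zpow k 1 = 1.
Proof. by apply: (mulgI (aut_zpow k 1)); rewrite -aut_zpowM !mulg1. Qed.

Local Notation S := (sdprodZ phi).

HB.instance Definition _ := Choice.on S.

Definition sdZ_mul (u v : S) : S :=
  (u.1 * aut_zpow u.2 v.1, (u.2 + v.2)%R).
Definition sdZ_one : S := (1, 0%R).
Definition sdZ_inv (u : S) : S :=
  (aut_zpow (- u.2)%R u.1^-1, (- u.2)%R).

Fact sdZ_mulA : associative sdZ_mul.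
Proof.
by move=> u v w; rewrite /sdZ_mul /= aut_zpowM aut_zpowD mulgA GRing.addrA.
Qed.

Fact sdZ_mul1g : left_id sdZ_one sdZ_mul.
Proof. by case=> a l; rewrite /sdZ_mul /= mul1g GRing.add0r. Qed.

Fact sdZ_mulg1 : right_id sdZ_one sdZ_mul.
Proof. by case=> a k; rewrite /sdZ_mul /= aut_zpow1 mulg1 GRing.addr0. Qed.

Fact sdZ_mulVg : left_inverse sdZ_one sdZ_inv sdZ_mul.
Proof.
by case=> a k; rewrite /sdZ_mul /= -aut_zpowM mulVg aut_zpow1 GRing.addNr.
Qed.

Fact sdZ_mulgV : right_inverse sdZ_one sdZ_inv sdZ_mul.
Proof.
by case=> a k; rewrite /sdZ_mul /= -aut_zpowD GRing.addrN /= mulgV.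
Qed.

HB.instance Definition _ := isGroup.Build S
  sdZ_mulA sdZ_mul1g sdZ_mulg1 sdZ_mulVg sdZ_mulgV.

End SdprodZ.

Definition q8x : Q8 := pgen (quat_rel 2) qx.
Definition q8y : Q8 := pgen (quat_rel 2) qy.

Lemma q8_pow : q8x * q8x = q8y * q8y.
Proof. exact: (pgen_rel (quat_pow 2)). Qed.

Lemma q8_conj : q8y * q8x * q8y^-1 = q8x^-1.
Proof. exact: (pgen_rel (quat_conj 2)). Qed.

Lemma q8_yx : q8y * q8x = q8x^-1 * q8y.
Proof. by rewrite -q8_conj mulgVK. Qed.

Lemma q8_xyx : q8x * q8y * q8x = q8y.
Proof. by rewrite -mulgA q8_yx mulVKg. Qed.

Lemma q8_yxy : q8y * q8x * q8y = q8x.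
Proof. by rewrite q8_yx -mulgA -q8_pow mulKg. Qed.

Definition q8_pair (a b : Q8) (q : quat_gen) : Q8 :=
  match q with qx => a | qy => b end.

Section Q8Lift.
Variables a b : Q8.
Hypotheses (ab_pow : a * a = b * b) (ab_conj : b * a = a^-1 * b).

Fact q8_lift_rel u v : quat_rel 2 u v ->
  weval (q8_pair a b) u = weval (q8_pair a b) v.
Proof.
case; first exact: ab_pow.
by rewrite /= ab_conj mulgK.
Qed.

Definition q8_lift : {multiplicative Q8 -> Q8} := pres_lift q8_lift_rel.

Lemma q8_lift_x : q8_lift q8x = a.
Proof. exact: (pres_lift_gen q8_lift_rel qx). Qed.

Lemma q8_lift_y : q8_lift q8y = b.
Proof. exact: (pres_lift_gen q8_lift_rel qy). Qed.

End Q8Lift.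

Lemma q8_hom_id (g : {multiplicative Q8 -> Q8}) :
  g q8x = q8x -> g q8y = q8y -> g =1 id.
Proof. by move=> gx gy; apply: (@pres_hom_eq _ _ _ g idfun) => -[]. Qed.

Fact q8_swap_conj : q8x * q8y = q8y^-1 * q8x.
Proof. by rewrite -[X in _ = _ * X]q8_yxy -!mulgA mulKg. Qed.

(* x |-> y, y |-> x *)
Definition q8_swap : {multiplicative Q8 -> Q8} :=
  q8_lift (esym q8_pow) q8_swap_conj.

Fact q8_swapK : involutive q8_swap.
Proof.
apply: (q8_hom_id (g := q8_swap \o q8_swap)) => /=;
  by rewrite ?(q8_lift_x, q8_lift_y).
Qed.

Fact q8_rot_pow : q8y * q8y = q8x * q8y * (q8x * q8y).
Proof. by rewrite [RHS]mulgA q8_xyx. Qed.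

Fact q8_rot_conj : q8x * q8y * q8y = q8y^-1 * (q8x * q8y).
Proof. by rewrite [X in X * _ = _]q8_swap_conj mulgA. Qed.

(* x |-> y, y |-> x y *)
Definition q8_rot : {multiplicative Q8 -> Q8} := q8_lift q8_rot_pow q8_rot_conj.

Fact q8_yxV : q8y * q8x^-1 = q8x * q8y.
Proof. by rewrite -[in LHS]q8_xyx mulgK. Qed.

Fact q8_rotV_pow : q8y * q8x^-1 * (q8y * q8x^-1) = q8x * q8x.
Proof. by rewrite q8_yxV -q8_rot_pow q8_pow. Qed.

Fact q8_rotV_conj : q8x * (q8y * q8x^-1) = (q8y * q8x^-1)^-1 * q8x.
Proof.
rewrite q8_yxV; apply: (mulgI (q8x * q8y)).
by rewrite mulVKg !mulgA q8_xyx q8_yxy.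
Qed.

(* x |-> y x^-1, y |-> x *)
Definition q8_rotV : {multiplicative Q8 -> Q8} :=
  q8_lift q8_rotV_pow q8_rotV_conj.

Fact q8_rotK : cancel q8_rot q8_rotV.
Proof.
apply: (q8_hom_id (g := q8_rotV \o q8_rot)) => /=.
  by rewrite q8_lift_x q8_lift_y.
by rewrite q8_lift_y gmulfM q8_lift_x q8_lift_y mulgVK.
Qed.

Fact q8_rotVK : cancel q8_rotV q8_rot.
Proof.
apply: (q8_hom_id (g := q8_rot \o q8_rotV)) => /=.
  by rewrite q8_lift_x gmulfM mulhomV q8_lift_x q8_lift_y mulgK.
by rewrite q8_lift_y q8_lift_x.
Qed.

Inductive q8_action : Type := act1 | act2 | act3.

Definition q8_aut (j : q8_action) : group_aut Q8 :=
  match j with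
  | act1 => @GroupAut Q8 idfun id (fun=> erefl) (fun=> erefl)
  | act2 => GroupAut q8_swapK q8_swapK
  | act3 => GroupAut q8_rotK q8_rotVK
  end.

Definition Q8Z (j : q8_action) : groupType := sdprodZ (q8_aut j).

Section Amalgam.
Variables (C A B : groupType).
Variables (i : {multiplicative C -> A}) (k : {multiplicative C -> B}).

(* The free product of [A] and [B] with [i c] and [k c] identified. *)
Inductive amalgam_rel : word (A + B) -> word (A + B) -> Prop :=
  | amalgam_l a a' : amalgam_rel (Gen (inl a) * Gen (inl a')) (Gen (inl (a * a')))
  | amalgam_r b b' : amalgam_rel (Gen (inr b) * Gen (inr b')) (Gen (inr (b * b')))
  | amalgam_c c : amalgam_rel (Gen (inl (i c))) (Gen (inr (k c))).

Definition amalgam : groupType := presented amalgam_rel.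

End Amalgam.

Section Subgroups.
Variable G : groupType.
Implicit Types (H C : set G) (K : groupType).

Definition is_subgroup H := group_closed (mem H).

Definition cyclic_subgroup C :=
  exists c : G, C = [set x | exists n : nat, x = c ^+ n \/ x = c ^- n].

Definition finite_index C H :=
  finite_set [set [set h * c | c in C] | h in H].

Definition virtually_cyclic H :=
  is_subgroup H /\
  exists C, [/\ cyclic_subgroup C, C `<=` H & finite_index C H].

Definition maximal_virtually_cyclic H :=
  virtually_cyclic H /\
  forall L, virtually_cyclic L -> H `<=` L -> L = H.

Definition nonmaximal_virtually_cyclic H :=
  virtually_cyclic H /\ ~ maximal_virtually_cyclic H.

Definition isom_to H K :=
  exists2 f : {multiplicative K -> G}, injective f & range f = H.

(* [i] and [k] embed Q8 in the two copies of Q16; their images automatically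
   have index 2. *)
Definition isom_to_Q16_amalgam H :=
  exists i k : {multiplicative Q8 -> Q16},
    [/\ injective i, injective k & isom_to H (amalgam i k)].

End Subgroups.

(* Main.v *)
(* The elements x = s1 s3^-1 and y = s2 x s2^-1 generate a normal quaternion group
   N of B = B4(S2), and B/N is PSL(2, Z), generated by the images of
   a = s1 s2 s1 and b = s1 s2 of orders 2 and 3. As N is finite, maximal virtually
   cyclic subgroups of B are preimages of such subgroups of PSL(2, Z). There the
   centralizer of an element of infinite order is abelian and torsion-free, which
   forces an infinite virtually cyclic subgroup to be Z or Z/2 * Z/2. The preimage
   of Z is Q8 x| Z, whose type is decided by the image of a generator in
   Out(Q8) = S3 = SL(2, Z/2). An element of order 2 of PSL(2, Z) is nontrivial
   modulo 2, acts on N as an outer automorphism of order 2, and its preimage is Q16,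
   as is seen in the binary octahedral group inside SL(2, 7); the preimage of
   Z/2 * Z/2 is thus Q16 *_Q8 Q16. A subgroup T* maps onto a subgroup of order 3 of
   PSL(2, Z), which is contained in no larger virtually cyclic subgroup. *)

Require Import Defs.
From HB Require Import structures.
From mathcomp Require Import all_boot all_order all_algebra.
From mathcomp Require Import boolp classical_sets functions cardinality.
From mathcomp Require Import zify ring.

Set Implicit Arguments.
Unset Strict Implicit.
Unset Printing Implicit Defensive.

Import Order.TTheory GRing.Theory Num.Theory.

Local Open Scope classical_set_scope.
Local Open Scope group_scope.

(** * Virtually cyclic subgroups *)

(** The braid group is given only by a presentation, so every lower bound needs a representation.
    That [N] has 8 elements amounts to [bz] being nontrivial, which [rho7] detects. That the kernel
    of [rho] is no larger than [N] comes from a normal form whose image in PSL(2, Z) is computed.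
    The prime 7 is the least odd one modulo which 2 is a square: elements of order 8 in the binary
    octahedral group have a square root of 2 as trace, here 3 or -3.

    Facts on PSL(2, Z) usually drawn from its action on the hyperbolic plane are read off the
    traceless part of a matrix: commuting with an element of infinite order, being a root of it, and
    being an involution inverting it become proportionality, divisibility and orthogonality of
    integer triples.

    A class in Out(Q8) is not enough for an isomorphism type: some lift must act on [N] exactly as
    prescribed. It is found by multiplying by an element of [N] and by letting any noncommuting pair
    of [N] serve as [x], [y]. Injectivity on the amalgam again rests on a normal form, with
    alternating words mapped to the infinite dihedral group. *)

Definition zexp (G : groupType) (g : G) (k : int) : G :=
  match k with Posz n => g ^+ n | Negz n => g ^- n.+1 end.

Section IntegerPowers.
Variable G : groupType.
Implicit Types g h : G.

Lemma zexpS g k : zexp g (k + 1)%R = zexp g k * g.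
Proof.
case: k => [n|[|n]]; first by rewrite -PoszD addn1 /= expgSr.
  by rewrite /= mulVg.
rewrite (_ : (Negz n.+1 + 1)%R = Negz n) /=; last by lia.
by rewrite (expgS g n.+1) invgM mulgVK.
Qed.

Lemma zexpP g k : zexp g (k - 1)%R = zexp g k * g^-1.
Proof. by rewrite -{2}(subrK 1%R k) zexpS mulgK. Qed.

Lemma zexpD g k l : zexp g (k + l)%R = zexp g k * zexp g l.
Proof.
elim/int_rec: l => [|n IHn|n IHn]; first by rewrite addr0 mulg1.
- by rewrite -addn1 PoszD addrA !zexpS IHn mulgA.
- by rewrite -addn1 PoszD opprD addrA !zexpP IHn mulgA.
Qed.

Lemma zexpN g k : zexp g (- k)%R = (zexp g k)^-1.
Proof. by apply: (mulgI (zexp g k)); rewrite -zexpD addrN mulgV. Qed.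

Lemma zexp1 g : zexp g 1%R = g.
Proof. by []. Qed.

Lemma zexpM g k l : zexp g (k * l)%R = zexp (zexp g k) l.
Proof.
elim/int_rec: l => [|n IHn|n IHn]; first by rewrite mulr0.
- by rewrite -addn1 PoszD (zexpS (zexp g k)) -IHn -zexpD mulrDr mulr1.
- rewrite -addn1 PoszD opprD (zexpP (zexp g k)) -IHn -zexpN -zexpD.
  by rewrite mulrDr mulrN1.
Qed.

Lemma commute_zexp g h k : commute g h -> commute g (zexp h k).
Proof.
by move=> gh; case: k => n /=; [|apply: commuteV]; apply: commuteX.
Qed.

Lemma commute_zexp2 g k l : commute (zexp g k) (zexp g l).
Proof. by rewrite /commute -!zexpD addrC. Qed.

Lemma conj_zexp g h k : g * zexp h k * g^-1 = zexp (g * h * g^-1) k.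
Proof.
elim/int_rec: k => [|n IHn|n IHn]; first by rewrite /= mulg1 mulgV.
- by rewrite -addn1 PoszD !zexpS -IHn !mulgA mulgVK.
- by rewrite -addn1 PoszD opprD !zexpP -IHn !invgM invgK !mulgA mulgVK.
Qed.

Definition inf_order g := forall n, 0 < n -> g ^+ n <> 1.

Lemma inf_order_zexp g k : inf_order g -> zexp g k = 1 -> k = 0%R.
Proof.
move=> ig; case: k => n /= gn; first by case: n gn => // n /ig; case.
by case: (ig n.+1) => //; rewrite -[LHS]invgK gn invg1.
Qed.

Lemma zexp_inj g : inf_order g -> injective (zexp g).
Proof.
move=> ig k l kl; suff /(inf_order_zexp ig) : zexp g (k - l)%R = 1 by lia.
by rewrite zexpD zexpN kl mulgV.
Qed.

Lemma inf_orderX g n : 0 < n -> inf_order g -> inf_order (g ^+ n).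
Proof. by move=> n0 ig m m0; rewrite -expgnA; apply: ig; rewrite muln_gt0 n0. Qed.

Lemma inf_order_root g n : inf_order (g ^+ n) -> inf_order g.
Proof.
move=> ig m m0 gm; apply: (ig m m0).
by rewrite expgnAC gm expg1n.
Qed.

Lemma inf_orderV g : inf_order g -> inf_order g^-1.
Proof. by move=> ig n n0 gn; apply: (ig n n0); rewrite -[LHS]invgK -expVgn gn invg1. Qed.

Lemma inf_order_zexpV g k : inf_order (zexp g k) -> inf_order g.
Proof.
case: k => n /=; first exact: inf_order_root.
by rewrite -expVgn => /inf_order_root/inf_orderV; rewrite invgK.
Qed.

End IntegerPowers.

Lemma mulhomX (G H : groupType) (f : {multiplicative G -> H}) g n :
  f (g ^+ n) = f g ^+ n.
Proof. by elim: n => [|n IHn]; rewrite ?mulhom1 // !expgS gmulfM IHn. Qed.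

Lemma zexp_hom (G H : groupType) (f : {multiplicative G -> H}) g k :
  f (zexp g k) = zexp (f g) k.
Proof. by case: k => n /=; rewrite ?mulhomV mulhomX. Qed.

Lemma presented_ind (X : Type) (R : word X -> word X -> Prop)
    (T : presented R -> Prop) :
  T 1 -> (forall x a, T a -> T (pgen R x * a)) ->
  (forall x a, T a -> T ((pgen R x)^-1 * a)) -> forall a, T a.
Proof.
move=> T1 Tg TgV a.
(* The claim is strengthened to left multiplication by the value of a formal expression and by its
   inverse, so that the induction passes through products and inverses. *)
suff Tw w b : T b -> T (weval (pgen R) w * b) /\ T ((weval (pgen R) w)^-1 * b).
  by have [] := Tw (repr a) 1 T1; rewrite weval_pgen reprK mulg1.
elim: w b => [x||u IHu v IHv|u IHu] b Tb /=.
- by split; [apply: Tg | apply: TgV].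
- by rewrite invg1 mul1g.
- split; first by rewrite -mulgA; apply: (IHu _ (IHv _ Tb).1).1.
  by rewrite invgM -mulgA; apply: (IHv _ (IHu _ Tb).2).2.
- by rewrite invgK; have [] := IHu _ Tb.
Qed.

Section VirtuallyCyclicBy.
Variable G : groupType.
Implicit Types (H : set G) (c g h : G) (s : seq G).

Lemma subgroup1 H : is_subgroup H -> H 1.
Proof. by case=> /set_mem. Qed.

Lemma subgroupM H g h : is_subgroup H -> H g -> H h -> H (g * h).
Proof. by move=> /group_closedM HM Hg Hh; apply/set_mem/HM; apply/mem_set. Qed.

Lemma subgroupV H g : is_subgroup H -> H g -> H g^-1.
Proof. by move=> /group_closedV HV Hg; apply/set_mem/HV; apply/mem_set. Qed.

Lemma subgroupZ H g k : is_subgroup H -> H g -> H (zexp g k).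
Proof.
move=> sH Hg; elim/int_rec: k => [|n IHn|n IHn]; first exact: subgroup1.
- by rewrite -addn1 PoszD zexpS; apply: subgroupM.
- by rewrite -addn1 PoszD opprD zexpP; exact: subgroupM sH IHn (subgroupV sH Hg).
Qed.

Lemma is_subgroupP H :
  H 1 -> (forall g h, H g -> H h -> H (g * h)) ->
  (forall g, H g -> H g^-1) -> is_subgroup H.
Proof.
move=> H1 HM HV; split; first exact/mem_set.
by move=> g h /set_mem Hg /set_mem Hh; apply/mem_set/HM => //; apply: HV.
Qed.

(** [s] covers the left cosets of the powers of [c] in [H]; its members need not belong to [H]. *)
Definition vc_by H c s :=
  [/\ is_subgroup H, H c &
      forall g, H g -> exists2 h, h \in s & exists k, g = h * zexp c k].

Lemma zexp_nat c x :
  (exists k, x = zexp c k) <-> (exists n : nat, x = c ^+ n \/ x = c ^- n).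
Proof.
split=> [[[n|n] ->]|[n [->|->]]].
- by exists n; left.
- by exists n.+1; right.
- by exists n.
- by exists (- (Posz n))%R; rewrite zexpN.
Qed.

Lemma virtually_cyclicP H :
  virtually_cyclic H <-> exists c s, vc_by H c s.
Proof.
split=> [[sH [C [[c Cc] CH fC]]]|[c [s [sH Hc cs]]]].
  have Hc : H c by apply: CH; rewrite Cc; exists 1%N; left; rewrite expg1.
  have /finite_seqP[t tE] := fC.
  (* One member of [H] is chosen in each coset; the default 1 is never reached, since every set
     listed in [t] is a coset. *)
  exists c, [seq xget 1 [set h | H h /\ K = [set h * x | x in C]] | K <- t].
  split=> // g Hg.
  set K := [set g * x | x in C].
  have Kt : K \in t.
    have : [set` t] K by rewrite -tE; exists g.
    by [].
  exists (xget 1 [set h | H h /\ K = [set h * x | x in C]]).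
    by apply/mapP; exists K.
  case: xgetP => [h _ [Hh KE]|]; last by move=> /(_ g); case.
  have : K g.
    by exists 1; rewrite ?mulg1// Cc; exists 0%N; left.
  rewrite KE => -[x Cx <-].
  suff /zexp_nat[k ->] : (exists n : nat, x = c ^+ n \/ x = c ^- n) by exists k.
  by move: Cx; rewrite Cc.
split=> //; set C := [set x | exists n : nat, x = c ^+ n \/ x = c ^- n].
have CE x : C x <-> exists k, x = zexp c k by split => /zexp_nat.
exists C; split; first by exists c.
  by move=> _ /CE[k ->]; apply: subgroupZ.
have fs : finite_set [set [set h * x | x in C] | h in [set` s]].
  exact: finite_image.
apply: sub_finite_set fs => _ [g Hg <-].
have [h hs [k gE]] := cs _ Hg; exists h => //.
apply/seteqP; split=> _ [_ /CE[l ->] <-].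
- exists (zexp c (l - k)); first by apply/CE; eexists.
  by rewrite gE -mulgA -zexpD; congr (_ * zexp _ _); lia.
- exists (zexp c (k + l)); first by apply/CE; eexists.
  by rewrite gE -mulgA -zexpD.
Qed.

Lemma vc_by_finite H c s :
  vc_by H c s -> ~ inf_order c -> finite_set H.
Proof.
move=> [_ _ cs] /existsNP[n /not_implyP[n0 /contrapT cn]].
have fs : finite_set [set h * c ^+ i | h in [set` s] & i in `I_n].
  by apply: finite_image2.
apply: sub_finite_set fs => g /cs[h hs [k ->]].
exists h => //; exists (absz (k %% (Posz n))%Z) => /=; first by lia.
congr (_ * _).
rewrite -[c ^+ _]/(zexp c (absz (k %% (Posz n))%Z)).
have -> : (Posz (absz (k %% Posz n)%Z)) = (k %% (Posz n))%Z by lia.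
transitivity (zexp c (Posz n * (k %/ n)%Z + (k %% n)%Z)%R); last by congr zexp; lia.
rewrite [RHS]zexpD zexpM /= cn.
suff -> : zexp (1 : G) (k %/ n)%Z = 1 by rewrite mul1g.
by case: (k %/ n)%Z => m /=; rewrite expg1n // invg1.
Qed.

Lemma finite_virtually_cyclic H :
  is_subgroup H -> finite_set H -> virtually_cyclic H.
Proof.
move=> sH /finite_seqP[s sE]; apply/virtually_cyclicP; exists 1, s.
split=> //; first exact: subgroup1.
by move=> g; rewrite sE => gs; exists g => //; exists 0%R; rewrite mulg1.
Qed.

Lemma pigeonhole_nat (f : nat -> nat) N :
  (forall n, f n < N) -> exists m n, m < n /\ f m = f n.
Proof.
move=> fN; have /negP : ~~ uniq [seq f i | i <- iota 0 N.+1].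
  apply/negP => u.
  have : {subset [seq f i | i <- iota 0 N.+1] <= iota 0 N}.
    by move=> _ /mapP[i _ ->]; rewrite mem_iota add0n fN.
  by move=> /(uniq_leq_size u); rewrite size_map !size_iota ltnn.
move=> nu; apply: contrapT => nE; apply: nu.
rewrite map_inj_in_uniq ?iota_uniq// => i j _ _ fij.
case: (ltngtP i j) => // ij; case: nE; first by exists i, j.
by exists j, i.
Qed.

(** Two powers of [g] fall into the same coset of the powers of [c], and their quotient is the
    required power. *)
Lemma vc_by_power H c s g :
  vc_by H c s -> H g -> exists2 n, 0 < n & exists k, g ^+ n = zexp c k.
Proof.
move=> [sH Hc cs] Hg.
have /choice[f fP] n : exists i, i < size s /\ exists k, g ^+ n = nth 1 s i * zexp c k.
  have [h hs kE] := cs _ (subgroupZ n sH Hg).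
  by exists (index h s); rewrite index_mem nth_index.
have [m [n [mn fmn]]] := pigeonhole_nat (fun n => proj1 (fP n)).
exists (n - m); first by rewrite subn_gt0.
have [_ [k kE]] := fP m; have [_ [l lE]] := fP n.
exists (l - k)%R; rewrite addrC zexpD zexpN.
apply: (mulgI (g ^+ m)); rewrite -expgnDr subnKC 1?ltnW// lE kE fmn.
by rewrite -!mulgA mulVKg.
Qed.

End VirtuallyCyclicBy.

(* The elements of [H] commuting with a power of [c] form an abelian torsion-free
   group in which [c] has finite index, so some fixed power embeds it in [<c>] and
   it is cyclic. Every other element of [H] inverts a power of [c], hence inverts
   this cyclic group; its square is then inverted by and equal to itself. *)
Section Structure.
Variable P : groupType.
Implicit Types (c g h w : P).

Definition centralizers_abelian_torsion_free :=
  forall c g h : P, inf_order c -> commute c g -> commute c h ->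
  commute g h /\ (forall n, 0 < n -> g ^+ n = 1 -> g = 1).

Hypothesis tfc : centralizers_abelian_torsion_free.

Variables (H : set P) (c : P) (s : seq P).
Hypotheses (vcH : vc_by H c s) (ic : inf_order c).

Let sH : is_subgroup H. Proof. by case: vcH. Qed.
Let Hc : H c. Proof. by case: vcH. Qed.

(** A power of [c] is allowed instead of [c] itself, because conjugation by an element of [H] is
    only known to carry some power of [c] to a power of [c]. *)
Let Cen g := H g /\ exists2 n, 0 < n & commute (c ^+ n) g.

Let Cen_pow g m : 0 < m -> H g -> commute (c ^+ m) g -> Cen g.
Proof. by move=> m0 Hg cg; split=> //; exists m. Qed.

Let CenC g h : Cen g -> Cen h -> commute g h.
Proof.
move=> [_ [m m0 cm]] [_ [n n0 cn]].
have mn0 : 0 < m * n by rewrite muln_gt0 m0.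
apply: (proj1 (tfc (c := c ^+ (m * n)) (inf_orderX mn0 ic) _ _)).
  by rewrite expgnA; apply/commute_sym/commuteX/commute_sym.
by rewrite mulnC expgnA; apply/commute_sym/commuteX/commute_sym.
Qed.

Let Cen_tf g n : Cen g -> 0 < n -> g ^+ n = 1 -> g = 1.
Proof.
move=> [_ [m m0 cm]].
exact: (proj2 (tfc (c := c ^+ m) (inf_orderX m0 ic) cm cm)).
Qed.

Let CenM g h : Cen g -> Cen h -> Cen (g * h).
Proof.
move=> [Hg [m m0 cm]] [Hh [n n0 cn]].
split; first exact: subgroupM.
exists (m * n)%N; first by rewrite muln_gt0 m0.
apply: commuteM; first by rewrite expgnA; apply/commute_sym/commuteX/commute_sym.
by rewrite mulnC expgnA; apply/commute_sym/commuteX/commute_sym.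
Qed.

Let Cen_c k : Cen (zexp c k).
Proof.
split; first exact: subgroupZ.
by exists 1%N => //; rewrite expg1; apply: commute_zexp.
Qed.

Let CenZ g k : Cen g -> Cen (zexp g k).
Proof.
move=> [Hg [n n0 cn]]; split; first exact: subgroupZ.
by exists n => //; apply: commute_zexp.
Qed.

(** The exponent is built along the coset list: a coset that meets [Cen] contributes a factor [n]
    such that the [n]-th power of one of its members [g0] is a power of [c]; the other cosets
    contribute nothing. *)
Let Cen_exponent : exists2 M, 0 < M & forall g, Cen g -> exists k, g ^+ M = zexp c k.
Proof.
suff [M M0 cM] : exists2 M, 0 < M & forall g, Cen g ->
    (exists2 h, h \in s & exists k, g = h * zexp c k) -> exists k, g ^+ M = zexp c k.
  exists M => // g Cg; apply: cM => //; have [_ _ cs] := vcH.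
  by apply: cs; case: Cg.
elim: (s) => [|h t [M M0 IH]]; first by exists 1%N => // g _ [].
have [[g0 Cg0 [k0 g0E]]|nE] :=
    pselect (exists2 g0, Cen g0 & exists k, g0 = h * zexp c k).
  have [n n0 [l g0n]] := vc_by_power vcH (proj1 Cg0).
  exists (n * M)%N => [|g Cg [h']]; first by rewrite muln_gt0 n0.
  rewrite inE => /orP[/eqP-> [k gE]|h't [k gE]]; last first.
    have [|r gM] := IH g Cg; first by exists h' => //; exists k.
    exists (r * n)%R; rewrite mulnC expgnA gM -[in LHS]/(zexp _ (Posz n)).
    by rewrite -zexpM.
  have {gE} -> : g = g0 * zexp c (k - k0).
    by rewrite g0E -mulgA -zexpD gE; congr (_ * zexp _ _); lia.
  exists ((l + (k - k0) * n) * M)%R.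
  rewrite expgnA expgMn; last exact: CenC.
  by rewrite g0n -[zexp c (k - k0) ^+ n]/(zexp (zexp c (k - k0)) n) -zexpM -zexpD zexpM.
exists M => // g Cg [h']; rewrite inE => /orP[/eqP-> [k gE]|h't kE].
  by case: nE; exists g => //; exists k.
by apply: IH => //; exists h'.
Qed.

(** Among the [w] in [Cen] with [w ^+ M = c ^+ n], one with least positive [n] is taken. Dividing
    the exponent of any other element by [n] leaves an element of [Cen] whose [M]-th power must be
    1, and [Cen] is torsion-free. *)
Let Cen_cyclic : exists2 w, Cen w & inf_order w /\ forall g, Cen g -> exists k, g = zexp w k.
Proof.
have [M M0 cM] := Cen_exponent.
pose Q n := `[< 0 < n /\ exists2 w, Cen w & w ^+ M = c ^+ n >].
have exQ : exists n, Q n.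
  exists M; apply/asboolP; split=> //; exists c => //; exact: (Cen_c 1).
have [n /asboolP[n0 [w Cw wM]] nmin] := ex_minnP exQ.
exists w => //; split.
  by apply: (@inf_order_root _ _ M); rewrite wM; apply: inf_orderX.
move=> g Cg; have [k gM] := cM _ Cg.
pose q := (k %/ (Posz n))%Z; exists q.
have Cv : Cen (g * zexp w (- q)%R) by apply/CenM => //; apply: CenZ.
suff : g * zexp w (- q)%R = 1 by rewrite zexpN => /divg1_eq.
have vM : (g * zexp w (- q)%R) ^+ M = zexp c (k %% (Posz n))%Z.
  rewrite expgMn; last by apply: CenC => //; apply: CenZ.
  rewrite gM -[X in _ * X]/(zexp _ (Posz M)) -zexpM mulrC zexpM.
  rewrite -[zexp w M]/(w ^+ M) wM -[c ^+ n]/(zexp c (Posz n)) -zexpM -zexpD.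
  by congr (zexp c _); rewrite /q; lia.
have [r0|r0] := eqVneq (absz (k %% (Posz n))%Z) 0.
  by apply: (Cen_tf Cv M0); rewrite vM (_ : (k %% (Posz n))%Z = 0%R) //; lia.
have /nmin : Q (absz (k %% (Posz n))%Z).
  apply/asboolP; split; first by rewrite lt0n.
  exists (g * zexp w (- q)%R) => //; rewrite vM -[RHS]/(zexp c (Posz _)).
  by congr (zexp c _); lia.
lia.
Qed.

(** Conjugation by [g] sends some [c ^+ n] to [zexp c m]. Iterating it [a] times, where [g ^+ a] is
    a power of [c], gives n^a = m^a, so m = n or m = -n; the first would put [g] in [Cen]. *)
Let notCen_inverts g : H g -> ~ Cen g ->
  exists2 n, 0 < n & g * c ^+ n * g^-1 = c ^- n.
Proof.
move=> Hg nCg.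
have Hd : H (g * c * g^-1) := subgroupM sH (subgroupM sH Hg Hc) (subgroupV sH Hg).
have [n n0 [m dn]] := vc_by_power vcH Hd.
have gcn : g * c ^+ n * g^-1 = zexp c m by rewrite -dn; exact: (conj_zexp g c n).
have [a a0 [l ga]] := vc_by_power vcH Hg.
have it r : g ^+ r * zexp c ((Posz n) ^+ r)%R * g ^- r = zexp c (m ^+ r)%R.
  elim: r => [|r IH]; first by rewrite /= mul1g invg1 mulg1.
  have -> : zexp c (Posz n ^+ r.+1)%R = zexp (zexp c n) (Posz n ^+ r)%R.
    by rewrite -zexpM -exprS.
  transitivity (g ^+ r * (g * zexp (zexp c n) (Posz n ^+ r)%R * g^-1) * g ^- r).
    by rewrite expgSr invgM !mulgA.
  rewrite conj_zexp -[zexp c n]/(c ^+ n) gcn -zexpM mulrC zexpM conj_zexp IH.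
  by rewrite -zexpM -exprSr.
have /(zexp_inj ic) : zexp c ((Posz n) ^+ a)%R = zexp c (m ^+ a)%R.
  by rewrite -it ga commute_zexp2 mulgK.
move=> /(congr1 (fun k : int => absz k)); rewrite !abszX => /eqP.
rewrite eqn_exp2r //= => /eqP nm.
have [mE|mE] : m = (Posz n) \/ m = (- (Posz n))%R by lia.
  case: nCg; apply: (Cen_pow n0 Hg).
  by rewrite /commute -[in LHS](_ : g * c ^+ n * g^-1 = c ^+ n) ?mulgVK// gcn mE.
by exists n => //; rewrite gcn mE zexpN.
Qed.

Theorem virtually_cyclic_structure :
  exists w, [/\ H w, inf_order w & forall g, H g ->
    (exists k, g = zexp w k) \/ [/\ g * w = w^-1 * g, g * g = 1 & g <> 1]].
Proof.
have [w Cw [iw wP]] := Cen_cyclic.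
exists w; split=> // [|g Hg]; first by case: Cw.
have [Cg|nCg] := pselect (Cen g); [by left; apply: wP | right].
have [n n0 gcn] := notCen_inverts Hg nCg.
have conj_c m : g * zexp c (Posz n * m)%R * g^-1 = zexp c (- (Posz n * m))%R.
  by rewrite zexpM conj_zexp gcn -[c ^- n]/((zexp c n)^-1) -zexpN -zexpM mulNr.
have gwE x y : commute x y -> commute (g * x * g^-1) (g * y * g^-1).
  by move=> xy; rewrite /commute !mulgA !mulgVK -!(mulgA g) xy.
have gHg x : H x -> H (g * x * g^-1).
  by move=> Hx; apply: subgroupM sH (subgroupM sH Hg Hx) (subgroupV sH Hg).
have Cwg : Cen (g * w * g^-1).
  have [Hw [m m0 cm]] := Cw; split; first exact: gHg.
  exists (n * m)%N; first by rewrite muln_gt0 n0.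
  apply: commute_sym.
  rewrite -[c ^+ (n * m)]invgK; apply: commuteV.
  rewrite -[c ^- (n * m)]/((zexp c (n * m)%N)^-1) -zexpN PoszM -conj_c; apply: gwE.
  by rewrite mulrC zexpM; apply/commute_zexp/commute_sym.
have [l lE] := wP _ Cwg.
have [k0 k0E] := wP _ (Cen_c 1); rewrite zexp1 in k0E.
have k0_neq0 : k0 <> 0%R by move=> k00; apply: (ic (n := 1%N)) => //; rewrite k0E k00.
(* Conjugation by [g] raises [w] to the power [l] and inverts [c ^+ n], which is a nontrivial power
   of [w]. *)
have lN1 : l = (- 1)%R.
  have := conj_c 1%R; rewrite k0E -!zexpM conj_zexp lE -zexpM => /(zexp_inj iw).
  by nia.
rewrite lN1 in lE.
have Cgg : Cen (g * g).
  split; first exact: subgroupM.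
  exists n => //; apply: commute_sym.
  have conj_cn : g * zexp c n * g^-1 = zexp c (- Posz n)%R by rewrite zexpN.
  have conj_cNn : g * zexp c (- Posz n)%R * g^-1 = zexp c n.
    by have := conj_c (-1)%R; rewrite mulrN1 opprK.
  rewrite -[c ^+ n]/(zexp c n) /commute -[in RHS]conj_cNn -conj_cn.
  by rewrite !mulgA !mulgVK.
have [k kE] := wP _ Cgg.
have k0' : k = 0%R.
  have := conj_zexp g w k; rewrite lE -kE mulgA mulgK kE -zexpM => /(zexp_inj iw).
  by lia.
split; last by move=> g1; apply: nCg; rewrite g1; apply: (Cen_c 0).
- by rewrite -[w^-1]/(zexp w (-1)%R) -lE mulgVK.
- by rewrite kE k0'.
Qed.

End Structure.

(** * The modular group *)

Section SL2.
Variable R : comNzRingType.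
Local Open Scope ring_scope.

Definition det2 (m : R * R * R * R) : R :=
  let: (a, b, c, d) := m in a * d - b * c.

(** Quadruples keep the entries accessible to computation: identities over ['F_7], ['F_3] and [bool]
    are then decided by evaluation. *)
Record sl2 := SL2 { sl2_val :> R * R * R * R; _ : det2 sl2_val == 1 }.

HB.instance Definition _ := [isSub for sl2_val].
HB.instance Definition _ := [Choice of sl2 by <:].

Definition e11 (m : sl2) := m.1.1.1.
Definition e12 (m : sl2) := m.1.1.2.
Definition e21 (m : sl2) := m.1.2.
Definition e22 (m : sl2) := m.2.

Lemma sl2_det (m : sl2) : e11 m * e22 m - e12 m * e21 m = 1.
Proof. by case: m => [[[[a b] c] d] md]; apply/eqP. Qed.

Lemma sl2P (m n : sl2) :
  [/\ e11 m = e11 n, e12 m = e12 n, e21 m = e21 n & e22 m = e22 n] -> m = n.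
Proof.
case: m n => -[[[a b] c] d] m1 [[[[a' b'] c'] d'] n1] [] /=.
by rewrite /e11 /e12 /e21 /e22 /= => *; apply: val_inj => /=; congr (_, _, _, _).
Qed.

Ltac sl2_ring :=
  apply: sl2P; split; do 3 rewrite /e11 /e12 /e21 /e22 /=; ring.

Fact sl2_mul_det (m n : sl2) :
  det2 (e11 m * e11 n + e12 m * e21 n, e11 m * e12 n + e12 m * e22 n,
        e21 m * e11 n + e22 m * e21 n, e21 m * e12 n + e22 m * e22 n) == 1.
Proof.
apply/eqP; rewrite -[RHS](mulr1 1) -{1}(sl2_det m) -(sl2_det n) /=; ring.
Qed.

Fact sl2_one_det : det2 (1, 0, 0, 1) == 1.
Proof. by rewrite /= mul0r subr0 mulr1. Qed.

Fact sl2_inv_det (m : sl2) : det2 (e22 m, - e12 m, - e21 m, e11 m) == 1.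
Proof. by apply/eqP; rewrite -(sl2_det m) /=; ring. Qed.

Definition sl2_mul (m n : sl2) := SL2 (sl2_mul_det m n).
Definition sl2_one := SL2 sl2_one_det.
Definition sl2_inv (m : sl2) := SL2 (sl2_inv_det m).

Fact sl2_mulA : associative sl2_mul.
Proof. by move=> m n p; sl2_ring. Qed.
Fact sl2_mul1g : left_id sl2_one sl2_mul.
Proof. move=> m; sl2_ring. Qed.
Fact sl2_mulg1 : right_id sl2_one sl2_mul.
Proof. move=> m; sl2_ring. Qed.
Fact sl2_mulVg : left_inverse sl2_one sl2_inv sl2_mul.
Proof.
move=> m; apply: sl2P; split;
  [rewrite -[RHS](sl2_det m) | | | rewrite -[RHS](sl2_det m)];
  do 3 rewrite /e11 /e12 /e21 /e22 /=; ring.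
Qed.
Fact sl2_mulgV : right_inverse sl2_one sl2_inv sl2_mul.
Proof.
move=> m; apply: sl2P; split;
  [rewrite -[RHS](sl2_det m) | | | rewrite -[RHS](sl2_det m)];
  do 3 rewrite /e11 /e12 /e21 /e22 /=; ring.
Qed.

HB.instance Definition _ := isGroup.Build sl2
  sl2_mulA sl2_mul1g sl2_mulg1 sl2_mulVg sl2_mulgV.

Fact sl2_opp_det (m : sl2) : det2 (- e11 m, - e12 m, - e21 m, - e22 m) == 1.
Proof. by apply/eqP; rewrite -(sl2_det m) /=; ring. Qed.

Definition sl2_opp (m : sl2) := SL2 (sl2_opp_det m).

Lemma sl2_oppK : involutive sl2_opp.
Proof. by move=> m; apply: sl2P; split; apply: opprK. Qed.

Lemma sl2_mulNg (m n : sl2) : (sl2_opp m * n = sl2_opp (m * n))%g.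
Proof. by sl2_ring. Qed.

Lemma sl2_mulgN (m n : sl2) : (m * sl2_opp n = sl2_opp (m * n))%g.
Proof. by sl2_ring. Qed.

Definition mtrace (m : sl2) := e11 m + e22 m.

Lemma sl2_mulE (m n : sl2) :
  ((e11 (m * n)%g = (e11 m * e11 n + e12 m * e21 n)%R) *
   (e12 (m * n)%g = (e11 m * e12 n + e12 m * e22 n)%R) *
   (e21 (m * n)%g = (e21 m * e11 n + e22 m * e21 n)%R) *
   (e22 (m * n)%g = (e21 m * e12 n + e22 m * e22 n)%R))%type.
Proof. by []. Qed.

Lemma sl2_oneE : ((e11 1%g = 1%R) * (e12 1%g = 0%R) * (e21 1%g = 0%R) * (e22 1%g = 1%R))%type.
Proof. by []. Qed.

Lemma sl2_oppE (m : sl2) :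
  ((e11 (sl2_opp m) = (- e11 m)%R) * (e12 (sl2_opp m) = (- e12 m)%R) *
   (e21 (sl2_opp m) = (- e21 m)%R) * (e22 (sl2_opp m) = (- e22 m)%R))%type.
Proof. by []. Qed.

End SL2.

(** Adding the determinant to the diagonal entries of [m * m] gives tr(m) a = tr(m) d = 2. The trace
    is therefore nonzero, and it multiplies both off-diagonal entries to 0. *)
Lemma sl2_involution (F : fieldType) (m : sl2 F) :
  (2%:R != 0 :> F)%R -> m * m = 1 -> m = 1 \/ m = sl2_opp 1.
Proof.
move=> F2 mm.
have [E11 E12 E21 E22] : [/\ e11 (m * m) = 1%R, e12 (m * m) = 0%R,
    e21 (m * m) = 0%R & e22 (m * m) = 1%R].
  by rewrite mm.
move: E11 E12 E21 E22; rewrite !sl2_mulE; have := sl2_det m.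
set a := e11 m; set b := e12 m; set c := e21 m; set d := e22 m => D E11 E12 E21 E22.
have ta : ((a + d) * a = 2%:R)%R.
  by rewrite -[RHS]/(1 + 1)%R -{1}E11 -D; ring.
have td : ((a + d) * d = 2%:R)%R.
  by rewrite -[RHS]/(1 + 1)%R -{1}E22 -D; ring.
have t0 : (a + d != 0)%R by apply: contraNneq F2 => t0; rewrite -ta t0 mul0r.
have b0 : b = 0%R by apply: (mulfI t0); rewrite mulr0 -E12; ring.
have c0 : c = 0%R by apply: (mulfI t0); rewrite mulr0 -E21; ring.
have ad : a = d by apply: (mulfI t0); rewrite ta td.
have /eqP : (a * a = 1)%R by rewrite -E11 b0 mul0r addr0.
rewrite -expr2 sqrf_eq1 => /orP[] /eqP a1; [left|right]; apply: sl2P.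
  by rewrite -/a -/b -/c -/d -ad a1 b0 c0.
by rewrite !sl2_oppE !sl2_oneE -/a -/b -/c -/d -ad a1 b0 c0 oppr0.
Qed.

Section PSL2Z.

Definition eq_sign (m n : sl2 int) : bool := (m == n) || (m == sl2_opp n).

Lemma eq_sign_refl : reflexive eq_sign.
Proof. by move=> m; rewrite /eq_sign eqxx. Qed.

Lemma eq_sign_sym : symmetric eq_sign.
Proof.
move=> m n; rewrite /eq_sign [m == n]eq_sym; congr (_ || _).
by rewrite eq_sym (inv_eq (@sl2_oppK _)).
Qed.

Lemma eq_sign_trans : transitive eq_sign.
Proof.
move=> n m p /orP[]/eqP-> /orP[]/eqP->; rewrite /eq_sign ?eqxx ?orbT //.
by rewrite sl2_oppK eqxx.
Qed.

Canonical eq_sign_equiv := EquivRel eq_sign eq_sign_refl eq_sign_sym eq_sign_trans.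

Local Open Scope quotient_scope.

Definition psl : Type := {eq_quot eq_sign_equiv}.

HB.instance Definition _ := Choice.on psl.
HB.instance Definition _ := EqQuotient.on psl.

Definition psl_pi (m : sl2 int) : psl := \pi_psl m.

Lemma psl_piP m n : psl_pi m = psl_pi n <-> m = n \/ m = sl2_opp n.
Proof.
split; first by move=> /eqmodP/orP[]/eqP; [left|right].
by move=> mn; apply/eqmodP/orP; case: mn => ->; rewrite eqxx; [left|right].
Qed.

Lemma psl_pi_surj (a : psl) : exists m, a = psl_pi m.
Proof. by exists (repr a); rewrite /psl_pi reprK. Qed.

Lemma psl_repr m : repr (psl_pi m) = m \/ repr (psl_pi m) = sl2_opp m.
Proof. by apply/psl_piP; rewrite /psl_pi reprK. Qed.

Definition psl_mul (a b : psl) := psl_pi (repr a * repr b).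
Definition psl_one := psl_pi 1.
Definition psl_inv (a : psl) := psl_pi (repr a)^-1.

Lemma psl_mulE m n : psl_mul (psl_pi m) (psl_pi n) = psl_pi (m * n).
Proof.
apply/psl_piP; case: (psl_repr m) => ->; case: (psl_repr n) => ->.
- by left.
- by right; rewrite sl2_mulgN.
- by right; rewrite sl2_mulNg.
- by left; rewrite sl2_mulgN sl2_mulNg sl2_oppK.
Qed.

Lemma psl_invE m : psl_inv (psl_pi m) = psl_pi m^-1.
Proof.
apply/psl_piP; case: (psl_repr m) => ->; [by left | right].
by apply: (mulgI (sl2_opp m)); rewrite mulgV sl2_mulgN sl2_mulNg mulgV sl2_oppK.
Qed.

Fact psl_mulA : associative psl_mul.
Proof.
move=> a b c; have [m ->] := psl_pi_surj a; have [n ->] := psl_pi_surj b.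
by have [p ->] := psl_pi_surj c; rewrite !psl_mulE mulgA.
Qed.
Fact psl_mul1g : left_id psl_one psl_mul.
Proof. by move=> a; have [m ->] := psl_pi_surj a; rewrite psl_mulE mul1g. Qed.
Fact psl_mulg1 : right_id psl_one psl_mul.
Proof. by move=> a; have [m ->] := psl_pi_surj a; rewrite psl_mulE mulg1. Qed.
Fact psl_mulVg : left_inverse psl_one psl_inv psl_mul.
Proof. by move=> a; have [m ->] := psl_pi_surj a; rewrite psl_invE psl_mulE mulVg. Qed.
Fact psl_mulgV : right_inverse psl_one psl_inv psl_mul.
Proof. by move=> a; have [m ->] := psl_pi_surj a; rewrite psl_invE psl_mulE mulgV. Qed.

HB.instance Definition _ := isGroup.Build psl
  psl_mulA psl_mul1g psl_mulg1 psl_mulVg psl_mulgV.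

Lemma psl_piM : {morph psl_pi : m n / m * n}.
Proof. by move=> m n; rewrite -psl_mulE. Qed.

HB.instance Definition _ := isMultiplicative.Build (sl2 int) psl psl_pi psl_piM.

End PSL2Z.

Section Matrices.
Local Open Scope ring_scope.
Implicit Types (m n : sl2 int) (a b c : psl).

Lemma psl_pi1 m : psl_pi m = 1%g <-> [/\ e12 m = 0, e21 m = 0 & e11 m = e22 m].
Proof.
rewrite -[1%g]/(psl_pi 1%g) psl_piP; split=> [[->|->] //|[m12 m21 m1122]].
have := sl2_det m; rewrite m12 mul0r subr0 m1122 => mm.
have [m1|m1] : e22 m = 1 \/ e22 m = -1 by nia.
  by left; apply: sl2P; rewrite m12 m21 m1122 m1.
by right; apply: sl2P; rewrite !sl2_oppE m12 m21 m1122 m1.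
Qed.

(* By Cayley-Hamilton m^(n+1) = u m - u' where u and u' are consecutive values
   of the Chebyshev recursion with parameter the trace. *)
Lemma sl2_expgS m (k : nat) : exists u u' : int,
  [/\ e11 (m ^+ k.+1)%g = u * e11 m - u', e12 (m ^+ k.+1)%g = u * e12 m,
      e21 (m ^+ k.+1)%g = u * e21 m, e22 (m ^+ k.+1)%g = u * e22 m - u' &
      2 <= `|mtrace m| -> `|u'| + 1 <= `|u| /\ (k.+1 : int) <= `|u|].
Proof.
elim: k => [|k [u [u' [E11 E12 E21 E22 uP]]]].
  by exists 1, 0; rewrite expg1; split; rewrite ?mul1r ?subr0.
have D := sl2_det m.
exists (u * mtrace m - u'), u; rewrite expgSr !sl2_mulE E11 E12 E21 E22 /mtrace.
move: uP; rewrite /mtrace; move: (e11 m) (e12 m) (e21 m) (e22 m) D => a b c d D uP.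
have ad : a * d = 1 + b * c by rewrite -D; ring.
split.
- by transitivity (u * a * a + u * (a * d) - u' * a - u); [rewrite ad|]; ring.
- by ring.
- by ring.
- by transitivity (u * d * d + u * (a * d) - u' * d - u); [rewrite ad|]; ring.
move=> t2; have [u1 u2] := uP t2.
have : 2 * `|u| <= `|u * (a + d)| by rewrite normrM mulrC ler_wpM2l.
have := lerB_dist (u * (a + d)) u'.
by lia.
Qed.

Lemma psl_piX m k : (psl_pi m ^+ k)%g = psl_pi (m ^+ k)%g.
Proof. by rewrite mulhomX. Qed.

(** An integral trace of absolute value below 2 is 0, 1 or -1, and the square or the cube of the
    matrix is then scalar. *)
Lemma psl_inf_order m : inf_order (psl_pi m) -> 2 <= `|mtrace m|.
Proof.
move=> im; case: (lerP 2 `|mtrace m|) => // t2.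
have D := sl2_det m.
have [t0|t1] : mtrace m = 0 \/ mtrace m ^+ 2 = 1 by nia.
  case: (im 2%N) => //; rewrite psl_piX; apply/psl_pi1.
  rewrite expg2 !sl2_mulE; move: t0; rewrite /mtrace => t0.
  have -> : e22 m = - e11 m by lia.
  by split; ring.
case: (im 3%N) => //; rewrite psl_piX; apply/psl_pi1.
rewrite !expgS expg0 mulg1 !sl2_mulE; move: t1; rewrite /mtrace.
move: (e11 m) (e12 m) (e21 m) (e22 m) D => a b c d D t1.
(* By Cayley-Hamilton the traceless part of [m ^+ 3] is tr^2 - det times that of [m]. *)
have {}t1 : (a + d) ^+ 2 - (a * d - b * c) = 0 by rewrite t1 D subrr.
by split; apply: subr0_eq; rewrite ?subr0;
  [rewrite -[RHS](mulr0 b)|rewrite -[RHS](mulr0 c)|rewrite -[RHS](mulr0 (a - d))];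
  rewrite -t1; ring.
Qed.

Lemma psl_expgS_neq1 m (k : nat) :
  2 <= `|mtrace m| -> psl_pi m <> 1%g -> (psl_pi m ^+ k.+1)%g <> 1%g.
Proof.
move=> t2 m1; rewrite psl_piX => /psl_pi1[].
have [u [u' [-> -> -> -> /(_ t2)[_ uk]]]] := sl2_expgS m k.
have u0 : u != 0 by lia.
move=> /eqP; rewrite mulf_eq0 (negPf u0) /= => /eqP m12 /eqP.
rewrite mulf_eq0 (negPf u0) /= => /eqP m21 /addIr/(mulfI u0) m1122.
by apply/m1/psl_pi1.
Qed.

End Matrices.

(** * Centralizers, torsion and involutions in PSL(2, Z) *)

Section Matrices.
Local Open Scope ring_scope.
Implicit Types (m n : sl2 int) (a b c : psl).

(* [(e12, e21, e11 - e22)] are the coordinates of the traceless part of a matrix;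
   those of [m] and [n] are proportional when the 2x2 minors vanish. *)
Definition parallel m n :=
  [/\ e12 m * e21 n = e12 n * e21 m,
      e12 m * (e11 n - e22 n) = e12 n * (e11 m - e22 m) &
      e21 m * (e11 n - e22 n) = e21 n * (e11 m - e22 m)].

Lemma parallel_commute m n : parallel m n <-> commute m n.
Proof.
split=> [[H1 H2 H3]|mn].
  apply: sl2P; rewrite !sl2_mulE.
  split; apply: subr0_eq.
  - by transitivity (e12 m * e21 n - e12 n * e21 m); [ring | rewrite H1 subrr].
  - transitivity (e12 n * (e11 m - e22 m) - e12 m * (e11 n - e22 n)); first by ring.
    by rewrite H2 subrr.
  - transitivity (e21 m * (e11 n - e22 n) - e21 n * (e11 m - e22 m)); first by ring.
    by rewrite H3 subrr.
  - by transitivity (e12 n * e21 m - e12 m * e21 n); [ring | rewrite H1 subrr].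
have E11 : e11 (m * n)%g - e11 (n * m)%g = 0 by rewrite mn subrr.
have E12 : e12 (m * n)%g - e12 (n * m)%g = 0 by rewrite mn subrr.
have E21 : e21 (m * n)%g - e21 (n * m)%g = 0 by rewrite mn subrr.
rewrite !sl2_mulE in E11 E12 E21.
by split; apply: subr0_eq; [rewrite -E11|rewrite -[RHS]oppr0 -E12|rewrite -E21]; ring.
Qed.

Lemma psl_commute m n : 2 <= `|mtrace m| ->
  commute (psl_pi m) (psl_pi n) -> parallel m n.
Proof.
move=> t2; rewrite /commute -!psl_piM => /psl_piP[|mn]; first by move/parallel_commute.
have E11 : e11 (m * n)%g + e11 (n * m)%g = 0 by rewrite mn addNr.
have E12 : e12 (m * n)%g + e12 (n * m)%g = 0 by rewrite mn addNr.
have E21 : e21 (m * n)%g + e21 (n * m)%g = 0 by rewrite mn addNr.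
have E22 : e22 (m * n)%g + e22 (n * m)%g = 0 by rewrite mn addNr.
rewrite !sl2_mulE in E11 E12 E21 E22.
(* If [m] and [n] anticommute, then [n] conjugates [m] to [- m]. The combination of entries is the
   trace of (m n + n m) n^-1, that is twice the trace of [m], which cannot vanish. *)
have : mtrace m * 2 * (e11 n * e22 n - e12 n * e21 n) = 0.
  transitivity (e22 n * 0 - e21 n * 0 - e12 n * 0 + e11 n * 0); last by ring.
  by rewrite -{1}E11 -{1}E12 -{1}E21 -{1}E22 /mtrace; ring.
by rewrite sl2_det mulr1; lia.
Qed.

Lemma minor_trans (xi xj xk yj yk zi zj zk : int) : xi != 0 ->
  xi * zk = zi * xk -> xi * zj = zi * xj -> yj * xk = yk * xj ->
  yj * zk = yk * zj.
Proof.
move=> x0 zk_E zj_E yE; apply: (mulfI x0).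
by rewrite mulrCA zk_E [RHS]mulrCA zj_E mulrCA yE mulrCA.
Qed.

Lemma minors_trans (x1 x2 x3 y1 y2 y3 z1 z2 z3 : int) :
  [|| x1 != 0, x2 != 0 | x3 != 0] ->
  [/\ x1 * y2 = y1 * x2, x1 * y3 = y1 * x3 & x2 * y3 = y2 * x3] ->
  [/\ x1 * z2 = z1 * x2, x1 * z3 = z1 * x3 & x2 * z3 = z2 * x3] ->
  [/\ y1 * z2 = z1 * y2, y1 * z3 = z1 * y3 & y2 * z3 = z2 * y3].
Proof.
move=> x0 [A1 A2 A3] [B1 B2 B3]; case/or3P: x0 => i0.
- by split; rewrite [RHS]mulrC; [apply: (minor_trans (xj := x1) (xk := x2) (zi := z1) i0)
    |apply: (minor_trans (xj := x1) (xk := x3) (zi := z1) i0)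
    |apply: (minor_trans (xj := x2) (xk := x3) (zi := z1) i0)]; lia.
- by split; rewrite [RHS]mulrC; [apply: (minor_trans (xj := x1) (xk := x2) (zi := z2) i0)
    |apply: (minor_trans (xj := x1) (xk := x3) (zi := z2) i0)
    |apply: (minor_trans (xj := x2) (xk := x3) (zi := z2) i0)]; lia.
- by split; rewrite [RHS]mulrC; [apply: (minor_trans (xj := x1) (xk := x2) (zi := z3) i0)
    |apply: (minor_trans (xj := x1) (xk := x3) (zi := z3) i0)
    |apply: (minor_trans (xj := x2) (xk := x3) (zi := z3) i0)]; lia.
Qed.

Lemma psl_neq1 m : psl_pi m <> 1%g ->
  [|| e12 m != 0, e21 m != 0 | e11 m - e22 m != 0].
Proof.
move=> m1; apply: contra_notT m1; rewrite !negb_or !negbK subr_eq0.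
by move=> /and3P[/eqP ? /eqP ? /eqP ?]; apply/psl_pi1.
Qed.

Lemma parallel_trans m n p :
  psl_pi m <> 1%g -> parallel m n -> parallel m p -> parallel n p.
Proof. by move=> /psl_neq1; apply: minors_trans. Qed.

Lemma traceless_norm m :
  (e11 m - e22 m) ^+ 2 + 4 * e12 m * e21 m = mtrace m ^+ 2 - 4.
Proof.
have D := sl2_det m.
transitivity (mtrace m ^+ 2 - 4 * (e11 m * e22 m - e12 m * e21 m)); last by rewrite D mulr1.
by rewrite /mtrace; ring.
Qed.

(* Proportional traceless parts have discriminants of the same sign. *)
Lemma parallel_tr_ge2 m n : psl_pi m <> 1%g -> parallel m n ->
  2 <= `|mtrace m| -> 2 <= `|mtrace n|.
Proof.
move=> m1 [A1 A2 A3] t2; have := traceless_norm m; have := traceless_norm n.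
move: A1 A2 A3; set x3 := e11 m - e22 m; set y3 := e11 n - e22 n => A1 A2 A3 Q Q'.
have Q0 : 0 <= x3 ^+ 2 + 4 * e12 m * e21 m by nia.
suff : 0 <= y3 ^+ 2 + 4 * e12 n * e21 n by nia.
have key (xi yi : int) : xi != 0 ->
    xi ^+ 2 * (y3 ^+ 2 + 4 * e12 n * e21 n) = yi ^+ 2 * (x3 ^+ 2 + 4 * e12 m * e21 m) ->
    0 <= y3 ^+ 2 + 4 * e12 n * e21 n.
  move=> xi0 E; have x2 : 0 < xi ^+ 2 by rewrite lt0r sqrf_eq0 xi0 sqr_ge0.
  by rewrite -(pmulr_rge0 _ x2) E mulr_ge0 ?sqr_ge0.
have [m12|m12] := eqVneq (e12 m) 0; last first.
  apply: (key _ (e12 n) m12).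
  transitivity ((e12 m * y3) ^+ 2 + 4 * (e12 m * e12 n) * (e12 m * e21 n)); first by ring.
  by rewrite A1 A2; ring.
have [m21|m21] := eqVneq (e21 m) 0; last first.
  apply: (key _ (e21 n) m21).
  transitivity ((e21 m * y3) ^+ 2 + 4 * (e12 n * e21 m) * (e21 m * e21 n)); first by ring.
  by rewrite A3 -A1; ring.
have [x30|x30] := eqVneq x3 0; first by case: m1; apply/psl_pi1; split=> //; apply: subr0_eq.
apply: (key _ y3 x30).
transitivity ((x3 * y3) ^+ 2 + 4 * (e12 n * x3) * (e21 n * x3)); first by ring.
by rewrite -A2 -A3; ring.
Qed.

(** The traceless parts of [g] and [h] are proportional to the nonzero one of [c], hence to each
    other. Proportionality also carries the bound on the trace from [c] to [g], which rules out
    torsion. *)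
Lemma psl_centralizers : centralizers_abelian_torsion_free psl.
Proof.
move=> c g h; have [m ->] := psl_pi_surj c; have [a ->] := psl_pi_surj g.
have [b ->] := psl_pi_surj h => im ma mb; have t2 := psl_inf_order im.
have m1 : psl_pi m <> 1%g by move=> m1; apply: (im 1%N).
have pa := psl_commute t2 ma; have pb := psl_commute t2 mb; split.
  have /parallel_commute ab := parallel_trans m1 pa pb.
  by rewrite /commute -!psl_piM ab.
move=> [//|n] _ an; apply: contrapT => a1.
exact: (psl_expgS_neq1 (parallel_tr_ge2 m1 pa t2) a1 an).
Qed.

(** The traceless part of [m * m] is the trace times that of [m]. *)
Lemma psl_order2_tr m : (psl_pi m * psl_pi m)%g = 1%g -> psl_pi m <> 1%g -> mtrace m = 0.
Proof.
rewrite -psl_piM => /psl_pi1[]; rewrite !sl2_mulE => E12 E21 E E1; apply: contrapT => t0.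
have {}t0 : mtrace m != 0 by apply/eqP.
apply/E1/psl_pi1; split; apply: (mulfI t0).
- by rewrite mulr0 -E12 /mtrace; ring.
- by rewrite mulr0 -E21 /mtrace; ring.
- apply: subr0_eq; move: E => /eqP; rewrite -subr_eq0 => /eqP <-.
  by rewrite /mtrace; ring.
Qed.

Lemma psl_order3_tr m : (psl_pi m ^+ 3)%g = 1%g -> psl_pi m <> 1%g -> mtrace m ^+ 2 = 1.
Proof.
rewrite psl_piX => /psl_pi1[]; rewrite !expgS expg0 mulg1 !sl2_mulE => E12 E21 E E1.
apply: contrapT => t1.
have {}t1 : mtrace m ^+ 2 - 1 != 0 by rewrite subr_eq0; apply/eqP.
move: t1; rewrite -{1}(sl2_det m) => t1.
apply/E1/psl_pi1; split; apply: (mulfI t1).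
- by rewrite mulr0 -E12 /mtrace; ring.
- by rewrite mulr0 -E21 /mtrace; ring.
- apply: subr0_eq; move: E => /eqP; rewrite -subr_eq0 => /eqP <-.
  by rewrite /mtrace; ring.
Qed.

(* The traceless parts of [g] and [h] would be orthogonal and both negative for a
   form of signature (2, 1). *)
Lemma psl_no_dihedral3 (g h : psl) :
  g <> 1%g -> (g ^+ 3)%g = 1%g -> h <> 1%g -> (h * h)%g = 1%g ->
  (h * g)%g <> (g^-1 * h)%g.
Proof.
have [m ->] := psl_pi_surj g; have [n ->] := psl_pi_surj h => m1 m3 n1 n2 nm.
have nm2 : (psl_pi (n * m)%g * psl_pi (n * m)%g)%g = 1%g.
  by rewrite psl_piM {1}nm -mulgA (mulgA (psl_pi n)) n2 mul1g mulVg.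
have nm1 : psl_pi (n * m)%g <> 1%g.
  move=> /[!psl_piM] E; apply: m1; have E' : psl_pi m = psl_pi n.
    by apply: (mulgI (psl_pi n)); rewrite n2.
  by move: m3; rewrite !expgS mulg1 E' n2 mulg1.
have tm := psl_order3_tr m3 m1; have tn := psl_order2_tr n2 n1.
have := psl_order2_tr nm2 nm1; rewrite /mtrace !sl2_mulE => tnm.
have := traceless_norm m; rewrite tm; have := traceless_norm n; rewrite tn.
move: tm tn tnm; rewrite /mtrace; move=> _ tn.
have -> : e22 n = - e11 n by lia.
set D := e11 m - e22 m => tnm Qn Qm.
have dn : e22 n = - e11 n by lia.
have E1 : e11 n ^+ 2 = - 1 - e12 n * e21 n.
  by have := sl2_det n; rewrite dn; lia.
have E2 : e11 n * D = - (e12 n * e21 m + e21 n * e12 m).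
  by apply: subr0_eq; rewrite -tnm /D; ring.
have : (e11 n * D) ^+ 2 >= 4 * (e12 n * e21 n) * (e12 m * e21 m).
  have : 0 <= (e12 n * e21 m - e21 n * e12 m) ^+ 2 := sqr_ge0 _.
  rewrite E2; lia.
have -> : (e11 n * D) ^+ 2 = (-1 - e12 n * e21 n) * (-3 - 4 * (e12 m * e21 m)).
  by rewrite exprMn E1; congr (_ * _); lia.
have : e12 n * e21 n <= -1 by nia.
have : 4 * (e12 m * e21 m) <= -3 by nia.
lia.
Qed.

End Matrices.

(** * The congruence kernel modulo 2 *)

Section ReductionMod2.
Local Open Scope ring_scope.
Implicit Types (m n : sl2 int) (a b c : psl).

Fact sl2_red_det m :
  @det2 bool ((e11 m)%:~R, (e12 m)%:~R, (e21 m)%:~R, (e22 m)%:~R) == 1.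
Proof. by apply/eqP; rewrite /= -!intrM -intrB sl2_det. Qed.

Definition sl2_red m : sl2 bool := SL2 (sl2_red_det m).

Lemma sl2_redM m n : sl2_red (m * n)%g = (sl2_red m * sl2_red n)%g.
Proof.
by apply: sl2P; rewrite /e11 /e12 /e21 /e22 /=; split;
  rewrite -!intrM -intrD.
Qed.

Lemma sl2_redN m : sl2_red (sl2_opp m) = sl2_red m.
Proof.
have N (k : int) : (- k)%:~R = k%:~R :> bool by rewrite intrN.
by apply: sl2P; rewrite /e11 /e12 /e21 /e22 /=; split; rewrite N.
Qed.

Definition psl_red a : sl2 bool := sl2_red (repr a).

Lemma psl_redE m : psl_red (psl_pi m) = sl2_red m.
Proof. by rewrite /psl_red; case: (psl_repr m) => ->; rewrite ?sl2_redN. Qed.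

Lemma psl_redM : {morph psl_red : a b / (a * b)%g}.
Proof.
move=> a b; have [m ->] := psl_pi_surj a; have [n ->] := psl_pi_surj b.
by rewrite -psl_piM !psl_redE sl2_redM.
Qed.

HB.instance Definition _ := isMultiplicative.Build psl (sl2 bool) psl_red psl_redM.

Lemma intr_bool (k : int) : (k%:~R : bool) = odd `|k|%N.
Proof.
have natrb (n : nat) : (n%:R : bool) = odd n.
  by elim: n => [//|n IHn]; rewrite mulrS IHn.
by case: k => n; [rewrite -natrb | rewrite NegzE abszN -natrb intrN].
Qed.

(** Torsion bounds the trace by 1 in absolute value, and the congruence makes it even, hence 0. The
    determinant then reads - a^2 - b c = 1 with a odd and b, c even, which fails modulo 4. *)
Lemma psl_red1_torsion_free a (n : nat) :
  psl_red a = 1%g -> (a ^+ n.+1)%g = 1%g -> a = 1%g.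
Proof.
have [m ->] := psl_pi_surj a; rewrite psl_redE => m1 mn.
have E12 : (e12 m)%:~R = false by rewrite -[LHS]/(e12 (sl2_red m)) m1.
have E21 : (e21 m)%:~R = false by rewrite -[LHS]/(e21 (sl2_red m)) m1.
have E11 : (e11 m)%:~R = true by rewrite -[LHS]/(e11 (sl2_red m)) m1.
have E22 : (e22 m)%:~R = true by rewrite -[LHS]/(e22 (sl2_red m)) m1.
move: E11 E12 E21 E22; rewrite !intr_bool => E11 E12 E21 E22.
apply: contrapT => mN1; have t2 : ~ (2 <= `|mtrace m|).
  by move=> t2; apply: (psl_expgS_neq1 t2 mN1 mn).
have : e22 m = - e11 m by move: t2; rewrite /mtrace; lia.
have := sl2_det m => + d; rewrite d.
have [k ->] : exists k, e11 m = 2 * k + 1.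
  by exists ((e11 m) %/ 2)%Z; lia.
have [l ->] : exists l, e12 m = 2 * l by exists ((e12 m) %/ 2)%Z; lia.
have [r ->] : exists r, e21 m = 2 * r by exists ((e21 m) %/ 2)%Z; lia.
lia.
Qed.

End ReductionMod2.

Section Roots.
Local Open Scope ring_scope.

(** The test for roots: taking a [k]-th power multiplies the traceless part by some [u] at least as
    large as [k], so the common divisors of the three coordinates of [m] bound the exponents of its
    roots. *)
Lemma psl_root m n (k : int) :
  inf_order (psl_pi m) -> zexp (psl_pi n) k = psl_pi m ->
  exists2 u : int, (`|k| <= `|u|) &
    [/\ e12 m = u * e12 n, e21 m = u * e21 n & e11 m - e22 m = u * (e11 n - e22 n)].
Proof.
wlog k0 : m k / 0 <= k => [W|] im nk.
  have [k0|k0] := leP 0 k; first exact: W.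
  have Nk : 0 <= - k by lia.
  have [||u uk [U1 U2 U3]] := W m^-1%g _ Nk.
  - by rewrite mulhomV; apply: inf_orderV.
  - by rewrite zexpN nk mulhomV.
  exists (- u); first by rewrite normrN -(normrN k).
  rewrite !mulNr -U1 -U2 -U3 /e11 /e12 /e21 /e22 /=; split; ring.
have := im; rewrite -nk => /inf_order_zexpV/psl_inf_order t2.
case: k k0 nk => [[|k]|//] _ nk.
  by case: (im 1%N) => //; rewrite expg1 -nk.
have [u [u' [E11 E12 E21 E22 /(_ t2)[_ ku]]]] := sl2_expgS n k.
move: nk; rewrite /= psl_piX => /esym/psl_piP[mE|mE].
  by exists u => //; rewrite mE E11 E12 E21 E22; split=> //; ring.
exists (- u); first by rewrite normrN.
by rewrite mE !sl2_oppE E11 E12 E21 E22; split; ring.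
Qed.

(** If the involution [n] inverts [m], then [n * m] is an involution too, and involutions have trace
    0. For given [m] these are the equations refuted in the examples. *)
Lemma psl_inverted_tr m n : inf_order (psl_pi m) ->
  (psl_pi n * psl_pi m = (psl_pi m)^-1 * psl_pi n)%g ->
  (psl_pi n * psl_pi n = 1)%g ->
  psl_pi n <> 1%g -> mtrace n = 0 /\ mtrace (n * m)%g = 0.
Proof.
move=> im nm n2 n1; split; first exact: psl_order2_tr.
apply: psl_order2_tr; rewrite psl_piM.
  by rewrite {1}nm -mulgA (mulgA (psl_pi n)) n2 mul1g mulVg.
move=> E; apply: (im 2%N) => //.
have -> : psl_pi m = psl_pi n by apply: (mulgI (psl_pi n)); rewrite n2.
by rewrite expg2.
Qed.

End Roots.

(** * The quaternion group *)

Section QuaternionModel.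

(* [(i, j, k)] stands for [z^i x^j y^k] with [z = x^2]. *)
Definition q8m : Type := (bool * bool * bool)%type.

(** The exponent of [z] collects [k && j'] from y x = z x y, [j && j'] from x^2 = z and [k && k']
    from y^2 = z. *)
Definition q8m_mul (u v : q8m) : q8m :=
  let: (i, j, k) := u in let: (i', j', k') := v in
  (i (+) i' (+) (k && j') (+) (j && j') (+) (k && k'), j (+) j', k (+) k').
Definition q8m_inv (u : q8m) : q8m :=
  let: (i, j, k) := u in (i (+) (j || k), j, k).

Fact q8m_mulA : associative q8m_mul.
Proof. by do 3 case=> [[[] []] []]. Qed.
Fact q8m_mul1g : left_id (false, false, false) q8m_mul.
Proof. by case=> [[[] []] []]. Qed.
Fact q8m_mulg1 : right_id (false, false, false) q8m_mul.
Proof. by case=> [[[] []] []]. Qed.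
Fact q8m_mulVg : left_inverse (false, false, false) q8m_inv q8m_mul.
Proof. by case=> [[[] []] []]. Qed.
Fact q8m_mulgV : right_inverse (false, false, false) q8m_inv q8m_mul.
Proof. by case=> [[[] []] []]. Qed.

HB.instance Definition _ := Choice.on q8m.
HB.instance Definition _ := isGroup.Build q8m
  q8m_mulA q8m_mul1g q8m_mulg1 q8m_mulVg q8m_mulgV.

Definition qmx : q8m := (false, true, false).
Definition qmy : q8m := (false, false, true).

Definition q8m_gen (q : quat_gen) : q8m := match q with qx => qmx | qy => qmy end.

Fact q8m_rel u v : quat_rel 2 u v -> weval q8m_gen u = weval q8m_gen v.
Proof. by case. Qed.

Definition q8_code : {multiplicative Q8 -> q8m} := pres_lift q8m_rel.

Lemma q8_code_x : q8_code q8x = qmx. Proof. exact: (pres_lift_gen q8m_rel qx). Qed.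
Lemma q8_code_y : q8_code q8y = qmy. Proof. exact: (pres_lift_gen q8m_rel qy). Qed.

Definition q8_word (u : q8m) : Q8 :=
  let: (i, j, k) := u in (q8x * q8x) ^+ i * q8x ^+ j * q8y ^+ k.

Lemma q8_wordK : cancel q8_word q8_code.
Proof.
by case=> [[[] []] []]; rewrite /= ?gmulfM ?mulhom1 ?q8_code_x ?q8_code_y.
Qed.

Let z := q8x * q8x.

Let zx : z * q8x = q8x * z. Proof. by rewrite /z mulgA. Qed.
Let zy : z * q8y = q8y * z. Proof. by rewrite /z q8_pow mulgA. Qed.
Let zz : z * z = 1.
Proof.
have zV : z = q8x^-1 * q8x^-1.
  by apply: (mulIg q8y); rewrite zy /z mulgA q8_yx -mulgA q8_yx mulgA.
by rewrite {1}zV /z -mulgA mulKg mulVg.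
Qed.

Let mulx u : exists v, q8x * q8_word u = q8_word v.
Proof.
case: u => [[i j] k]; exists (i (+) j, ~~ j, k) => /=.
rewrite -/z !mulgA; congr (_ * _).
case: i; case: j; rewrite /= ?expg1 ?expg0 ?mul1g ?mulg1 -?zx -?mulgA -?/z ?zz //.
by rewrite mulgA -/z zz.
Qed.

Let muly u : exists v, q8y * q8_word u = q8_word v.
Proof.
case: u => [[i j] k]; exists (i (+) j (+) k, j, ~~ k) => /=.
have yx : q8y * q8x = z * q8x * q8y.
  by rewrite q8_yx; congr (_ * _); apply: (mulgI q8x); rewrite mulgV mulgA -zx -mulgA -/z zz.
have yy : q8y * q8y = z by rewrite -q8_pow.
have yz : q8y * z = z * q8y by rewrite zy.
have xx : q8x * q8x = z by [].
rewrite -/z; move: z zx zy zz yx yy yz xx => t tx ty tt yx yy yt xx.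
have Ei w : q8y * (t ^+ i * w) = t ^+ i * (q8y * w).
  by case: i; rewrite /= ?expg1 ?expg0 ?mul1g ?mul1g // !mulgA yt.
rewrite -mulgA Ei.
have -> : q8y * (q8x ^+ j * q8y ^+ k) = t ^+ (j (+) k) * q8x ^+ j * q8y ^+ (~~ k).
  case: j; case: k; rewrite /= ?expg0 ?expg1 ?mul1g ?mulg1 ?mul1g ?yy //.
  by rewrite mulgA yx -mulgA yy tx -mulgA tt mulg1.
rewrite !mulgA; congr (_ * _ * _).
by case: (i); case: (j); case: (k); rewrite /= ?expg1 ?expg0 ?mul1g ?mulg1 ?tt.
Qed.

Lemma q8_word_surj (q : Q8) : exists u, q = q8_word u.
Proof.
have xV : q8x^-1 = q8x * (q8x * q8x) by apply: (mulgI q8x); rewrite mulgV mulgA zz.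
have yV : q8y^-1 = q8y * (q8x * q8x).
  by apply: (mulgI q8y); rewrite mulgV mulgA -q8_pow zz.
pose T q := exists u, q = q8_word u.
move: q; apply: (presented_ind (T := T)) => [|[] q [u ->]|[] q [u ->]].
- by exists (false, false, false); rewrite /= !mulg1.
- exact: mulx.
- exact: muly.
- have [v1 E1] := mulx u; have [v2 E2] := mulx v1; have [v3 E3] := mulx v2.
  by exists v3; rewrite -[pgen _ _]/q8x xV -!mulgA E1 E2 E3.
- have [v1 E1] := mulx u; have [v2 E2] := mulx v1; have [v3 E3] := muly v2.
  by exists v3; rewrite -[pgen _ _]/q8y yV -!mulgA E1 E2 E3.
Qed.

Lemma q8_codeK : cancel q8_code q8_word.
Proof. by move=> q; have [u ->] := q8_word_surj q; rewrite q8_wordK. Qed.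

Lemma q8_wordM : {morph q8_word : u v / u * v}.
Proof. exact: (can2_gmulfM q8_codeK q8_wordK). Qed.

HB.instance Definition _ := isMultiplicative.Build q8m Q8 q8_word q8_wordM.

End QuaternionModel.

Lemma mulhom_inj (G H : groupType) (f : {multiplicative G -> H}) :
  (forall g, f g = 1 -> g = 1) -> injective f.
Proof.
move=> f1 g h gh; apply: divg1_eq; apply: f1.
by rewrite gmulfM mulhomV gh mulgV.
Qed.

(** Every nontrivial element of the quaternion group is the central involution or squares to it, so
    a nontrivial kernel contains that involution. *)
Lemma q8_hom_inj (G : groupType) (f : {multiplicative Q8 -> G}) :
  f (q8x * q8x) <> 1 -> injective f.
Proof.
move=> fz; apply: mulhom_inj => q; have [u ->] := q8_word_surj q => fu.
apply: contrapT => u1; apply: fz.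
have [uz|uz] : q8_word u = q8x * q8x \/ q8_word u * q8_word u = q8x * q8x.
- case: u {fu} u1 => [[i j] k] u1.
  case: j u1; case: k; case: i => u1; first [by right; rewrite -q8_wordM /= !mulg1
    | by left; rewrite /= !mulg1 | by case: u1; rewrite /= !mulg1].
- by rewrite -uz.
- by rewrite -uz gmulfM fu mulg1.
Qed.

Lemma q8m_generation (A B : q8m) : A * B <> B * A ->
  [/\ A * A = B * B, B * A = A^-1 * B &
      forall t : q8m, exists u : q8m,
        t = (A * A) ^+ u.1.1 * A ^+ u.1.2 * B ^+ u.2].
Proof.
case: A B => [[i j] k] [[i' j'] k'] AB.
have jk : j && k' != j' && k.
  by apply: contra_notN AB => /eqP; case: i j k i' j' k' => [] [] [] [] [] [].
split.
- by case: i j k i' j' k' jk {AB} => [] [] [] [] [] [].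
- by case: i j k i' j' k' jk {AB} => [] [] [] [] [] [].
move=> [[a b] c].
(* Cramer's rule modulo 2, with determinant 1 by [jk], gives the exponents of [A] and [B]; the
   leading bit corrects the central factor. *)
pose bb := (b && k') (+) (c && j').
pose cc := (b && k) (+) (c && j).
pose t0 : q8m := ((i, j, k) : q8m) ^+ bb * ((i', j', k') : q8m) ^+ cc.
exists (a (+) t0.1.1, bb, cc).
rewrite /t0 /bb /cc {t0 bb cc}.
by case: i j k i' j' k' jk a b c {AB} => [] [] [] [] [] [] //= _ [] [] [].
Qed.

Lemma q8_automorphism (A B : Q8) : A * B <> B * A ->
  exists th : {multiplicative Q8 -> Q8},
    [/\ th q8x = A, th q8y = B, injective th & forall q, exists q', q = th q'].
Proof.
move=> AB; have AB' : q8_code A * q8_code B <> q8_code B * q8_code A.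
  by rewrite -!gmulfM => /(can_inj q8_codeK).
have [E1 E2 E3] := q8m_generation AB'.
rewrite -!gmulfM in E1; have {}E1 := can_inj q8_codeK E1.
rewrite -mulhomV -!gmulfM in E2; have {}E2 := can_inj q8_codeK E2.
exists (q8_lift E1 E2); rewrite q8_lift_x q8_lift_y; split=> //.
  apply: q8_hom_inj; rewrite gmulfM q8_lift_x => AA; apply: AB.
  by rewrite E2; congr (_ * _); apply: (mulgI A); rewrite mulgV.
move=> q; have [[[a b] c] uE] := E3 (q8_code q); exists (q8_word (a, b, c)).
rewrite /= !(gmulfM, mulhomX) q8_lift_x q8_lift_y.
by apply: (can_inj q8_codeK); rewrite uE !(gmulfM, mulhomX).
Qed.

(** * The quaternion subgroup of the braid group *)

Section BraidRelations.
Variables (G : groupType) (s1 s2 s3 x y z a b : G).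
Hypotheses (s13 : s1 * s3 = s3 * s1) (s121 : s1 * s2 * s1 = s2 * s1 * s2).
Hypotheses (s232 : s2 * s3 * s2 = s3 * s2 * s3).
Hypothesis sphere : s1 * s2 * (s3 * s3) * s2 * s1 = 1.
Hypotheses (xE : x = s1 * s3^-1) (yE : y = s2 * x * s2^-1) (zE : z = x * x).
Hypotheses (aE : a = s1 * s2 * s1) (bE : b = s1 * s2).

Let s2112 : s2 * s1 * s1 * s2 = s3^-1 * s3^-1.
Proof.
have -> : s2 * s1 = (s3 * s3)^-1 * (s1 * s2)^-1.
  apply: (mulgI (s1 * s2 * (s3 * s3))).
  by rewrite mulgA sphere -invgM mulgV.
by rewrite -(mulgA _ s1 s2) mulgVK invgM.
Qed.

Let a_s1 : a * s1 = s2 * a.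
Proof. by rewrite aE {1}s121 !mulgA. Qed.

Let a_s2 : a * s2 = s1 * a.
Proof. by rewrite aE {2}s121 !mulgA. Qed.

Let s1_s3V : s3^-1 * s1 = s1 * s3^-1.
Proof. by apply: (mulgI s3); rewrite mulVKg mulgA -s13 mulgK. Qed.

(** The half twist [a] exchanges [s1] and [s2] by conjugation, and the sphere relation replaces
    s3^-2 by s2 s1^2 s2; so z = s1^2 s3^-2 = s1^2 s2 s1^2 s2 = a^2. In particular [z] commutes with
    [s1] and [s2]. *)
Lemma braid_aa : a * a = z.
Proof.
have -> : z = s1 * (s1 * (s3^-1 * s3^-1)).
  by rewrite zE xE -!mulgA (mulgA s3^-1) s1_s3V !mulgA.
rewrite -s2112.
have -> : s1 * (s2 * s1 * s1 * s2) = a * s1 * s2 by rewrite aE !mulgA.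
by rewrite a_s1 -[s2 * a * s2]mulgA a_s2 {1}aE !mulgA.
Qed.

Let z_s1 : z * s1 = s1 * z.
Proof. by rewrite -braid_aa -mulgA a_s1 mulgA a_s2 mulgA. Qed.

Let z_s2 : z * s2 = s2 * z.
Proof. by rewrite -braid_aa -mulgA a_s2 mulgA a_s1 mulgA. Qed.

Lemma braid_s1x : s1 * x = x * s1.
Proof. by rewrite xE -!mulgA s1_s3V. Qed.

Lemma braid_s3 : s3 = x^-1 * s1.
Proof. by rewrite xE invgM invgK mulgVK. Qed.

Lemma braid_s2x : s2 * x = y * s2.
Proof. by rewrite yE mulgVK. Qed.

Lemma braid_yy : y * y = z.
Proof.
have -> : y * y = s2 * (x * x) * s2^-1.
  by rewrite yE !mulgA mulgVK.
by rewrite -zE -z_s2 mulgK.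
Qed.

Lemma braid_s1y : s1 * y = y * x^-1 * s1.
Proof.
have E : s2 * s3 * s2^-1 = s3^-1 * s2 * s3.
  by apply: (mulIg s2); apply: (mulgI s3); rewrite mulgVK !mulgA mulgV mul1g -s232.
have {}E : s2 * s3^-1 * s2^-1 = s3^-1 * s2^-1 * s3.
  by have := congr1 (fun g : G => g^-1) E; rewrite /= !invgM !invgK !mulgA.
have -> : y = s2 * s1 * (s3^-1 * s2^-1) by rewrite yE xE !mulgA.
have -> : s1 * (s2 * s1 * (s3^-1 * s2^-1)) = s2 * s1 * (s2 * s3^-1 * s2^-1).
  by rewrite !mulgA s121.
by rewrite E -[RHS]mulgA -braid_s3 !mulgA.
Qed.

(** Conjugation by [s1] fixes [z = y * y] and sends [y] to [y * x^-1]. Hence (y x^-1)^2 = y^2, which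
    is the quaternion relation. *)
Lemma braid_yx : y * x = x^-1 * y.
Proof.
have E : y * x^-1 * (y * x^-1) = y * y.
  apply: (mulIg s1); rewrite braid_yy z_s1 -braid_yy.
  by rewrite [RHS]mulgA braid_s1y -[RHS]mulgA braid_s1y !mulgA.
move: E; rewrite -!mulgA => /mulgI; rewrite !mulgA => E.
by rewrite -{1}E mulgVK.
Qed.

Lemma braid_zz : z * z = 1.
Proof.
have zy : z * y = y * z by rewrite -braid_yy mulgA.
have zV : z = x^-1 * x^-1.
  by apply: (mulIg y); rewrite zy zE mulgA braid_yx -mulgA braid_yx mulgA.
by rewrite {1}zV zE -mulgA mulKg mulVg.
Qed.

(** Moving [x] through both sides of the braid relation shows that [s2] commutes with [y * x^-1];
    the image of [y] follows from that of [x]. *)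
Lemma braid_s2y : s2 * y = y * x^-1 * y * s2.
Proof.
have E : s1 * s2 * s1 * x = y * x^-1 * (s2 * s1 * s2).
  by rewrite -mulgA braid_s1x mulgA -(mulgA s1) braid_s2x mulgA braid_s1y -s121 !mulgA.
have E' : s2 * (y * x^-1) * (s1 * s2) = y * x^-1 * s2 * (s1 * s2).
  transitivity (s1 * s2 * s1 * x); last by rewrite E !mulgA.
  by rewrite s121 -(mulgA _ s2 x) braid_s2x -!mulgA (mulgA s1 y) braid_s1y !mulgA.
have {E E'}E := mulIg _ _ _ E'.
transitivity (y * x^-1 * s2 * x); last by rewrite -!mulgA braid_s2x !mulgA.
by rewrite -E mulgA mulgVK.
Qed.

Lemma braid_bbb : b * (b * b) = z.
Proof.
have -> : b * (b * b) = a * (s2 * s1 * s2) by rewrite aE bE !mulgA.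
by rewrite -s121 -aE braid_aa.
Qed.

Let bs1 : b * s1 = a. Proof. by rewrite aE bE. Qed.
Let as2 : a * s2 = b * b. Proof. by rewrite aE bE !mulgA. Qed.

Lemma braid_s1E : s1 = z * (b * (b * a)).
Proof. by rewrite -bs1 !mulgA -(mulgA _ b b) -(mulgA _ b) braid_bbb braid_zz mul1g. Qed.

Lemma braid_s2E : s2 = z * (a * (b * b)).
Proof. by rewrite -as2 (mulgA a) braid_aa mulgA braid_zz mul1g. Qed.

Lemma braid_s1V : s1^-1 = z * (a * b).
Proof.
apply: (mulIg s1); rewrite mulVg -mulgA -mulgA bs1 braid_aa.
by rewrite braid_zz.
Qed.

Lemma braid_s2V : s2^-1 = z * (b * a).
Proof.
by apply: (mulIg s2); rewrite mulVg -!mulgA as2 braid_bbb braid_zz.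
Qed.

End BraidRelations.

(** * The quaternion subgroup inside the braid group, the action on it, and the kernel of the map to
    PSL(2, Z) *)

Definition s1 : B4S2 := pgen B4_rel sigma1.
Definition s2 : B4S2 := pgen B4_rel sigma2.
Definition s3 : B4S2 := pgen B4_rel sigma3.
(* [bx] and [by_] generate a normal quaternion group with centre [bz]; modulo it
   [ba] and [bb] have orders 2 and 3. The definitions are locked because rewriting
   with [mulgA] would unfold them. *)
Definition bx : B4S2 := locked (s1 * s3^-1).
Definition by_ : B4S2 := locked (s2 * bx * s2^-1).
Definition bz : B4S2 := locked (bx * bx).
Definition ba : B4S2 := locked (s1 * s2 * s1).
Definition bb : B4S2 := locked (s1 * s2).

Lemma s13 : s1 * s3 = s3 * s1. Proof. exact: (pgen_rel B4_comm). Qed.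
Lemma s121 : s1 * s2 * s1 = s2 * s1 * s2. Proof. exact: (pgen_rel B4_braid12). Qed.
Lemma s232 : s2 * s3 * s2 = s3 * s2 * s3. Proof. exact: (pgen_rel B4_braid23). Qed.
Lemma s_sphere : s1 * s2 * (s3 * s3) * s2 * s1 = 1. Proof. exact: (pgen_rel B4_sphere). Qed.

Lemma bxE : bx = s1 * s3^-1. Proof. by rewrite /bx -lock. Qed.
Lemma byE : by_ = s2 * bx * s2^-1. Proof. by rewrite /by_ -lock. Qed.
Lemma bzE : bz = bx * bx. Proof. by rewrite /bz -lock. Qed.
Lemma baE : ba = s1 * s2 * s1. Proof. by rewrite /ba -lock. Qed.
Lemma bbE : bb = s1 * s2. Proof. by rewrite /bb -lock. Qed.

Lemma baa : ba * ba = bz.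
Proof. exact: (braid_aa s13 s121 s_sphere bxE bzE baE). Qed.
Lemma bbbb : bb * (bb * bb) = bz.
Proof. exact: (braid_bbb s13 s121 s_sphere bxE bzE baE bbE). Qed.
Lemma bzz : bz * bz = 1.
Proof. exact: (braid_zz s13 s121 s232 s_sphere bxE byE bzE baE). Qed.
Lemma byx : by_ * bx = bx^-1 * by_.
Proof. exact: (braid_yx s13 s121 s232 s_sphere bxE byE bzE baE). Qed.
Lemma byy : by_ * by_ = bz.
Proof. exact: (braid_yy s13 s121 s_sphere bxE byE bzE baE). Qed.
Lemma bs1x : s1 * bx = bx * s1.
Proof. exact: (braid_s1x s13 bxE). Qed.
Lemma bs1y : s1 * by_ = by_ * bx^-1 * s1.
Proof. exact: (braid_s1y s121 s232 bxE byE). Qed.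
Lemma bs2x : s2 * bx = by_ * s2.
Proof. exact: (braid_s2x byE). Qed.
Lemma bs2y : s2 * by_ = by_ * bx^-1 * by_ * s2.
Proof. exact: (braid_s2y s13 s121 s232 bxE byE). Qed.
Lemma bs3 : s3 = bx^-1 * s1.
Proof. exact: (braid_s3 bxE). Qed.
Lemma bs1E : s1 = bz * (bb * (bb * ba)).
Proof. exact: (braid_s1E s13 s121 s232 s_sphere bxE byE bzE baE bbE). Qed.
Lemma bs2E : s2 = bz * (ba * (bb * bb)).
Proof. exact: (braid_s2E s13 s121 s232 s_sphere bxE byE bzE baE bbE). Qed.
Lemma bs1V : s1^-1 = bz * (ba * bb).
Proof. exact: (braid_s1V s13 s121 s232 s_sphere bxE byE bzE baE bbE). Qed.
Lemma bs2V : s2^-1 = bz * (bb * ba).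
Proof. exact: (braid_s2V s13 s121 s232 s_sphere bxE byE bzE baE bbE). Qed.

Fact nu_rel u v : quat_rel 2 u v ->
  weval (fun q => match q with qx => bx | qy => by_ end) u =
  weval (fun q => match q with qx => bx | qy => by_ end) v.
Proof.
case; first by transitivity (by_ * by_); rewrite // byy bzE.
by transitivity (by_ * bx * by_^-1); rewrite // byx mulgK.
Qed.

Definition nu : {multiplicative Q8 -> B4S2} := pres_lift nu_rel.

Lemma nu_x : nu q8x = bx. Proof. exact: (pres_lift_gen nu_rel qx). Qed.
Lemma nu_y : nu q8y = by_. Proof. exact: (pres_lift_gen nu_rel qy). Qed.

Definition nuq : {multiplicative q8m -> B4S2} := nu \o q8_word.

Lemma nuq_x : nuq qmx = bx.
Proof. by rewrite /nuq /= !mulg1 mul1g nu_x. Qed.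
Lemma nuq_y : nuq qmy = by_.
Proof. by rewrite /nuq /= !mul1g nu_y. Qed.
Lemma nuq_z : nuq (true, false, false) = bz.
Proof. by rewrite -[(true, false, false)]/(qmx * qmx) gmulfM nuq_x bzE. Qed.

Lemma nu_nuq q : nu q = nuq (q8_code q).
Proof. by rewrite /nuq /= q8_codeK. Qed.

(* The binary octahedral group embeds in SL(2, 7), and [rho7] is onto it. *)
Section SL2F7.
Local Open Scope ring_scope.
Let F := 'F_7.
Fact o1_det : det2 ((0, 1, -1, 3%:R) : F * F * F * F) == 1. Proof. by []. Qed.
Fact o2_det : det2 ((0, 3%:R, 2%:R, 3%:R) : F * F * F * F) == 1. Proof. by []. Qed.
Fact o3_det : det2 ((3%:R, -1, 1, 0) : F * F * F * F) == 1. Proof. by []. Qed.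

Definition o_gen (g : B4_gen) : sl2 F :=
  match g with sigma1 => SL2 o1_det | sigma2 => SL2 o2_det | sigma3 => SL2 o3_det end.
Fact o_rel u v : B4_rel u v -> weval o_gen u = weval o_gen v.
Proof. by case; apply/eqP. Qed.
End SL2F7.

Definition rho7 : {multiplicative B4S2 -> sl2 'F_7} := pres_lift o_rel.

Lemma rho7_z : rho7 bz = sl2_opp 1.
Proof.
have o1 : rho7 s1 = o_gen sigma1 := pres_lift_gen o_rel sigma1.
have o3 : rho7 s3 = o_gen sigma3 := pres_lift_gen o_rel sigma3.
rewrite bzE bxE !(gmulfM, mulhomV) o1 o3.
by apply/eqP.
Qed.

Lemma bz_neq1 : bz <> 1.
Proof. by move/(congr1 rho7); rewrite rho7_z mulhom1 => /eqP. Qed.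

Section PSLRep.
Local Open Scope ring_scope.
Fact p1_det : det2 ((1, -1, 0, 1) : int * int * int * int) == 1. Proof. by []. Qed.
Fact p2_det : det2 ((1, 0, 1, 1) : int * int * int * int) == 1. Proof. by []. Qed.
Definition m_gen (g : B4_gen) : sl2 int :=
  match g with sigma2 => SL2 p2_det | _ => SL2 p1_det end.
Definition p_gen (g : B4_gen) : psl := psl_pi (m_gen g).
(** The sphere relation holds only up to sign for these matrices: its left side maps to -1. *)
Fact p_rel u v : B4_rel u v -> weval p_gen u = weval p_gen v.
Proof.
have pE w : weval p_gen w = psl_pi (weval m_gen w).
  elim: w => [//|//|w1 IH1 w2 IH2|w IH]; first by rewrite psl_piM -IH1 -IH2.
  by rewrite -[LHS]/((weval p_gen w)^-1)%g IH -mulhomV.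
by rewrite !pE => uv; apply/psl_piP; case: uv;
  first [left; exact: sl2P | right; exact: sl2P].
Qed.
End PSLRep.

Definition rho : {multiplicative B4S2 -> psl} := pres_lift p_rel.

Lemma nuq_inj : injective nuq.
Proof.
have nuI : injective nu by apply: q8_hom_inj; rewrite gmulfM nu_x -bzE; apply: bz_neq1.
by move=> u v E; apply: (can_inj q8_wordK); apply: nuI; apply: E.
Qed.

Lemma nu_inj : injective nu.
Proof. by move=> q r; rewrite !nu_nuq => /nuq_inj/(can_inj q8_codeK). Qed.

(** Conjugation by [g] is recorded through codes in [q8m], so that actions of products are obtained
    by evaluation. *)
Definition acts_by (g : B4S2) (A B : q8m) :=
  g * bx = nuq A * g /\ g * by_ = nuq B * g.

Definition q8m_app (A B u : q8m) : q8m := (A * A) ^+ u.1.1 * A ^+ u.1.2 * B ^+ u.2.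

Lemma acts_by_app g A B u : acts_by g A B -> g * nuq u = nuq (q8m_app A B u) * g.
Proof.
move=> [gx gy]; rewrite /q8m_app.
have gM v w v' w' : g * nuq v = nuq v' * g -> g * nuq w = nuq w' * g ->
    g * nuq (v * w) = nuq (v' * w') * g.
  by move=> gv gw; rewrite !gmulfM mulgA gv -mulgA gw mulgA.
have gX v v' (i : bool) : g * nuq v = nuq v' * g -> g * nuq (v ^+ i) = nuq (v' ^+ i) * g.
  by case: i => H; [exact: H | rewrite !expg0 mulhom1 mulg1 mul1g].
have {1}-> : u = (qmx * qmx) ^+ u.1.1 * qmx ^+ u.1.2 * qmy ^+ u.2.
  by case: u => [[[] []] []].
rewrite -nuq_x in gx; rewrite -nuq_y in gy.
exact: gM _ _ _ _ (gM _ _ _ _ (gX _ _ _ (gM _ _ _ _ gx gx)) (gX _ _ _ gx)) (gX _ _ _ gy).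
Qed.

Lemma acts_by_mul g h A B C D : acts_by g A B -> acts_by h C D ->
  acts_by (g * h) (q8m_app A B C) (q8m_app A B D).
Proof.
move=> gAB [hx hy]; split.
  by rewrite -mulgA hx mulgA (acts_by_app _ gAB) mulgA.
by rewrite -mulgA hy mulgA (acts_by_app _ gAB) mulgA.
Qed.

Lemma acts_by_nuq u : acts_by (nuq u) (u * qmx * u^-1) (u * qmy * u^-1).
Proof. by split; rewrite -?nuq_x -?nuq_y -!gmulfM mulgVK. Qed.

Lemma acts_by_s1 : acts_by s1 qmx (qmy * qmx^-1).
Proof. by split; rewrite ?gmulfM ?mulhomV nuq_x ?nuq_y ?bs1x ?bs1y. Qed.

Lemma acts_by_s2 : acts_by s2 qmy (qmy * qmx^-1 * qmy).
Proof. by split; rewrite ?gmulfM ?mulhomV ?nuq_x nuq_y ?bs2x ?bs2y. Qed.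

Lemma acts_by_b : acts_by bb (qmx * qmy) qmx^-1.
Proof. by rewrite bbE; have := acts_by_mul acts_by_s1 acts_by_s2. Qed.

Lemma acts_by_a : acts_by ba (qmx * qmy) qmy^-1.
Proof. by rewrite baE; have := acts_by_mul (acts_by_mul acts_by_s1 acts_by_s2) acts_by_s1. Qed.

(** No inverses of [ba] and [bb] are needed: both have finite order modulo the quaternion group, and
    [s3] differs from [s1] by an element of it. *)
Lemma B4_ind (T : B4S2 -> Prop) :
  T 1 -> (forall g, T g -> T (ba * g)) -> (forall g, T g -> T (bb * g)) ->
  (forall u g, T g -> T (nuq u * g)) -> forall g, T g.
Proof.
move=> T1 Ta Tb Tn.
have Tz g : T g -> T (bz * g) by move=> Tg; rewrite -nuq_z; apply: Tn.
have Tx g : T g -> T (bx * g) by move=> Tg; rewrite -nuq_x; apply: Tn.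
have TxV g : T g -> T (bx^-1 * g) by move=> Tg; rewrite -nuq_x -mulhomV; apply: Tn.
have T_s1 g : T g -> T (s1 * g).
  by move=> Tg; rewrite bs1E -!mulgA; apply/Tz/Tb/Tb/Ta.
have T_s1V g : T g -> T (s1^-1 * g).
  by move=> Tg; rewrite bs1V -!mulgA; apply/Tz/Ta/Tb.
apply: presented_ind => // -[] g Tg.
- exact: T_s1.
- by rewrite -[pgen _ _]/s2 bs2E -!mulgA; apply/Tz/Ta/Tb/Tb.
- by rewrite -[pgen _ _]/s3 bs3 -!mulgA; apply/TxV/T_s1.
- exact: T_s1V.
- by rewrite -[pgen _ _]/s2 bs2V -!mulgA; apply/Tz/Tb/Ta.
- by rewrite -[pgen _ _]/s3 bs3 invgM invgK -!mulgA; apply/T_s1V/Tx.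
Qed.

Lemma acts_by_ex g : exists A B, acts_by g A B.
Proof.
elim/B4_ind: g => [|g [A [B gAB]]|g [A [B gAB]]|u g [A [B gAB]]].
- exists qmx, qmy; have := acts_by_nuq 1; rewrite mulhom1 => - H; exact: H.
- by do 2 eexists; apply: acts_by_mul acts_by_a gAB.
- by do 2 eexists; apply: acts_by_mul acts_by_b gAB.
- by do 2 eexists; apply: acts_by_mul (acts_by_nuq u) gAB.
Qed.

Lemma nuq_normal g u : exists v, g * nuq u = nuq v * g.
Proof. by have [A [B /acts_by_app gAB]] := acts_by_ex g; exists (q8m_app A B u). Qed.

Lemma rho_nuq u : rho (nuq u) = 1.
Proof.
have p1 : rho s1 = p_gen sigma1 := pres_lift_gen p_rel sigma1.
have p2 : rho s2 = p_gen sigma2 := pres_lift_gen p_rel sigma2.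
have p3 : rho s3 = p_gen sigma3 := pres_lift_gen p_rel sigma3.
have bpx : rho bx = 1 by rewrite bxE gmulfM mulhomV p1 p3 mulgV.
have bpy : rho by_ = 1 by rewrite byE !gmulfM mulhomV bpx mulg1 mulgV.
have -> : u = (qmx * qmx) ^+ u.1.1 * qmx ^+ u.1.2 * qmy ^+ u.2.
  by case: u => [[[] []] []].
by rewrite !(gmulfM, mulhomX) nuq_x nuq_y bpx bpy !(mulg1, expg1n).
Qed.

Section PSLValues.
Local Open Scope ring_scope.
Fact pa_det : det2 ((0, 1, -1, 0) : int * int * int * int) == 1. Proof. by []. Qed.
Fact pb_det : det2 ((0, 1, -1, -1) : int * int * int * int) == 1. Proof. by []. Qed.
Fact pU_det : det2 ((1, 1, 0, 1) : int * int * int * int) == 1. Proof. by []. Qed.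
Definition mA := SL2 pa_det.
Definition mB := SL2 pb_det.
Definition mU := SL2 pU_det.
Definition mV := SL2 p2_det.
End PSLValues.

Lemma rho_a : rho ba = psl_pi mA.
Proof.
have p1 : rho s1 = p_gen sigma1 := pres_lift_gen p_rel sigma1.
have p2 : rho s2 = p_gen sigma2 := pres_lift_gen p_rel sigma2.
transitivity (psl_pi (m_gen sigma1 * m_gen sigma2 * m_gen sigma1)).
  by rewrite baE !gmulfM p1 p2 /p_gen.
apply/psl_piP.
by first [left; exact: sl2P | right; exact: sl2P].
Qed.

Lemma rho_b : rho bb = psl_pi mB.
Proof.
have p1 : rho s1 = p_gen sigma1 := pres_lift_gen p_rel sigma1.
have p2 : rho s2 = p_gen sigma2 := pres_lift_gen p_rel sigma2.
transitivity (psl_pi (m_gen sigma1 * m_gen sigma2)).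
  by rewrite bbE !gmulfM p1 p2 /p_gen.
apply/psl_piP.
by first [left; exact: sl2P | right; exact: sl2P].
Qed.

Definition eps (t : bool) : B4S2 := if t then bb else bb^-1.
Definition alt_word (l : seq bool) (d : bool) : B4S2 :=
  foldr (fun t g => ba * eps t * g) (ba ^+ d) l.

(* The syllables [ba * eps t] map to the elementary matrices [1 1; 0 1] and
   [1 0; 1 1] up to sign, and these generate a free monoid of nonnegative matrices:
   only trivial words can be mapped to 1. *)
Lemma B4_normal_form g : exists u l d, exists2 e : B4S2,
  [\/ e = 1, e = bb | e = bb^-1] & g = nuq u * (e * alt_word l d).
Proof.
have nN h u : exists v, h * nuq u = nuq v * h := nuq_normal h u.
have bV : bb * bb = nuq (true, false, false) * bb^-1.
  by rewrite nuq_z -bbbb !mulgA mulgK.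
elim/B4_ind: g => [|g [u [l [d [e eP ->]]]]|g [u [l [d [e eP ->]]]]|v g [u [l [d [e eP ->]]]]].
- exists 1, [::], false, 1; first by constructor 1.
  by rewrite mulhom1 !mul1g.
- have [v E] := nN ba u; rewrite mulgA E -mulgA.
  case: eP => ->; last 2 first.
  + exists v, (true :: l), d, 1; first by constructor 1.
    by rewrite mul1g /= !mulgA.
  + exists v, (false :: l), d, 1; first by constructor 1.
    by rewrite mul1g /= !mulgA.
  case: l => [|t l]; rewrite mul1g.
    case: d.
      exists (v * (true, false, false)), [::], false, 1; first by constructor 1.
      by rewrite gmulfM nuq_z /= -baa expg1 expg0 !mulg1.
    by exists v, [::], true, 1; [constructor 1 | rewrite /= mulg1 mul1g].
  exists (v * (true, false, false)), l, d, (eps t); first last.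
    by rewrite gmulfM nuq_z -baa /= !mulgA.
  by case: t; [constructor 2|constructor 3].
- have [v E] := nN bb u; rewrite mulgA E -mulgA.
  case: eP => ->.
  + by exists v, l, d, bb; [constructor 2 | rewrite mul1g].
  + exists (v * (true, false, false)), l, d, bb^-1; first by constructor 3.
    by rewrite gmulfM (mulgA bb) bV !mulgA.
  + exists v, l, d, 1; first by constructor 1.
    by rewrite mul1g mulVKg.
- by exists (v * u), l, d, e; rewrite ?gmulfM ?mulgA.
Qed.

Section Kernel.
Local Open Scope ring_scope.

Lemma rho_aeps t : rho (ba * eps t)%g = psl_pi (if t then mU else mV).
Proof.
rewrite gmulfM rho_a; case: t => /=; rewrite ?mulhomV rho_b -?mulhomV -psl_piM;
  apply/psl_piP; by first [left; exact: sl2P | right; exact: sl2P].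
Qed.

(** The nonnegative one of the two opposite matrices is kept; the last bound separates nonempty
    words from the identity. *)
Lemma rho_alt_word l : exists2 m,
  rho (alt_word l false) = psl_pi m &
  [/\ 1 <= e11 m, 0 <= e12 m, 0 <= e21 m, 1 <= e22 m & l != [::] -> 1 <= e12 m + e21 m].
Proof.
elim: l => [|t l [m mE [m11 m12 m21 m22 _]]]; first by exists 1%g; rewrite ?mulhom1.
exists ((if t then mU else mV) * m)%g; first by rewrite /= gmulfM rho_aeps mE psl_piM.
rewrite !sl2_mulE.
case: t; rewrite /e11 /e12 /e21 /e22 /= -?/(e11 m) -?/(e12 m) -?/(e21 m) -?/(e22 m);
  split; lia.
Qed.

Lemma alt_wordT l d : alt_word l d = (alt_word l false * ba ^+ d)%g.
Proof. by elim: l => [|t l /= ->]; rewrite /= ?mul1g // !mulgA. Qed.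

(** The prefix [e] and the possible final [ba] leave six products. The bounds on [m] prevent them
    from being scalar unless both are absent, and then the word is empty. *)
Lemma rho_kernel g : rho g = 1%g -> exists u, g = nuq u.
Proof.
have [u [l [d [e eP ->]]]] := B4_normal_form g.
rewrite gmulfM rho_nuq mul1g alt_wordT !gmulfM mulhomX rho_a.
have [m mE [m11 m12 m21 m22 mN]] := rho_alt_word l; rewrite mE => ker.
have [n nE nP] : exists2 n, rho e = psl_pi n &
    [\/ e = 1%g /\ n = 1%g, n = mB | n = mB^-1%g].
  case: eP => ->.
  - by exists 1%g; [rewrite !mulhom1 | constructor 1].
  - by exists mB; [rewrite rho_b | constructor 2].
  - by exists mB^-1%g; [rewrite !mulhomV rho_b | constructor 3].
have /psl_pi1 : psl_pi (n * (m * mA ^+ d))%g = 1%g.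
  by rewrite !psl_piM -nE mulhomX.
have nA : e11 mA = 0 /\ e12 mA = 1 /\ e21 mA = - 1 /\ e22 mA = 0 by [].
have nB : e11 mB = 0 /\ e12 mB = 1 /\ e21 mB = - 1 /\ e22 mB = - 1 by [].
have nBV : e11 mB^-1%g = - 1 /\ e12 mB^-1%g = - 1 /\ e21 mB^-1%g = 1 /\ e22 mB^-1%g = 0 by [].
case: nA => A11 [A12 [A21 A22]]; case: nB => B11 [B12 [B21 B22]].
case: nBV => V11 [V12 [V21 V22]].
case: nP => [[e1 ->]|->|->]; case: d {ker}; rewrite ?expg1 ?expg0 ?mulg1 ?mul1g ?sl2_mulE
  ?A11 ?A12 ?A21 ?A22 ?B11 ?B12 ?B21 ?B22 ?V11 ?V12 ?V21 ?V22
  => -[K1 K2 K3]; try by exfalso; lia.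
exists u; rewrite e1 mul1g; case: (l) mN => [_|t l' /(_ isT)]; first by rewrite /= ?mulg1.
by lia.
Qed.

End Kernel.

(** * Action on the quaternion subgroup *)

Definition rho2 : {multiplicative B4S2 -> sl2 bool} := psl_red \o rho.

Lemma rho2_a : rho2 ba = sl2_red mA.
Proof. by rewrite /rho2 /= rho_a psl_redE. Qed.
Lemma rho2_b : rho2 bb = sl2_red mB.
Proof. by rewrite /rho2 /= rho_b psl_redE. Qed.
Lemma rho2_nuq u : rho2 (nuq u) = 1.
Proof. by rewrite /rho2 /= rho_nuq mulhom1. Qed.

Lemma nuq_normalr g u : exists v, nuq u * g = g * nuq v.
Proof.
have [v E] := nuq_normal g^-1 u; exists v.
by apply: (mulgI g^-1); rewrite mulKg mulgA E mulgVK.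
Qed.

Section InnerActions.

(** Such elements are trivial both in Out(Q8) and in SL(2, Z/2). Keeping the two conditions together
    lets one list of six cosets control both groups. *)
Definition inner8 (g : B4S2) := exists u k,
  [/\ g = nuq u * k, (forall v, commute k (nuq v)) & rho2 k = 1].

Lemma inner8_nuq u : inner8 (nuq u).
Proof.
by exists u, 1; split; rewrite ?mulg1 ?mulhom1 // => v; apply/commute_sym/commute1.
Qed.

Lemma inner8M g h : inner8 g -> inner8 h -> inner8 (g * h).
Proof.
move=> [u [k [-> ku k1]]] [v [l [-> lv l1]]]; exists (u * v), (k * l); split.
- by rewrite gmulfM -!mulgA; congr (_ * _); rewrite !mulgA ku.
- by move=> w; apply/commute_sym/commuteM; apply/commute_sym.
- by rewrite gmulfM k1 l1 mulg1.
Qed.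

Lemma inner8_normal g h : inner8 g -> exists2 g', inner8 g' & g * h = h * g'.
Proof.
move=> [u [k [-> ku k1]]]; have [v uh] := nuq_normalr h u.
exists (nuq v * (h^-1 * k * h)); last by rewrite [RHS]mulgA -uh -!mulgA mulVKg.
exists v, (h^-1 * k * h); split=> // [w|].
  have [w' hw] := nuq_normal h w; rewrite /commute -!mulgA hw (mulgA k) ku -!mulgA.
  have hw' : h^-1 * nuq w' = nuq w * h^-1 by apply: (mulgI h); rewrite mulVKg mulgA hw mulgK.
  by rewrite mulgA hw' !mulgA.
by rewrite !gmulfM mulhomV k1 mulg1 mulVg.
Qed.

Lemma inner8_acts_by g h u A B : acts_by g A B -> acts_by (h * nuq u) A B -> rho2 g = rho2 h ->
  exists2 k, inner8 k & g = h * k.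
Proof.
move=> gAB hAB gh; exists (h^-1 * g); last by rewrite mulVKg.
exists u, ((h * nuq u)^-1 * g); split.
- by rewrite invgM !mulgA mulgV mul1g.
- move=> v; have gv := acts_by_app v gAB; have hv := acts_by_app v hAB.
  rewrite /commute -mulgA gv !mulgA; congr (_ * _).
  by apply: (mulgI (h * nuq u)); rewrite mulVKg mulgA hv mulgK.
- by rewrite gmulfM mulhomV gmulfM rho2_nuq mulg1 gh mulVg.
Qed.

Definition coset_reps : seq B4S2 :=
  [:: 1; bb; bb * bb; ba; ba * bb; ba * (bb * bb)].

(** The defining relation of the symmetric group of degree 3. Both sides agree up to an inner
    automorphism, given by one of the four classes of the quaternion group modulo its centre. *)
Let ba_relation : exists2 k, inner8 k & bb * ba = ba * (bb * bb) * k.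
Proof.
have AB := acts_by_mul acts_by_b acts_by_a.
have CD u := acts_by_mul (acts_by_mul acts_by_a (acts_by_mul acts_by_b acts_by_b))
  (acts_by_nuq u).
have Q : rho2 (bb * ba) = rho2 (ba * (bb * bb)).
  by rewrite !gmulfM rho2_a rho2_b; apply/eqP.
by first [exact: inner8_acts_by AB (CD 1) Q | exact: inner8_acts_by AB (CD qmx) Q |
  exact: inner8_acts_by AB (CD qmy) Q | exact: inner8_acts_by AB (CD (qmx * qmy)) Q].
Qed.

(** Up to [inner8], left multiplication by [ba] and [bb] permutes the six representatives: [baa],
    [bbbb] and [ba_relation] reduce every product to one of them. *)
Lemma coset_decomposition g : exists r u k,
  [/\ r \in coset_reps, g = r * (nuq u * k), forall v, commute k (nuq v) & rho2 k = 1].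
Proof.
suff [r [h rR [[u [k [-> ku k1]]] ->]]] :
    exists r, exists2 h, r \in coset_reps & inner8 h /\ g = r * h.
  by exists r, u, k.
have Tn h r h' : inner8 h -> inner8 h' -> r \in coset_reps ->
    exists r', exists2 h'', r' \in coset_reps & inner8 h'' /\ h * (r * h') = r' * h''.
  move=> ih ih' rR; exists r; have [h2 ih2 E] := inner8_normal r ih.
  by exists (h2 * h') => //; split; [apply: inner8M | rewrite mulgA E mulgA].
have iz : inner8 bz by rewrite -nuq_z; apply: inner8_nuq.
have [k0 ik0 baE0] := ba_relation.
elim/B4_ind: g => [|_ [r [h rR [ih ->]]]|_ [r [h rR [ih ->]]]|u _ [r [h rR [ih ->]]]].
- exists 1, 1; first by rewrite !inE eqxx.
  split; last by rewrite mulg1.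
  by rewrite -(mulhom1 nuq); apply: inner8_nuq.
- move: rR; rewrite !inE => /or3P[/eqP->|/eqP->|/or4P[]/eqP->].
  + by exists ba, h; rewrite ?inE ?eqxx ?orbT // mul1g.
  + by exists (ba * bb), h; rewrite ?inE ?eqxx ?orbT // !mulgA.
  + by exists (ba * (bb * bb)), h; rewrite ?inE ?eqxx ?orbT // !mulgA.
  + have := Tn bz 1 h iz ih; rewrite mul1g -baa mulgA; apply.
    by rewrite !inE eqxx.
  + have := Tn bz bb h iz ih; rewrite -baa !mulgA; apply.
    by rewrite !inE eqxx orbT.
  + have := Tn bz (bb * bb) h iz ih; rewrite -baa !mulgA; apply.
    by rewrite !inE eqxx !orbT.
- move: rR; rewrite !inE => /or3P[/eqP->|/eqP->|/or4P[]/eqP->].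
  + by exists bb, h; rewrite ?inE ?eqxx ?orbT // mul1g.
  + by exists (bb * bb), h; rewrite ?inE ?eqxx ?orbT // !mulgA.
  + have := Tn bz 1 h iz ih; rewrite mul1g -bbbb !mulgA; apply.
    by rewrite !inE eqxx.
  + exists (ba * (bb * bb)), (k0 * h); first by rewrite !inE eqxx !orbT.
    by split; [apply: inner8M | rewrite !mulgA baE0 !mulgA].
  + have [k1 ik1 E1] := inner8_normal bb ik0.
    have [z1 iz1 Ez] := inner8_normal 1 iz; rewrite mulg1 mul1g in Ez.
    exists ba, (bz * (k1 * h)); first by rewrite !inE eqxx !orbT.
    split; first by apply: inner8M => //; apply: inner8M.
    rewrite -bbbb !mulgA baE0 -!mulgA; do 3 congr (_ * _).
    by rewrite (mulgA k0) E1 -!mulgA.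
  + have [k1 ik1 E1] := inner8_normal (bb * bb) ik0.
    have [z1 iz1 E2] := inner8_normal bb iz.
    exists (ba * bb), (z1 * (k1 * h)); first by rewrite !inE eqxx !orbT.
    split; first by apply: inner8M => //; apply: inner8M.
    transitivity (ba * (bz * bb) * (k1 * h)); last by rewrite E2 !mulgA.
    rewrite -bbbb !mulgA baE0 -!mulgA; do 3 congr (_ * _).
    by rewrite !mulgA -(mulgA k0) E1 -!mulgA.
- by apply: Tn => //; apply: inner8_nuq.
Qed.

End InnerActions.

(* [C] and [D] play the roles of [x] and [y] in the definition of [q8_aut j]. *)
Definition acts_as (j : q8_action) (g : B4S2) (C D : q8m) :=
  C * D <> D * C /\
  match j with
  | act1 => g * nuq C = nuq C * g /\ g * nuq D = nuq D * g
  | act2 => g * nuq C = nuq D * g /\ g * nuq D = nuq C * g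
  | act3 => g * nuq C = nuq D * g /\ g * nuq D = nuq (C * D) * g
  end.

Definition q8m_acts_as (j : q8_action) (A B C D : q8m) : bool :=
  (C * D != D * C) &&
  match j with
  | act1 => (q8m_app A B C == C) && (q8m_app A B D == D)
  | act2 => (q8m_app A B C == D) && (q8m_app A B D == C)
  | act3 => (q8m_app A B C == D) && (q8m_app A B D == C * D)
  end.

Lemma acts_asP j g A B C D : acts_by g A B -> q8m_acts_as j A B C D -> acts_as j g C D.
Proof.
move=> gAB /andP[/eqP CD jE]; split=> //.
by case: j jE => /andP[/eqP E1 /eqP E2]; rewrite !(acts_by_app _ gAB) E1 E2.
Qed.

Lemma acts_as_centralM j g k C D : acts_as j g C D ->
  (forall v, commute k (nuq v)) -> acts_as j (g * k) C D.
Proof.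
move=> [CD jE] kN; split=> //; move: jE.
by case: j => -[E1 E2]; rewrite -!mulgA !kN !(mulgA g) E1 E2 !mulgA.
Qed.

(** The trivial coset has type [act1], the two of order 3 have type [act3], the three of order 2
    have type [act2]; the disjunction retains this so that an involution is known to be of type
    [act2]. The factor [v] removes the inner part of the action on the pair [C], [D]. *)
Lemma acts_as_ex g : exists j v C D, acts_as j (nuq v * g) C D /\
  (j = act2 \/ rho2 g = 1 \/ rho2 (g * g) <> 1).
Proof.
have [r [u [k [rR gE ku k1]]]] := coset_decomposition g.
have gr : rho2 g = rho2 r by rewrite gE !gmulfM rho2_nuq k1 !mulg1.
suff [j [v [C [D [jv jr]]]]] : exists j v C D, acts_as j (nuq v * r) C D /\
    (j = act2 \/ rho2 r = 1 \/ rho2 (r * r) <> 1).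
  have [w ru] := nuq_normal r u^-1.
  exists j, (v * w), C, D; split; last first.
    by rewrite gr gmulfM gr -gmulfM.
  have -> : nuq (v * w) * g = nuq v * r * k; last exact: acts_as_centralM.
  rewrite gE gmulfM -!mulgA (mulgA (nuq w)) -ru !mulgA -(mulgA _ (nuq u^-1)).
  by rewrite -gmulfM mulVg mulhom1 mulg1.
have Ar v A B : acts_by r A B -> acts_by (nuq v * r) _ _ := acts_by_mul (acts_by_nuq v).
have bbAB := acts_by_mul acts_by_b acts_by_b.
move: rR Ar {gE gr}; rewrite !inE => /or3P[/eqP->|/eqP->|/or4P[]/eqP->] Ar.
- exists act1, 1, qmx, qmy; split; last by right; left; rewrite mulhom1.
  by rewrite mulg1; apply: acts_asP (acts_by_nuq 1) _.
- exists act3, 1, qmx, (qmx * qmy); split; last by right; right; rewrite gmulfM rho2_b => /eqP.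
  by apply: acts_asP (Ar 1 _ _ acts_by_b) _.
- exists act3, 1, qmx^-1, qmy; split; last by right; right; rewrite !gmulfM rho2_b => /eqP.
  by apply: acts_asP (Ar 1 _ _ bbAB) _.
- exists act2, 1, qmx, (qmx * qmy); split; last by left.
  by apply: acts_asP (Ar 1 _ _ acts_by_a) _.
- exists act2, qmy, qmy, (qmx * qmy); split; last by left.
  by apply: acts_asP (Ar qmy _ _ (acts_by_mul acts_by_a acts_by_b)) _.
- exists act2, qmy, qmx, qmy; split; last by left.
  by apply: acts_asP (Ar qmy _ _ (acts_by_mul acts_by_a bbAB)) _.
Qed.

Lemma rho7_nuq_inj : injective (rho7 \o nuq).
Proof.
have boI : injective (rho7 \o nu).
  apply: q8_hom_inj; rewrite /= gmulfM nu_x -bzE rho7_z => /eqP; by [].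
by move=> u v E; apply: (can_inj q8_wordK); apply: boI; apply: E.
Qed.

Lemma q8m_center (w C D : q8m) : w * C = C * w -> w * D = D * w ->
  C * D <> D * C -> w = 1 \/ w = (true, false, false).
Proof.
move=> /eqP wC /eqP wD /eqP CD.
suff /orP[/eqP->|/eqP->] : (w == 1) || (w == (true, false, false)) by [left | right].
apply: contraTT CD => w1; rewrite negbK; move: wC wD w1.
case: w C D => [[i j] k] [[i' j'] k'] [[i2 j2] k2].
by case: i j k i' j' k' i2 j2 k2 => [] [] [] [] [] [] [] [] [].
Qed.

(* [h * h = 1] is excluded because -1 is the only involution of SL(2, 7), while
   [h] does not centralize the quaternion group. *)
Lemma order2_acts_as g : rho g <> 1 -> rho (g * g) = 1 ->
  exists h v C D, [/\ h = nuq v * g, acts_as act2 h C D & h * h = bz].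
Proof.
move=> g1 g2; have [j [v [C [D [jv jg]]]]] := acts_as_ex g.
have {jg} jE : j = act2.
  case: jg => [//|[qg|]]; last by rewrite /rho2 /= g2 mulhom1.
  case: g1; apply: (@psl_red1_torsion_free _ 1%N) => //.
  by rewrite expg2 -gmulfM.
rewrite jE in jv; exists (nuq v * g), v, C, D; split=> //.
set h := nuq v * g in jv *; have [CD [hC hD]] := jv.
have [w hh] : exists w, h * h = nuq w.
  by apply: rho_kernel; rewrite gmulfM /h gmulfM rho_nuq mul1g -gmulfM.
clearbody h; have wC : w * C = C * w.
  by apply: nuq_inj; rewrite !gmulfM -hh -mulgA hC mulgA hD -mulgA.
have wD : w * D = D * w.
  by apply: nuq_inj; rewrite !gmulfM -hh -mulgA hD mulgA hC -mulgA.
have [w1|wz] : w = 1 \/ w = (true, false, false).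
  exact: q8m_center wC wD CD.
- exfalso; apply: CD; apply: rho7_nuq_inj.
  have ho : rho7 h = 1 \/ rho7 h = sl2_opp 1.
    by apply: sl2_involution => //; rewrite -gmulfM hh w1 !mulhom1.
  have : rho7 (nuq C) = rho7 (nuq D).
    apply: (mulgI (rho7 h)); rewrite -gmulfM hC gmulfM.
    by case: ho => ->; rewrite ?mul1g ?mulg1 // sl2_mulgN sl2_mulNg mul1g mulg1.
  by move=> /rho7_nuq_inj ->.
- by rewrite hh wz nuq_z.
Qed.

(** * Extensions of cyclic and dihedral groups by the quaternion group *)

Lemma pres_intertwine (X : Type) (R : word X -> word X -> Prop) (G : groupType)
    (F F' : {multiplicative presented R -> G}) (h : G) :
  (forall x, h * F (pgen R x) = F' (pgen R x) * h) ->
  forall a, h * F a = F' a * h.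
Proof.
move=> hF; elim/quotW=> w; rewrite -weval_pgen.
elim: w => [x||u IHu v IHv|u IHu] /=; first exact: hF.
- by rewrite !mulhom1 mulg1 mul1g.
- by rewrite !gmulfM mulgA IHu -mulgA IHv mulgA.
- rewrite !mulhomV; apply: (mulgI (F' (weval (pgen R) u))).
  by rewrite mulgA -IHu mulgK mulVKg.
Qed.

Lemma lift_through (C A G : groupType) (f : {multiplicative A -> G})
    (g : {multiplicative C -> G}) :
  injective f -> (forall c, exists a, g c = f a) ->
  exists i : {multiplicative C -> A}, forall c, f (i c) = g c.
Proof.
move=> fI /choice[i iE].
have iM : {morph i : x y / x * y}.
  by move=> x y; apply: fI; rewrite gmulfM -!iE gmulfM.
pose i' : {multiplicative C -> A} := HB.pack i (isMultiplicative.Build C A i iM).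
by exists i' => c; rewrite -iE.
Qed.

Section CyclicExtension.
Variable w : B4S2.
Hypothesis iw : inf_order (rho w).

Definition zgroup : set B4S2 := [set g | exists k, rho g = zexp (rho w) k].

Lemma rho_fiber g h : rho g = rho h -> exists u, g = nuq u * h.
Proof.
move=> gh; have [u E] : exists u, g * h^-1 = nuq u.
  by apply: rho_kernel; rewrite gmulfM mulhomV gh mulgV.
by exists u; rewrite -E mulgVK.
Qed.

Definition q8m_enum : seq q8m :=
  [seq (ij, k) | ij <- [seq (i, j) | i <- [:: false; true], j <- [:: false; true]],
                 k <- [:: false; true]].

Lemma mem_q8m_enum u : u \in q8m_enum.
Proof. by case: u => [[[] []] []]. Qed.

Lemma zgroup_subgroup : is_subgroup zgroup.
Proof.
apply: is_subgroupP => [|g h [k gk] [l hl]|g [k gk]].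
- by exists 0%R; rewrite mulhom1.
- by exists (k + l)%R; rewrite gmulfM gk hl zexpD.
- by exists (- k)%R; rewrite mulhomV gk zexpN.
Qed.

Lemma zgroup_vc : virtually_cyclic zgroup.
Proof.
apply/virtually_cyclicP; exists w, [seq nuq u | u <- q8m_enum].
split; first exact: zgroup_subgroup.
  by exists 1%R.
move=> g [k gk]; have [u ->] : exists u, g = nuq u * zexp w k.
  by apply: rho_fiber; rewrite zexp_hom.
exists (nuq u); last by exists k.
by apply/mapP; exists u => //; apply: mem_q8m_enum.
Qed.

(** Through [th], which takes [C] and [D] as generators, the lift [w'] acts exactly as [q8_aut j],
    so [(a, k)] can be sent to [nu (th a) * zexp w' k]. The exponent is recovered from [rho], since
    [rho w] has infinite order. *)
Lemma zgroup_isom j v C D : acts_as j (nuq v * w) C D -> isom_to zgroup (Q8Z j).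
Proof.
set w' := nuq v * w; have bw : rho w' = rho w by rewrite gmulfM rho_nuq mul1g.
clearbody w'; move=> [CD jE].
have CD' : q8_word C * q8_word D <> q8_word D * q8_word C.
  by rewrite -!gmulfM => /(can_inj q8_wordK).
have [th [thx thy thI thS]] := q8_automorphism CD'.
have base r : w' * nu (th r) = nu (th (aut_map (q8_aut j) r)) * w'.
  apply: (@pres_intertwine _ _ _ (nu \o th) (nu \o th \o aut_map (q8_aut j)) w' _ r).
  have nw u : nu (q8_word u) = nuq u by [].
  case: j jE => -[E1 E2] -[];
    rewrite /= -?[pgen _ qx]/q8x -?[pgen _ qy]/q8y ?(q8_lift_x, q8_lift_y).
  - by rewrite thx nw E1.
  - by rewrite thy nw E2.
  - by rewrite thx thy !nw E1.
  - by rewrite thx thy !nw E2.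
  - by rewrite thx thy !nw E1.
  - by rewrite thy gmulfM thx thy -gmulfM !nw E2.
have step k r : zexp w' k * nu (th r) = nu (th (aut_zpow (q8_aut j) k r)) * zexp w' k.
  elim/int_rec: k => [|n IHn|n IHn]; first by rewrite /= mul1g mulg1.
    by rewrite -addn1 PoszD aut_zpowS addrC !zexpD -!mulgA IHn mulgA base -!mulgA.
  rewrite -addn1 PoszD opprD aut_zpowP addrC !zexpD -!mulgA IHn mulgA.
  rewrite [zexp w' (-1)%R]/= mulgA; congr (_ * _); apply: (mulgI w').
  by rewrite mulVKg mulgA base aut_invK mulgK.
pose f (a : Q8Z j) : B4S2 := nu (th a.1) * zexp w' a.2.
have fM : {morph f : a b / a * b}.
  move=> [q k] [r l]; rewrite /f /= !gmulfM zexpD -!mulgA; congr (_ * _).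
  by rewrite !mulgA step.
pose f' : {multiplicative Q8Z j -> B4S2} := HB.pack f (isMultiplicative.Build _ _ f fM).
have bf a : rho (f a) = zexp (rho w) a.2.
  by rewrite /f gmulfM nu_nuq rho_nuq mul1g zexp_hom bw.
exists f'.
  apply: mulhom_inj => -[q k] fqk.
  have k0 : k = 0%R.
    by apply: (inf_order_zexp iw); rewrite -(bf (q, k)) -[f _]/(f' (q, k)) fqk mulhom1.
  move: fqk; rewrite k0 -[f' _]/(nu (th q) * 1) mulg1 => thq.
  suff -> : q = 1 by [].
  by apply: thI; apply: nu_inj; rewrite thq !mulhom1.
apply/seteqP; split=> [_ [a _ <-]|g [k gk]].
  by exists a.2; apply: bf.
have [u gE] : exists u, g = nuq u * zexp w' k.
  by apply: rho_fiber; rewrite zexp_hom bw.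
have [q qE] := thS (q8_word u).
by exists (q, k) => //; rewrite gE -[LHS]/(nu (th q) * zexp w' k) -qE nu_nuq q8_wordK.
Qed.

Lemma zgroup_isom_ex : exists j, isom_to zgroup (Q8Z j).
Proof.
have [j [v [C [D [jv _]]]]] := acts_as_ex w.
by exists j; apply: zgroup_isom jv.
Qed.

End CyclicExtension.

(** * Dicyclic groups and preimages of involutions *)

Section DicyclicWords.
Variable m : nat.
Hypothesis m0 : 0 < m.
Local Notation D := (presented (quat_rel m)).
Local Notation X := (pgen (quat_rel m) qx).
Local Notation Y := (pgen (quat_rel m) qy).

Lemma dic_pow : X ^+ m = Y * Y.
Proof.
have wX (n : nat) : weval (pgen (quat_rel m)) (Gen qx ^+ n) = X ^+ n.
  by elim: n => [//|[//|n] IH]; rewrite expgS -IH.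
by rewrite -wX (pgen_rel (quat_pow m)).
Qed.

Lemma dic_conj : Y * X * Y^-1 = X^-1. Proof. exact: (pgen_rel (quat_conj m)). Qed.

Lemma dic_yx (n : nat) : Y * X ^+ n = X ^- n * Y.
Proof.
have /= E := conj_zexp Y X n; rewrite dic_conj expVgn in E.
by rewrite -E mulgVK.
Qed.

(** Conjugation by [Y] inverts [X ^+ m], yet fixes it because it is the square of [Y]. *)
Lemma dic_x2m : X ^+ (m + m) = 1.
Proof.
rewrite expgnDr.
suff {1}-> : X ^+ m = X ^- m by rewrite mulVg.
by apply: (mulIg Y); rewrite -dic_yx dic_pow mulgA.
Qed.

Lemma dic_word (q : D) : exists (n : nat) (j : bool), q = X ^+ n * Y ^+ j.
Proof.
have xV (n : nat) : exists l : nat, X ^- n = X ^+ l.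
  exists (n * (m + m) - n); rewrite expgnFr ?leq_pmulr ?addn_gt0 ?m0 //.
  by rewrite mulnC expgnA dic_x2m expg1n mul1g.
pose T (q : D) := exists (n : nat) (j : bool), q = X ^+ n * Y ^+ j.
have Tx (l : nat) r : T r -> T (X ^+ l * r).
  by move=> [n [j ->]]; exists (l + n), j; rewrite expgnDr mulgA.
have Ty r : T r -> T (Y * r).
  move=> [n [j ->]]; have [l lE] := xV n.
  rewrite mulgA dic_yx lE; case: j => /=; last by exists l, true; rewrite mulg1.
  by exists (l + m), false; rewrite expg1 -mulgA -dic_pow expgnDr mulg1.
have TxV r : T r -> T (X^-1 * r).
  by move=> Tr; have [l lE] := xV 1%N; rewrite -[X^-1]/(X ^- 1) lE; apply: Tx.
have TyV r : T r -> T (Y^-1 * r).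
  move=> Tr; have -> : Y^-1 = X ^+ m * Y.
    apply: (mulgI Y); rewrite mulgV mulgA dic_yx -mulgA -dic_pow mulVg.
    done.
  by rewrite -mulgA; apply/Tx/Ty.
apply: (presented_ind (T := T)); first by exists 0%N, false; rewrite mulg1.
  by move=> [] r; [apply: (Tx 1%N) | apply: Ty].
by move=> [] r; [apply: TxV | apply: TyV].
Qed.

End DicyclicWords.

Local Notation Q16x := (pgen (quat_rel 4) qx).
Local Notation Q16y := (pgen (quat_rel 4) qy).

(** A nontrivial kernel contains x^4. If it contains x^n y, then [f] maps y to a power of the image
    of x, which is thus both fixed and inverted and squares to 1. If it contains x^n with n not
    divisible by 8, some multiple of n is 4 modulo 8. *)
Lemma q16_hom_inj (G : groupType) (f : {multiplicative Q16 -> G}) :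
  f (Q16x ^+ 4) <> 1 -> injective f.
Proof.
move=> f4; apply: mulhom_inj => q; have [n [j ->]] := dic_word (isT : 0 < 4) q.
have x8 : Q16x ^+ 8 = 1 := dic_x2m 4.
rewrite gmulfM mulhomX; case: j => /=.
  rewrite expg1 => E; case: f4.
  have fy : f Q16y = f Q16x ^- n by apply/esym/mulg1_eq.
  have : f Q16y * f Q16x * (f Q16y)^-1 = (f Q16x)^-1.
    by rewrite -!mulhomV -!gmulfM dic_conj.
  rewrite fy invgK -expVgn.
  have -> : (f Q16x)^-1 ^+ n * f Q16x = f Q16x * (f Q16x)^-1 ^+ n.
    by apply/esym/commuteX/commuteV.
  rewrite expVgn mulgVK => fx.
  have fx2 : f Q16x ^+ 2 = 1 by rewrite expg2 {1}fx mulVg.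
  by rewrite mulhomX (expgnA _ 2 2) fx2 expg1n.
rewrite expg0 mulhom1 !mulg1 => fn.
have fx8 : f Q16x ^+ 8 = 1 by rewrite -mulhomX x8 mulhom1.
suff nuq : n %% 8 = 0%N.
  by rewrite {1}(divn_eq n 8) nuq addn0 mulnC expgnA x8 expg1n.
have fr : f Q16x ^+ (n %% 8) = 1.
  by move: fn; rewrite {1}(divn_eq n 8) expgnDr mulnC expgnA fx8 expg1n mul1g.
have key k l : f Q16x ^+ l = 1 -> l * k = 4 %[mod 8] -> False.
  move=> fl lk; apply: f4; rewrite mulhomX.
  have red i : f Q16x ^+ i = f Q16x ^+ (i %% 8).
    by rewrite {1}(divn_eq i 8) expgnDr mulnC expgnA fx8 expg1n mul1g.
  by rewrite red -lk -red expgnA fl expg1n.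
have : n %% 8 < 8 by rewrite ltn_mod.
case: (n %% 8) fr => [//|[|[|[|[|[|[|[|//]]]]]]]] fr _; exfalso.
- exact: (key 4 _ fr).
- exact: (key 2 _ fr).
- exact: (key 4 _ fr).
- exact: (key 1%N _ fr).
- exact: (key 4 _ fr).
- exact: (key 2 _ fr).
- exact: (key 4 _ fr).
Qed.

(** The lift [h'] exchanges [C] and [D] and squares to [bz]. So for A = h' C one gets A^2 = z D C
    and A^4 = z, and [h'] inverts A: these are the relations of Q16. *)
Lemma q16_embedding h : rho h <> 1 -> rho (h * h) = 1 ->
  exists f : {multiplicative Q16 -> B4S2}, injective f /\
    forall g, (exists a, g = f a) <-> rho g = 1 \/ rho g = rho h.
Proof.
move=> h1 h2; have [h' [v [C [D [h'E [CD [hC hD]] hh]]]]] := order2_acts_as h1 h2.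
have bh : rho h' = rho h by rewrite h'E gmulfM rho_nuq mul1g.
clear h'E.
have [CC DC gen] := q8m_generation CD.
have zE : C * C = (true, false, false).
  have : C * D != D * C by apply/eqP.
  by case: C D {hC hD CD CC DC gen} => [[[] []] []] [[[] []] []].
have CV : C^-1 * (true, false, false) = C.
  by rewrite -zE mulKg.
have DC2 : (D * C) * (D * C) = (true, false, false).
  have : C * D != D * C by apply/eqP.
  by case: C D {hC hD CD CC DC gen zE CV} => [[[] []] []] [[[] []] []].
have hV : h'^-1 = nuq (true, false, false) * h'.
  by apply: (mulIg h'); rewrite mulVg -mulgA hh nuq_z bzz.
have [A AE] : exists A, A = h' * nuq C by exists (h' * nuq C).
have AA : A * A = nuq (((true, false, false) : q8m) * (D * C)).
  by rewrite AE -mulgA (mulgA (nuq C)) -hD !gmulfM nuq_z -hh !mulgA.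
have AV : h' * A * h'^-1 = A^-1.
  transitivity (nuq C * h'); first by rewrite AE hC mulgA mulgK hD.
  by rewrite AE invgM hV -mulhomV mulgA -gmulfM CV.
have fR u v0 : quat_rel 4 u v0 ->
    weval (fun q => match q with qx => A | qy => h' end) u =
    weval (fun q => match q with qx => A | qy => h' end) v0.
  case=> //; transitivity (A * A * (A * A)); first by rewrite -mulgA.
  transitivity (h' * h'); last by [].
  rewrite AA hh -gmulfM -nuq_z; congr (nuq _); rewrite -DC2.
  by case: (D * C) => [[[] []] []].
have [f [fx fy]] : exists f : {multiplicative Q16 -> B4S2}, f Q16x = A /\ f Q16y = h'.
  exists (pres_lift fR); split; first exact: (pres_lift_gen fR qx).
  exact: (pres_lift_gen fR qy).
have f4 : f (Q16x ^+ 4) <> 1.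
  rewrite dic_pow gmulfM fy hh; exact: bz_neq1.
exists f; split; first exact: (q16_hom_inj f4).
have bA : rho A = rho h by rewrite AE gmulfM rho_nuq mulg1.
have ff g : rho (f g) = 1 \/ rho (f g) = rho h.
  have [n [j ->]] := dic_word (isT : 0 < 4) g.
  have hn (i : nat) : rho h ^+ i = 1 \/ rho h ^+ i = rho h.
    elim: i => [|i [IH|IH]]; [by left | |]; rewrite expgS IH ?mulg1; [by right|left].
    by rewrite -gmulfM.
  have -> : rho (f (Q16x ^+ n * Q16y ^+ j)) = rho h ^+ (n + j).
    by rewrite gmulfM !mulhomX fx fy gmulfM !mulhomX bA bh expgnDr.
  exact: hn.
have fN u : exists a, nuq u = f a.
  have fC : nuq C = f (Q16y^-1 * Q16x) by rewrite gmulfM mulhomV fx fy AE mulKg.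
  have fD : nuq D = f (Q16x * Q16y^-1) by rewrite gmulfM mulhomV fx fy AE hC mulgK.
  have [t ->] := gen u.
  by rewrite !(gmulfM, mulhomX) fC fD -!(gmulfM, mulhomX); eexists.
move=> g; split=> [[a ->]|[g1|gh]]; first exact: ff.
  by have [u ->] := rho_kernel g1; apply: fN.
have [u ->] : exists u, g = nuq u * h' by apply: rho_fiber; rewrite bh.
have [a ->] := fN u.
by exists (a * Q16y); rewrite gmulfM fy.
Qed.

(** * Preimages of infinite dihedral groups *)

Section DihedralExtension.
Variables w h : B4S2.
Hypothesis iw : inf_order (rho w).
Hypotheses (hw : rho h * rho w = (rho w)^-1 * rho h).
Hypotheses (h2 : rho h * rho h = 1) (h1 : rho h <> 1).

Definition dgroup : set B4S2 := [set g | exists k (d : bool),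
  rho g = zexp (rho w) k * rho h ^+ d].

Lemma dgroup_flip k : rho h * zexp (rho w) k = zexp (rho w) (- k)%R * rho h.
Proof.
have E := conj_zexp (rho h) (rho w) k; rewrite hw mulgK in E.
have -> : zexp (rho w) (- k)%R = zexp (rho w)^-1 k.
  by rewrite -[(rho w)^-1]/(zexp (rho w) (-1)%R) -zexpM mulN1r.
by rewrite -E mulgVK.
Qed.

Lemma dgroup_flipX k (d : bool) :
  rho h ^+ d * zexp (rho w) k = zexp (rho w) (if d then - k else k)%R * rho h ^+ d.
Proof. by case: d; rewrite /= ?expg1 ?dgroup_flip // expg0 mul1g mulg1. Qed.

Lemma dgroup_hX (d e : bool) : rho h ^+ d * rho h ^+ e = rho h ^+ (d (+) e).
Proof. by case: d; case: e; rewrite /= ?expg1 ?expg0 ?h2 ?mulg1 ?mul1g. Qed.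

Lemma dgroup_neq1 k : zexp (rho w) k * rho h <> 1.
Proof.
move=> E; have hE : rho h = zexp (rho w) (- k)%R.
  by rewrite zexpN; apply/esym/mulg1_eq.
move: hw; rewrite hE -[X in _ * X]/(zexp (rho w) 1%R) -[(rho w)^-1]/(zexp (rho w) (-1)%R).
by rewrite -!zexpD => /(zexp_inj iw); lia.
Qed.

Lemma dgroup_subgroup : is_subgroup dgroup.
Proof.
apply: is_subgroupP => [|g g' [k [d gk]] [l [e gl]]|g [k [d gk]]].
- by exists 0%R, false; rewrite mulhom1 mulg1.
- exists (k + (if d then - l else l))%R, (d (+) e).
  rewrite gmulfM gk gl -mulgA (mulgA (rho h ^+ d)) dgroup_flipX.
  by rewrite -!mulgA dgroup_hX !mulgA zexpD.
- exists (if d then k else - k)%R, d.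
  rewrite mulhomV gk; apply: (mulIg (zexp (rho w) k * rho h ^+ d)).
  rewrite mulVg -mulgA (mulgA (rho h ^+ d)) dgroup_flipX -!mulgA dgroup_hX addbb mulg1 -zexpD.
  by case: d {gk}; rewrite ?subrr ?addNr.
Qed.

Lemma dgroup_h : dgroup h.
Proof. by exists 0%R, true; rewrite mul1g. Qed.

Lemma dgroup_vc : virtually_cyclic dgroup.
Proof.
apply/virtually_cyclicP.
exists w, ([seq nuq u | u <- q8m_enum] ++ [seq nuq u * h | u <- q8m_enum]).
split; first exact: dgroup_subgroup.
  by exists 1%R, false; rewrite mulg1.
move=> g [k [[] gk]].
  have [u ->] : exists u, g = nuq u * (h * zexp w (- k)%R).
    by apply: rho_fiber; rewrite gmulfM zexp_hom dgroup_flip opprK gk expg1.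
  exists (nuq u * h); last by exists (- k)%R; rewrite mulgA.
  by rewrite mem_cat; apply/orP; right; apply/mapP; exists u => //; apply: mem_q8m_enum.
have [u ->] : exists u, g = nuq u * zexp w k.
  by apply: rho_fiber; rewrite zexp_hom gk mulg1.
exists (nuq u); last by exists k.
by rewrite mem_cat; apply/orP; left; apply/mapP; exists u => //; apply: mem_q8m_enum.
Qed.

Section Amalgam.
Variables (f1 f2 : {multiplicative Q16 -> B4S2}) (i k : {multiplicative Q8 -> Q16}).
Hypotheses (f1I : injective f1) (f2I : injective f2).
Hypothesis f1P : forall g, (exists a, g = f1 a) <-> rho g = 1 \/ rho g = rho h.
Hypothesis f2P : forall g, (exists a, g = f2 a) <-> rho g = 1 \/ rho g = rho (h * w).
Hypotheses (f1i : forall q, f1 (i q) = nu q) (f2k : forall q, f2 (k q) = nu q).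

Local Notation Am := (amalgam i k).
Local Notation gen c := (pgen (amalgam_rel i k) c : Am).

Definition am_gen (c : Q16 + Q16) : B4S2 := match c with inl a => f1 a | inr a => f2 a end.

Fact am_rel u v : amalgam_rel i k u v -> weval am_gen u = weval am_gen v.
Proof. by case=> [a a'|b b'|c] /=; rewrite -?gmulfM ?f1i ?f2k. Qed.

Definition am_hom : {multiplicative Am -> B4S2} := pres_lift am_rel.

Lemma am_hom_gen c : am_hom (gen c) = am_gen c.
Proof. exact: (pres_lift_gen am_rel c). Qed.

Lemma am_inlM a a' : gen (inl a) * gen (inl a') = gen (inl (a * a')).
Proof. exact: (pgen_rel (amalgam_l i k a a')). Qed.

Lemma am_inrM a a' : gen (inr a) * gen (inr a') = gen (inr (a * a')).
Proof. exact: (pgen_rel (amalgam_r i k a a')). Qed.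

Lemma am_c q : gen (inl (i q)) = gen (inr (k q)).
Proof. exact: (pgen_rel (amalgam_c i k q)). Qed.

Variables A1 A2 : Q16.
Hypotheses (A1E : f1 A1 = h) (A2E : f2 A2 = h * w).

Local Notation J q := (gen (inl (i q))).
Local Notation S := (gen (inl A1)).
Local Notation T := (gen (inr A2)).

Fixpoint am_alt (b : bool) (n : nat) : Am :=
  if n is n'.+1 then (if b then S else T) * am_alt (~~ b) n' else 1.

Lemma nu_code u : nu (q8_word u) = nuq u. Proof. by []. Qed.

Lemma am_JM q r : J q * J r = J (q * r).
Proof. by rewrite am_inlM -gmulfM. Qed.

Lemma am_J1 : J 1 = 1.
Proof. by apply: (mulgI (J 1)); rewrite am_JM !mulg1. Qed.

Lemma am_S q : exists r, S * J q = J r * S.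
Proof.
have [u E] := nuq_normal h (q8_code q); exists (q8_word u).
rewrite !am_inlM; congr (pgen _ (inl _)); apply: f1I.
by rewrite !gmulfM !f1i A1E nu_code -E nu_nuq.
Qed.

Lemma am_T q : exists r, T * J q = J r * T.
Proof.
have [u E] := nuq_normal (h * w) (q8_code q); exists (q8_word u).
rewrite !am_c !am_inrM; congr (pgen _ (inr _)); apply: f2I.
by rewrite !gmulfM !f2k A2E nu_code -E nu_nuq.
Qed.

Lemma am_SS : exists q, S * S = J q.
Proof.
have [u E] : exists u, h * h = nuq u by apply: rho_kernel; rewrite gmulfM h2.
exists (q8_word u); rewrite am_inlM; congr (pgen _ (inl _)); apply: f1I.
by rewrite gmulfM f1i A1E nu_code E.
Qed.

Lemma am_TT : exists q, T * T = J q.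
Proof.
have [u E] : exists u, (h * w) * (h * w) = nuq u.
  by apply: rho_kernel; rewrite !gmulfM {1}hw -mulgA (mulgA (rho h)) h2 mul1g mulVg.
exists (q8_word u); rewrite am_c am_inrM; congr (pgen _ (inr _)); apply: f2I.
by rewrite gmulfM f2k A2E nu_code E.
Qed.

Definition am_nf (a : Am) := exists q b n, a = J q * am_alt b n.

Lemma am_nfJ q a : am_nf a -> am_nf (J q * a).
Proof. by move=> [r [b [n ->]]]; exists (q * r), b, n; rewrite mulgA am_JM. Qed.

Lemma am_nfST (b : bool) a : am_nf a -> am_nf ((if b then S else T) * a).
Proof.
move=> [q [c [n ->]]].
have [r rE] : exists r, (if b then S else T) * J q = J r * (if b then S else T).
  by case: (b); [apply: am_S | apply: am_T].
rewrite mulgA rE -mulgA; apply: am_nfJ.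
case: n => [|n]; first by exists 1, b, 1%N; rewrite am_J1 mul1g.
have [->|bc] := eqVneq c (~~ b).
  by exists 1, b, n.+2; rewrite am_J1 mul1g.
have {bc} <- : b = c by case: b c bc {rE} => -[].
have [s sE] : exists s, (if b then S else T) * (if b then S else T) = J s.
  by case: (b); [apply: am_SS | apply: am_TT].
by rewrite /= mulgA sE; exists s, (~~ b), n.
Qed.

Lemma am_inl a : exists q (d : bool), gen (inl a) = J q * S ^+ d.
Proof.
have [ga|ga] : rho (f1 a) = 1 \/ rho (f1 a) = rho h by apply/f1P; exists a.
  have [u uE] := rho_kernel ga; exists (q8_word u), false; rewrite mulg1.
  by congr (pgen _ (inl _)); apply: f1I; rewrite f1i uE.
have [u uE] := rho_fiber ga; exists (q8_word u), true.
rewrite expg1 am_inlM; congr (pgen _ (inl _)); apply: f1I.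
by rewrite gmulfM f1i A1E uE.
Qed.

Lemma am_inr a : exists q (d : bool), gen (inr a) = J q * T ^+ d.
Proof.
have [ga|ga] : rho (f2 a) = 1 \/ rho (f2 a) = rho (h * w) by apply/f2P; exists a.
  have [u uE] := rho_kernel ga; exists (q8_word u), false; rewrite mulg1 am_c.
  by congr (pgen _ (inr _)); apply: f2I; rewrite f2k uE.
have [u uE] := rho_fiber ga; exists (q8_word u), true.
rewrite expg1 am_c am_inrM; congr (pgen _ (inr _)); apply: f2I.
by rewrite gmulfM f2k A2E uE.
Qed.

Lemma am_nf_gen c a : am_nf a -> am_nf (gen c * a).
Proof.
case: c => c na.
  have [q [d ->]] := am_inl c; rewrite -mulgA; apply: am_nfJ.
  by case: d; rewrite ?expg0 ?mul1g // expg1; apply: (am_nfST true).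
have [q [d ->]] := am_inr c; rewrite -mulgA; apply: am_nfJ.
by case: d; rewrite ?expg0 ?mul1g // expg1; apply: (am_nfST false).
Qed.

Lemma am_nfP a : am_nf a.
Proof.
have genV c : exists c', (gen c)^-1 = gen c'.
  case: c => c; [exists (inl c^-1)|exists (inr c^-1)]; apply: mulg1_eq.
    by rewrite am_inlM mulgV -am_J1 mulhom1.
  by rewrite am_inrM mulgV -am_J1 am_c mulhom1.
move: a; apply: (presented_ind (T := am_nf)) => [|c a|c a na].
- by exists 1, true, 0%N; rewrite am_J1 mulg1.
- exact: am_nf_gen.
- by have [c' ->] := genV c; apply: am_nf_gen.
Qed.

(** [S] and [T] map to [rho h] and [rho h * rho w], so [S * T] maps to [rho w] and [T * S] to its
    inverse; a word of odd length keeps one factor [rho h]. *)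
Lemma rho_am_alt n :
  rho (am_hom (am_alt true n)) = zexp (rho w) n./2 * rho h ^+ odd n /\
  rho (am_hom (am_alt false n)) = zexp (rho w) (- (Posz (uphalf n)))%R * rho h ^+ odd n.
Proof.
elim: n => [|n [IH1 IH2]]; first by rewrite /= mulhom1 !mulg1 mulhom1.
split; rewrite [am_alt _ _]/= gmulfM am_hom_gen /= ?A1E ?A2E !gmulfM ?IH1 ?IH2.
  rewrite mulgA dgroup_flip opprK -mulgA -[rho h in X in _ * X]expg1.
  by rewrite -[1%N]/(nat_of_bool true) dgroup_hX.
rewrite mulgA -(mulgA (rho h)) -[X in rho h * (X * _)]zexp1 -zexpD dgroup_flip -mulgA.
rewrite -[rho h in X in _ * X]expg1 -[1%N]/(nat_of_bool true) dgroup_hX.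
by congr (zexp _ _ * _); rewrite /=; lia.
Qed.

(** Alternating words of odd length map to reflections, and those of even positive length to nonzero
    powers of [rho w]. The kernel is thus confined to the amalgamated subgroup, where [nu] is
    injective. *)
Lemma am_hom_inj : injective am_hom.
Proof.
apply: mulhom_inj => a; have [q [b [n ->]]] := am_nfP a.
rewrite gmulfM am_hom_gen /= f1i => E.
have bE : rho (am_hom (am_alt b n)) = 1.
  by move/(congr1 rho): E; rewrite gmulfM nu_nuq rho_nuq mul1g mulhom1.
have [E1 E2] := rho_am_alt n.
have odd0 : odd n = false.
  apply/negP => on; case: b bE {E}; rewrite ?E1 ?E2 on expg1; exact: dgroup_neq1.
have n0 : n = 0%N.
  have : zexp (rho w) n./2 = 1 \/ zexp (rho w) (- (Posz (uphalf n)))%R = 1.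
    by case: b bE {E}; rewrite ?E1 ?E2 odd0 expg0 mulg1; [left | right].
  by case=> /(inf_order_zexp iw); lia.
move: E; rewrite n0 -[am_alt b 0]/(1 : Am) mulhom1 mulg1 => nq.
have -> : q = 1 by apply: nu_inj; rewrite mulhom1.
by rewrite am_J1 mulg1.
Qed.

Lemma am_hom_range : range am_hom = dgroup.
Proof.
apply/seteqP; split=> [_ [a _ <-]|g [l [d gl]]].
  have [q [b [n ->]]] := am_nfP a; rewrite /dgroup /= gmulfM am_hom_gen /= f1i.
  rewrite gmulfM nu_nuq rho_nuq mul1g; have [E1 E2] := rho_am_alt n.
  by case: b; rewrite ?E1 ?E2; do 2 eexists.
have rT : am_hom (S^-1 * T) = w by rewrite gmulfM mulhomV !am_hom_gen /= A1E A2E mulKg.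
have [u ->] : exists u, g = nuq u * (zexp w l * h ^+ d).
  by apply: rho_fiber; rewrite gmulfM zexp_hom mulhomX.
exists (J (q8_word u) * (zexp (S^-1 * T) l * S ^+ d)) => //.
by rewrite !gmulfM mulhomX zexp_hom rT !am_hom_gen /= f1i A1E.
Qed.

End Amalgam.

(** The image is generated by the involutions [rho h] and [rho (h * w)]. Their preimages are the two
    factors, and [i], [k] are the inclusions of the quaternion group read through [f1] and [f2]. *)
Lemma dgroup_isom : isom_to_Q16_amalgam dgroup.
Proof.
have [f1 [f1I f1P]] : exists f : {multiplicative Q16 -> B4S2}, injective f /\
    forall g, (exists a, g = f a) <-> rho g = 1 \/ rho g = rho h.
  by apply: q16_embedding => //; rewrite gmulfM.
have [f2 [f2I f2P]] : exists f : {multiplicative Q16 -> B4S2}, injective f /\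
    forall g, (exists a, g = f a) <-> rho g = 1 \/ rho g = rho (h * w).
  apply: q16_embedding; rewrite !gmulfM.
    by rewrite hw -[(rho w)^-1]/(zexp (rho w) (-1)%R); apply: dgroup_neq1.
  by rewrite {1}hw -mulgA (mulgA (rho h)) h2 mul1g mulVg.
have [i iE] : exists i : {multiplicative Q8 -> Q16}, forall q, f1 (i q) = nu q.
  by apply: lift_through => // q; apply/f1P; left; rewrite nu_nuq rho_nuq.
have [k kE] : exists i : {multiplicative Q8 -> Q16}, forall q, f2 (i q) = nu q.
  by apply: lift_through => // q; apply/f2P; left; rewrite nu_nuq rho_nuq.
have [A1 A1E] : exists a, h = f1 a by apply/f1P; right.
have [A2 A2E] : exists a, h * w = f2 a by apply/f2P; right.
exists i, k; split.
- by move=> q r qr; apply: nu_inj; rewrite -!iE qr.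
- by move=> q r qr; apply: nu_inj; rewrite -!kE qr.
exists (am_hom iE kE).
  exact: am_hom_inj f1I f2I f1P f2P iE kE A1 A2 (esym A1E) (esym A2E).
exact: am_hom_range f1I f2I f1P f2P iE kE A1 A2 (esym A1E) (esym A2E).
Qed.

End DihedralExtension.

(** * Maximal virtually cyclic subgroups *)

Lemma virtually_cyclic_dichotomy (H : set B4S2) : virtually_cyclic H ->
  finite_set H \/ exists w, [/\ H w, inf_order (rho w) & forall g, H g ->
    (exists k, rho g = zexp (rho w) k) \/
    [/\ rho g * rho w = (rho w)^-1 * rho g, rho g * rho g = 1 & rho g <> 1]].
Proof.
move=> /virtually_cyclicP[c [s vcH]]; have [sH Hc cs] := vcH.
have [ic|nic] := pselect (inf_order (rho c)); [right | left].
  have vcP : vc_by [set rho g | g in H] (rho c) [seq rho g | g <- s].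
    split.
    - apply: is_subgroupP => [|_ _ [g Hg <-] [h Hh <-]|_ [g Hg <-]].
      + by exists 1; [apply: subgroup1 | rewrite mulhom1].
      + by exists (g * h); [apply: subgroupM | rewrite gmulfM].
      + by exists g^-1; [apply: subgroupV | rewrite mulhomV].
    - by exists c.
    - move=> _ [g /cs[h hs [k ->]] <-]; exists (rho h); first exact: map_f.
      by exists k; rewrite gmulfM zexp_hom.
  have [_ [[w Hw <-] iw wP]] := virtually_cyclic_structure psl_centralizers vcP ic.
  by exists w; split=> // g Hg; apply: wP; exists g.
apply: (vc_by_finite vcH) => ic; apply: nic => n n0 cn.
have [u uE] : exists u, c ^+ n = nuq u by apply: rho_kernel; rewrite mulhomX.
(* The factor 4 is the exponent of the quaternion group. *)
apply: (ic (n * 4)%N); first by rewrite muln_gt0 n0.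
by rewrite expgnA uE -mulhomX -(mulhom1 nuq); congr (nuq _); case: (u) => [[[] []] []].
Qed.

Lemma finite_subgroup_torsion (G : groupType) (H : set G) g :
  is_subgroup H -> finite_set H -> H g -> ~ inf_order g.
Proof.
move=> sH /finite_seqP[s sE] Hg ig.
have vcH : vc_by H 1 s.
  split=> //; first exact: subgroup1.
  by move=> h; rewrite sE => hs; exists h => //; exists 0%R; rewrite mulg1.
have [n n0 [k]] := vc_by_power vcH Hg.
have -> : zexp (1 : G) k = 1 by case: k => m /=; rewrite expg1n ?invg1.
exact: ig.
Qed.

Lemma rho_inf_order g : inf_order (rho g) -> inf_order g.
Proof. by move=> ig n n0 gn; apply: (ig n n0); rewrite -mulhomX gn mulhom1. Qed.

Lemma inverting_pair (G : groupType) (w g h : G) : inf_order w ->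
  g * w = w^-1 * g -> h * w = w^-1 * h -> g * h * w <> w^-1 * (g * h).
Proof.
move=> iw gw hw E; apply: (iw 2%N) => //.
have gwV : g * w^-1 = w * g by apply: (mulgI w^-1); rewrite mulgA -gw mulgK mulKg.
have : w * (g * h) = w^-1 * (g * h) by rewrite -E -mulgA hw !mulgA gwV.
by move/mulIg => ww; rewrite expg2 {1}ww mulVg.
Qed.

Theorem maximal_infinite (H : set B4S2) :
  maximal_virtually_cyclic H -> infinite_set H ->
  (exists j : q8_action, isom_to H (Q8Z j)) \/ isom_to_Q16_amalgam H.
Proof.
move=> [vcH Hmax] infH; have sH : is_subgroup H by case: vcH.
have [//|[w [Hw iw wP]]] := virtually_cyclic_dichotomy vcH.
have [[h [Hh [hw h2 h1]]]|nh] := pselect (exists h, H h /\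
    [/\ rho h * rho w = (rho w)^-1 * rho h, rho h * rho h = 1 & rho h <> 1]); [right | left].
  suff -> : H = dgroup w h by apply: dgroup_isom.
  apply/esym/Hmax; first exact: dgroup_vc.
  move=> g Hg; have [[k gk]|[gw g2 g1]] := wP g Hg.
    by exists k, false; rewrite mulg1.
  have [[k hgk]|[hgw _ _]] := wP (h * g) (subgroupM sH Hh Hg).
    exists (- k)%R, true; rewrite -dgroup_flip // -hgk gmulfM mulgA h2 mul1g.
    by [].
  by case: (inverting_pair iw hw gw); rewrite -gmulfM.
suff -> : H = zgroup w by apply: zgroup_isom_ex.
apply/esym/Hmax; first exact: zgroup_vc.
move=> g Hg; have [//|gP] := wP g Hg.
by case: nh; exists g.
Qed.

(* For [w] of infinite image: [rho w] generates a maximal cyclic subgroup. *)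
Definition rootless (w : B4S2) := forall a k, zexp a k = rho w -> `|k|%R = 1%R.

Section Maximality.
Variables w : B4S2.
Hypotheses (iw : inf_order (rho w)) (rw : rootless w).

(** The structure theorem gives [w0] in [L] such that [rho w] is a power of [rho w0], and [rootless]
    leaves only the exponents 1 and -1: the cyclic part of the image of [L] is already generated by
    [rho w]. *)
Lemma rootless_overgroup L : virtually_cyclic L -> L w -> forall g, L g ->
  zgroup w g \/ [/\ rho g * rho w = (rho w)^-1 * rho g, rho g * rho g = 1 & rho g <> 1].
Proof.
move=> vcL Lw; have sL : is_subgroup L by case: vcL.
have [fL|[w0 [Lw0 iw0 wP]]] := virtually_cyclic_dichotomy vcL.
  by case: (finite_subgroup_torsion sL fL Lw); apply: rho_inf_order.
have [l [lE l1]] : exists l, rho w = zexp (rho w0) l /\ (l * l)%R = 1%R.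
  have [[l lE]|[_ w2 _]] := wP w Lw; last by case: (iw (n := 2%N)).
  by exists l; split=> //; have := rw (esym lE); lia.
have w0E : rho w0 = zexp (rho w) l by rewrite lE -zexpM l1.
move=> g Lg; have [[k gk]|[gw g2 g1]] := wP g Lg; [left | right].
  by exists (l * k)%R; rewrite gk w0E -zexpM.
split=> //; have := conj_zexp (rho g) (rho w0) l; rewrite gw mulgK -lE => E.
have -> : (rho w)^-1 = zexp (rho w0)^-1 l.
  rewrite lE -zexpN -[(rho w0)^-1]/(zexp (rho w0) (-1)%R) -zexpM; congr zexp; lia.
by rewrite -E mulgVK.
Qed.

Lemma zgroup_maximal :
  (forall g, rho g * rho w = (rho w)^-1 * rho g -> rho g * rho g = 1 -> rho g <> 1 -> False) ->
  maximal_virtually_cyclic (zgroup w).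
Proof.
move=> ninv; split=> [|L vcL zL]; first exact: zgroup_vc.
apply/seteqP; split=> // g Lg.
have Lw : L w by apply: zL; exists 1%R.
by have [//|[gw g2 g1]] := rootless_overgroup vcL Lw Lg; case: (ninv g).
Qed.

Lemma dgroup_maximal h :
  rho h * rho w = (rho w)^-1 * rho h -> rho h * rho h = 1 -> rho h <> 1 ->
  maximal_virtually_cyclic (dgroup w h).
Proof.
move=> hw h2 h1; split=> [|L vcL dL]; first exact: dgroup_vc.
have sL : is_subgroup L by case: vcL.
have Lh : L h by apply: dL; apply: dgroup_h.
have Lw : L w by apply: dL; exists 1%R, false; rewrite mulg1.
apply/seteqP; split=> // g Lg.
have [[k gk]|[gw _ _]] := rootless_overgroup vcL Lw Lg.
  by exists k, false; rewrite mulg1.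
have [[k hgk]|[hgw _ _]] := rootless_overgroup vcL Lw (subgroupM sL Lh Lg).
  by exists (- k)%R, true; rewrite -dgroup_flip // -hgk gmulfM mulgA h2 mul1g.
by case: (inverting_pair iw hw gw); rewrite -gmulfM.
Qed.

End Maximality.

Lemma zgroup_nonmaximal w n : inf_order (rho w) -> 1 < n ->
  nonmaximal_virtually_cyclic (zgroup (w ^+ n)).
Proof.
move=> iw n1; split; first exact: zgroup_vc.
move=> [_ /(_ (zgroup w) (zgroup_vc w))] E.
have wz : zgroup w w by exists 1%R.
have : zgroup (w ^+ n) w.
  rewrite -E // => g [k gk]; exists (Posz n * k)%R.
  by rewrite gk mulhomX zexpM.
move=> [k]; rewrite mulhomX -[rho w ^+ n]/(zexp (rho w) n) -zexpM -{1}(zexp1 (rho w)).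
move=> /(zexp_inj iw) nk; have [k0|k0] : (k <= 0)%R \/ (1 <= k)%R by lia.
  by nia.
by nia.
Qed.

Lemma dgroup_nonmaximal w h n : inf_order (rho w) ->
  rho h * rho w = (rho w)^-1 * rho h -> rho h * rho h = 1 -> rho h <> 1 ->
  1 < n -> nonmaximal_virtually_cyclic (dgroup (w ^+ n) h).
Proof.
move=> iw hw h2 h1 n1.
have hwn : rho h * rho (w ^+ n) = (rho (w ^+ n))^-1 * rho h.
  by rewrite mulhomX -[_ ^+ n]/(zexp (rho w) n) dgroup_flip // zexpN.
split; first exact: dgroup_vc.
move=> [_ /(_ (dgroup w h) (dgroup_vc hw h2))] E.
have wz : dgroup w h w by exists 1%R, false; rewrite mulg1.
have : dgroup (w ^+ n) h w.
  rewrite -E // => g [k [d gk]]; exists (Posz n * k)%R, d.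
  by rewrite gk mulhomX zexpM.
move=> [k [d]]; rewrite mulhomX -[rho w ^+ n]/(zexp (rho w) n) -zexpM => E'.
case: d E' => E'; last first.
  move: E'; rewrite mulg1 -{1}(zexp1 (rho w)) => /(zexp_inj iw) nk.
  have [k0|k0] : (k <= 0)%R \/ (1 <= k)%R by lia.
    by nia.
  by nia.
case: (dgroup_neq1 iw hw (k := (Posz n * k - 1)%R)).
rewrite addrC zexpD zexpN -mulgA; apply: (mulgI (rho w)).
by rewrite mulVKg mulg1 [RHS]E' expg1.
Qed.

(** The triple is the code of z x y. The inverse of [s1] is needed since [s1] maps to the inverse of
    [1 1; 0 1]. *)
Lemma acts_by_s1V : acts_by s1^-1 qmx ((true, true, true) : q8m).
Proof.
have E := acts_by_app ((true, true, true) : q8m) acts_by_s1.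
have Ex : s1 * nuq qmx = nuq qmx * s1 by rewrite nuq_x bs1x.
split; apply: (mulgI s1); rewrite mulVKg mulgA.
  by rewrite Ex mulgK nuq_x.
by rewrite E -nuq_y mulgK; congr (nuq _); apply/eqP.
Qed.

(** * Explicit elements for the maximal and non-maximal examples *)

Section ExampleMatrices.
Local Open Scope ring_scope.
Fact ex1_det : det2 ((9, 4, 2, 1) : int * int * int * int) == 1. Proof. by []. Qed.
Fact ex3_det : det2 ((4, 3, 1, 1) : int * int * int * int) == 1. Proof. by []. Qed.
Fact exD_det : det2 ((2, 1, 1, 1) : int * int * int * int) == 1. Proof. by []. Qed.

(* With U = [1 1; 0 1] and V = [1 0; 1 1], the images in PSL(2, Z) are U^4 V^2,
   U^3 V and U V; the action on the quaternion group is read off modulo 2. *)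
Definition ex1 : B4S2 := (s1^-1 * (s1^-1 * (s1^-1 * s1^-1)) * (s2 * s2))%g.
Definition ex3 : B4S2 := (s1^-1 * (s1^-1 * s1^-1) * s2)%g.
Definition exD : B4S2 := (s1^-1 * s2)%g.

Lemma rho_s1 : rho s1 = psl_pi (m_gen sigma1). Proof. exact: (pres_lift_gen p_rel sigma1). Qed.
Lemma rho_s2 : rho s2 = psl_pi (m_gen sigma2). Proof. exact: (pres_lift_gen p_rel sigma2). Qed.

Lemma rho_ex1 : rho ex1 = psl_pi (SL2 ex1_det).
Proof.
pose mV := ((m_gen sigma1)^-1)%g; pose m2 := m_gen sigma2.
transitivity (psl_pi (mV * (mV * (mV * mV)) * (m2 * m2))%g).
  by rewrite /ex1 !(gmulfM, mulhomV) rho_s1 rho_s2.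
by apply/psl_piP; left; apply: sl2P.
Qed.

Lemma rho_ex3 : rho ex3 = psl_pi (SL2 ex3_det).
Proof.
pose mV := ((m_gen sigma1)^-1)%g.
transitivity (psl_pi (mV * (mV * mV) * m_gen sigma2)%g).
  by rewrite /ex3 !(gmulfM, mulhomV) rho_s1 rho_s2.
by apply/psl_piP; left; apply: sl2P.
Qed.

Lemma rho_exD : rho exD = psl_pi (SL2 exD_det).
Proof.
transitivity (psl_pi ((m_gen sigma1)^-1 * m_gen sigma2)%g).
  by rewrite /exD !(gmulfM, mulhomV) rho_s1 rho_s2.
by apply/psl_piP; left; apply: sl2P.
Qed.

Lemma psl_pi_inf_order m : 2 <= `|mtrace m| -> psl_pi m <> 1%g -> inf_order (psl_pi m).
Proof. by move=> t2 m1 [//|n] _; apply: psl_expgS_neq1. Qed.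

Lemma ex1_inf : inf_order (rho ex1).
Proof. by rewrite rho_ex1; apply: psl_pi_inf_order => // /psl_pi1[]. Qed.
Lemma ex2_inf : inf_order (rho s1).
Proof. by rewrite rho_s1; apply: psl_pi_inf_order => // /psl_pi1[]. Qed.
Lemma ex3_inf : inf_order (rho ex3).
Proof. by rewrite rho_ex3; apply: psl_pi_inf_order => // /psl_pi1[]. Qed.
Lemma exD_inf : inf_order (rho exD).
Proof. by rewrite rho_exD; apply: psl_pi_inf_order => // /psl_pi1[]. Qed.

Lemma rootlessP g m : inf_order (rho g) -> rho g = psl_pi m ->
  (forall n (u : int), e12 m = u * e12 n -> e21 m = u * e21 n ->
     e11 m - e22 m = u * (e11 n - e22 n) -> `|u| <= 1) ->
  rootless g.
Proof.
move=> ig gm mP a k; have [n ->] := psl_pi_surj a => ak.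
have im : inf_order (psl_pi m) by rewrite -gm.
have [u ku [U1 U2 U3]] := psl_root im (etrans ak gm).
have := mP n u U1 U2 U3; suff : k != 0 by lia.
by apply/eqP => k0; apply: (ig 1%N) => //; rewrite -ak k0.
Qed.

(** The traceless part (4, 2, 8) has common divisor 2. For [u = 2] or [u = -2] the determinant of
    [n] would make (d + 2)^2 or (d - 2)^2 equal to 7. *)
Lemma ex1_rootless : rootless ex1.
Proof.
apply: (rootlessP ex1_inf rho_ex1) => n u.
have -> : e12 (SL2 ex1_det) = Posz 4 by [].
have -> : e21 (SL2 ex1_det) = Posz 2 by [].
have -> : e11 (SL2 ex1_det) - e22 (SL2 ex1_det) = Posz 8 by [].
have := sl2_det n.
move: (e11 n) (e12 n) (e21 n) (e22 n) => a b c d D U1 U2 U3.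
have [//|u2] := leP `|u| 1.
have sqr7 (x : int) : x * x = 7 -> False.
  move=> x7; have [x3|[x3|x2]] : x <= - 3 \/ 3 <= x \/ - 2 <= x <= 2 by lia.
  - by nia.
  - by nia.
  - by nia.
have [uE|uE] : u = 2 \/ u = - 2.
  have [u3|[u3|]] : u <= - 3 \/ 3 <= u \/ - 2 <= u <= 2 by lia.
  - have [c0|c0] : c <= - 1 \/ 0 <= c by lia.
      by nia.
    by nia.
  - have [c0|c0] : c <= 0 \/ 1 <= c by lia.
      by nia.
    by nia.
  - by lia.
  rewrite uE in U1 U2 U3; have bE : b = 2 by lia.
  have cE : c = 1 by lia.
  have aE : a = d + 4 by lia.
  by case: (@sqr7 (d + 2)); rewrite aE bE cE in D; lia.
rewrite uE in U1 U2 U3; have bE : b = - 2 by lia.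
have cE : c = - 1 by lia.
have aE : a = d - 4 by lia.
by case: (@sqr7 (d - 2)); rewrite aE bE cE in D; lia.
Qed.

Lemma int_unit_norm (u c : int) : u * c = 1 \/ u * c = - 1 -> `|u| <= 1.
Proof.
move=> uc; have [//|u2] := leP `|u| 1.
have : `|u * c| = 1 by case: uc => ->.
rewrite normrM; have [c0|c0] : `|c| = 0 \/ 1 <= `|c| by lia.
  by rewrite c0 mulr0.
by nia.
Qed.

Lemma ex2_rootless : rootless s1.
Proof.
apply: (rootlessP ex2_inf rho_s1) => n u.
have -> : e12 (m_gen sigma1) = Negz 0 by [].
by move=> U1 _ _; apply: (@int_unit_norm u (e12 n)); right; rewrite -U1.
Qed.

Lemma ex3_rootless : rootless ex3.
Proof.
apply: (rootlessP ex3_inf rho_ex3) => n u.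
have -> : e21 (SL2 ex3_det) = Posz 1 by [].
by move=> _ U2 _; apply: (@int_unit_norm u (e21 n)); left; rewrite -U2.
Qed.

Lemma exD_rootless : rootless exD.
Proof.
apply: (rootlessP exD_inf rho_exD) => n u.
have -> : e21 (SL2 exD_det) = Posz 1 by [].
by move=> _ U2 _; apply: (@int_unit_norm u (e21 n)); left; rewrite -U2.
Qed.

(** An inverting involution is represented by [a b; c -a], and its product with [m] also has trace
    0. This leaves one quadratic and one linear equation over the integers. *)
Lemma not_invertedP w m : inf_order (rho w) -> rho w = psl_pi m ->
  (forall a b c : int, - (a * a) - b * c = 1 ->
    a * (e11 m - e22 m) + b * e21 m + c * e12 m = 0 -> False) ->
  forall g, (rho g * rho w = (rho w)^-1 * rho g)%g -> (rho g * rho g = 1)%g ->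
    rho g <> 1%g -> False.
Proof.
move=> iw wm mP g; have [n ->] := psl_pi_surj (rho g); rewrite wm => nm n2 n1.
rewrite wm in iw; have [tn tnm] := psl_inverted_tr iw nm n2 n1.
have D := sl2_det n; move: tn tnm; rewrite /mtrace !sl2_mulE => tn tnm.
have dE : e22 n = - e11 n by lia.
apply: (mP (e11 n) (e12 n) (e21 n)); first by rewrite -D dE; ring.
by rewrite -tnm dE; ring.
Qed.

Lemma mod3_sqr (a c : int) : a * a + 1 = 3 * c -> False.
Proof.
have [q [r [-> r3]]] : exists q r, a = 3 * q + r /\ (r = 0 \/ r = 1 \/ r = 2).
  by exists (a %/ 3)%Z, (a %% 3)%Z; lia.
by case: r3 => [->|[->|->]]; lia.
Qed.

Lemma ex1_not_inverted g : (rho g * rho ex1 = (rho ex1)^-1 * rho g)%g ->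
  (rho g * rho g = 1)%g -> rho g <> 1%g -> False.
Proof.
apply: (not_invertedP ex1_inf rho_ex1) => a b c D.
have -> : e12 (SL2 ex1_det) = Posz 4 by [].
have -> : e21 (SL2 ex1_det) = Posz 2 by [].
have -> : e11 (SL2 ex1_det) - e22 (SL2 ex1_det) = Posz 8 by [].
(* Eliminating [b] and completing the square gives (a - 2c)^2 + 1 = 6 c^2, and -1 is not a square
   modulo 3. *)
move=> E; have bE : b = - (4 * a) - 2 * c by lia.
apply: (@mod3_sqr (a - 2 * c) (2 * c * c)); rewrite bE in D; lia.
Qed.

Lemma ex2_not_inverted g : (rho g * rho s1 = (rho s1)^-1 * rho g)%g ->
  (rho g * rho g = 1)%g -> rho g <> 1%g -> False.
Proof.
apply: (not_invertedP ex2_inf rho_s1) => a b c D.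
have -> : e12 (m_gen sigma1) = Negz 0 by [].
have -> : e21 (m_gen sigma1) = Posz 0 by [].
have -> : e11 (m_gen sigma1) - e22 (m_gen sigma1) = Posz 0 by [].
move=> E; have cE : c = 0 by lia.
by rewrite cE in D; nia.
Qed.

Lemma ex3_not_inverted g : (rho g * rho ex3 = (rho ex3)^-1 * rho g)%g ->
  (rho g * rho g = 1)%g -> rho g <> 1%g -> False.
Proof.
apply: (not_invertedP ex3_inf rho_ex3) => a b c D.
have -> : e12 (SL2 ex3_det) = Posz 3 by [].
have -> : e21 (SL2 ex3_det) = Posz 1 by [].
have -> : e11 (SL2 ex3_det) - e22 (SL2 ex3_det) = Posz 3 by [].
move=> E; have bE : b = - (3 * a) - 3 * c by lia.
apply: (@mod3_sqr a (a * c + c * c)); rewrite bE in D; lia.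
Qed.

(** [mA] conjugates every matrix of determinant 1 to its inverse transpose, and the matrix of [exD]
    is symmetric. *)
Lemma exD_inverted : [/\ (rho ba * rho exD = (rho exD)^-1 * rho ba)%g,
  (rho ba * rho ba = 1)%g & rho ba <> 1%g].
Proof.
rewrite rho_exD rho_a; split; last by move=> /psl_pi1[].
  transitivity (psl_pi (mA * SL2 exD_det)%g); first by rewrite psl_piM.
  transitivity (psl_pi ((SL2 exD_det)^-1 * mA)%g); last by rewrite psl_piM mulhomV.
  by apply/psl_piP; left; apply: sl2P.
transitivity (psl_pi (mA * mA)%g); first by rewrite psl_piM.
by apply/psl_pi1.
Qed.

End ExampleMatrices.

(** The exponent [n] is prime to the order of [w] in Out(Q8), so the power keeps the type: 2 for the
    orders 1 and 3, and 3 for the order 2. *)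
Lemma example_zgroups (j : q8_action) : exists w n, [/\ inf_order (rho w), rootless w,
  (forall g, rho g * rho w = (rho w)^-1 * rho g -> rho g * rho g = 1 ->
     rho g <> 1 -> False) & 1 < n] /\
  isom_to (zgroup w) (Q8Z j) /\ isom_to (zgroup (w ^+ n)) (Q8Z j).
Proof.
have a3 := acts_by_mul acts_by_s1V (acts_by_mul acts_by_s1V acts_by_s1V).
have a4 := acts_by_mul acts_by_s1V a3.
have act_ex1 := acts_by_mul a4 (acts_by_mul acts_by_s2 acts_by_s2).
have act_ex3 := acts_by_mul a3 acts_by_s2.
case: j.
- exists ex1, 2; split.
    by split=> //; [exact: ex1_inf | exact: ex1_rootless | exact: ex1_not_inverted].
  split; first apply: (@zgroup_isom _ ex1_inf _ (qmx * qmy) (qmy) (qmx)).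
    by apply: acts_asP (acts_by_mul (acts_by_nuq _) act_ex1) _.
  apply: (@zgroup_isom _ _ _ (1) (qmx) (qmy)).
    by rewrite mulhomX; apply: inf_orderX => //; apply: ex1_inf.
  by apply: acts_asP (acts_by_mul (acts_by_nuq _) (acts_by_mul act_ex1 act_ex1)) _.
- exists s1, 3; split.
    by split=> //; [exact: ex2_inf | exact: ex2_rootless | exact: ex2_not_inverted].
  split; first apply: (@zgroup_isom _ ex2_inf _ (qmy) (qmy) ((true, true, true))).
    by apply: acts_asP (acts_by_mul (acts_by_nuq _) acts_by_s1) _.
  apply: (@zgroup_isom _ _ _ (qmy) (qmy) (qmx * qmy)).
    by rewrite mulhomX; apply: inf_orderX => //; apply: ex2_inf.
  have act3 := acts_by_mul acts_by_s1 (acts_by_mul acts_by_s1 acts_by_s1).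
  by apply: acts_asP (acts_by_mul (acts_by_nuq _) act3) _.
- exists ex3, 2; split.
    by split=> //; [exact: ex3_inf | exact: ex3_rootless | exact: ex3_not_inverted].
  split; first apply: (@zgroup_isom _ ex3_inf _ (1) (qmx) (qmx * qmy)).
    by apply: acts_asP (acts_by_mul (acts_by_nuq _) act_ex3) _.
  apply: (@zgroup_isom _ _ _ (1) (qmy) ((true, true, true))).
    by rewrite mulhomX; apply: inf_orderX => //; apply: ex3_inf.
  by apply: acts_asP (acts_by_mul (acts_by_nuq _) (acts_by_mul act_ex3 act_ex3)) _.
Qed.

Lemma example_dgroups : exists w h n, [/\ inf_order (rho w), rootless w,
  [/\ rho h * rho w = (rho w)^-1 * rho h, rho h * rho h = 1 & rho h <> 1] & 1 < n] /\
  isom_to_Q16_amalgam (dgroup w h) /\ isom_to_Q16_amalgam (dgroup (w ^+ n) h).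
Proof.
have [hw h2 h1] := exD_inverted.
exists exD, ba, 2; split.
  by split=> //; [exact: exD_inf | exact: exD_rootless].
split; first by apply: dgroup_isom => //; apply: exD_inf.
apply: dgroup_isom => //.
  by rewrite mulhomX; apply: inf_orderX => //; apply: exD_inf.
by rewrite mulhomX -[_ ^+ 2]/(zexp (rho exD) 2) dgroup_flip // zexpN.
Qed.

(** * The binary tetrahedral group *)

Section BinaryTetrahedralRelations.
Variables (G : groupType) (r s t c u : G).
Hypotheses (rE : r * r = r * s * t) (sE : s * (s * s) = r * s * t).
Hypotheses (tE : t * (t * t) = r * s * t) (cE : c = r * r) (uE : u = t * s).

Lemma tet_st : r = s * t.
Proof. by apply: (mulgI r); rewrite rE mulgA. Qed.

Let sc : s * (s * s) = c. Proof. by rewrite sE -rE -cE. Qed.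
Let tc : t * (t * t) = c. Proof. by rewrite tE -rE -cE. Qed.
Let c_r : commute c r. Proof. by rewrite /commute cE mulgA. Qed.
Let c_s : commute c s. Proof. by rewrite /commute -sc !mulgA. Qed.

Let sts : s * (t * s) = t * t.
Proof. by apply: (mulIg t); rewrite -!mulgA tc cE tet_st !mulgA. Qed.

Let r_s : s * u = r * s. Proof. by rewrite uE tet_st mulgA. Qed.

Let c_t : commute c t. Proof. by rewrite /commute -tc !mulgA. Qed.
Let c_u : commute c u. Proof. by rewrite uE; apply: commuteM. Qed.

Let v := s * r * s^-1.
Let v_s : v * s = s * r. Proof. by rewrite /v mulgVK. Qed.

Let s_v : s * v = u * s.
Proof.
apply: (mulIg s); rewrite -mulgA v_s tet_st (mulgA s s t) mulgA sc c_t uE.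
by rewrite -!mulgA sc.
Qed.

Let r_u : r * u = c * v.
Proof.
apply: (mulIg s); rewrite -[RHS]mulgA v_s.
have -> : r * u = s * (t * t) * s by rewrite uE tet_st !mulgA.
have E : commute c (s * (s * t)) by do 2!apply: commuteM => //.
by rewrite tet_st E -sts -!mulgA sc.
Qed.

Let v_r : v * r = c * u.
Proof.
apply: (mulIg s); rewrite -mulgA -r_s mulgA v_s -mulgA r_u mulgA -c_s.
by rewrite -!mulgA s_v.
Qed.

Let r_u_r : r * (u * r) = c * (c * u).
Proof. by rewrite mulgA r_u -mulgA v_r. Qed.

Lemma tet_ur : u * r = c * (r * u).
Proof.
apply: (mulgI c); rewrite [LHS]mulgA {1}cE -!mulgA r_u_r.
by rewrite (mulgA r) -c_r -mulgA (mulgA r) -c_r -mulgA.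
Qed.

(** Conjugation by [s] permutes [u], [r], [v] cyclically, so r u = c v yields v r = c u and r u r =
    c^2 u. With u r = c r u this gives c u = u r^2 = c r u r = c^3 u. *)
Lemma tet_cc : c * c = 1.
Proof.
apply: (mulIg (c * u)); rewrite mul1g -mulgA.
have : u * r * r = c * u by rewrite -mulgA -cE c_u.
by rewrite tet_ur -!mulgA r_u_r.
Qed.

Lemma tet_q8_pow : r * r = u * u.
Proof. by apply: (mulgI s); rewrite (mulgA s u) r_s -mulgA r_s [RHS]mulgA -cE c_s. Qed.

Lemma tet_q8_conj : u * r = r^-1 * u.
Proof.
rewrite tet_ur mulgA; congr (_ * _); apply: (mulgI r).
by rewrite mulgV mulgA -c_r -mulgA -cE tet_cc.
Qed.

Lemma tet_s_r : s * r = c * r * u * s.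
Proof. by rewrite -v_s -(mulgA c) r_u mulgA tet_cc mul1g. Qed.

Lemma tet_s_u : s * u = r * s. Proof. exact: r_s. Qed.

End BinaryTetrahedralRelations.

Local Notation Tr := (pgen tet_rel tr2 : Tstar).
Local Notation Ts := (pgen tet_rel ts3 : Tstar).
Local Notation Tt := (pgen tet_rel tt3 : Tstar).
Local Notation Tc := (Tr * Tr).
Local Notation Tu := (Tt * Ts).

Lemma tstar_r : Tr * Tr = Tr * Ts * Tt. Proof. exact: (pgen_rel tet_r). Qed.
Lemma tstar_s : Ts * (Ts * Ts) = Tr * Ts * Tt. Proof. exact: (pgen_rel tet_s). Qed.
Lemma tstar_t : Tt * (Tt * Tt) = Tr * Ts * Tt. Proof. exact: (pgen_rel tet_t). Qed.

Lemma tstar_cc : Tc * Tc = 1.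
Proof. exact: (tet_cc tstar_r tstar_s tstar_t erefl erefl). Qed.

Lemma tstar_rE : Tr = Ts * Tt. Proof. exact: tet_st tstar_r. Qed.

Lemma tstar_sss : Ts * (Ts * Ts) = Tc. Proof. by rewrite tstar_s -tstar_r. Qed.
Lemma tstar_ttt : Tt * (Tt * Tt) = Tc. Proof. by rewrite tstar_t -tstar_r. Qed.

Section SL2F3.
Local Open Scope ring_scope.
Let F := 'F_3.
Fact ts_det : det2 ((-1, -1, 0, -1) : F * F * F * F) == 1. Proof. by []. Qed.
Fact tt_det : det2 ((-1, 0, -1, -1) : F * F * F * F) == 1. Proof. by []. Qed.
Definition tstar_gen (g : tet_gen) : sl2 F :=
  match g with tr2 => SL2 ts_det * SL2 tt_det | ts3 => SL2 ts_det | tt3 => SL2 tt_det end%g.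
Fact tstar_rel u v : tet_rel u v -> weval tstar_gen u = weval tstar_gen v.
Proof. by case; apply/eqP. Qed.
End SL2F3.

Lemma tstar_c_neq1 : Tc <> 1.
Proof.
have [f fr] : exists f : {multiplicative Tstar -> sl2 'F_3}, f Tr = tstar_gen tr2.
  by exists (pres_lift tstar_rel); apply: (pres_lift_gen tstar_rel tr2).
by move=> /(congr1 f); rewrite gmulfM mulhom1 fr => /eqP.
Qed.

Lemma tstar_u_r : Tu * Tr = Tc * (Tr * Tu).
Proof. exact: tet_ur tstar_r tstar_s tstar_t erefl erefl. Qed.

(** [Tr] and [Tu] generate a quaternion image normalized by [Ts] and containing its cube, and [Tt]
    is [Ts^-1 * Tr]; so at most 8 times 3 products occur. *)
Lemma tstar_finite : finite_set [set: Tstar].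
Proof.
have [phi [phx phy]] : exists phi : {multiplicative Q8 -> Tstar}, phi q8x = Tr /\ phi q8y = Tu.
  have R a b : quat_rel 2 a b ->
      weval (fun q => match q with qx => Tr | qy => Tu end) a =
      weval (fun q => match q with qx => Tr | qy => Tu end) b.
    case; first exact: tet_q8_pow tstar_r tstar_s erefl erefl.
    rewrite /=; apply: (mulIg Tu); rewrite mulgVK.
    exact: tet_q8_conj tstar_r tstar_s tstar_t erefl erefl.
  exists (pres_lift R); split; first exact: (pres_lift_gen R qx).
  exact: (pres_lift_gen R qy).
pose S (a : Tstar) := exists (u : q8m) (k : 'I_3), a = phi (q8_word u) * Ts ^+ k.
have Sphi q a : S a -> S (phi q * a).
  by move=> [u [k ->]]; exists (q8_code q * u), k; rewrite q8_wordM q8_codeK gmulfM mulgA.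
have s_phi q : exists q', Ts * phi q = phi q' * Ts.
  have sx : Ts * phi q8x = phi (q8x * q8x * q8x * q8y) * Ts.
    rewrite !gmulfM phx phy -[RHS]mulgA -[RHS]mulgA.
    have := tet_s_r tstar_r tstar_s tstar_t erefl erefl; rewrite -!mulgA; exact.
  have sy : Ts * phi q8y = phi q8x * Ts.
    by rewrite phx phy; exact: tet_s_u tstar_r erefl.
  have sM p p' q0 q0' : Ts * phi p = phi p' * Ts -> Ts * phi q0 = phi q0' * Ts ->
      Ts * phi (p * q0) = phi (p' * q0') * Ts.
    by move=> E1 E2; rewrite !gmulfM mulgA E1 -mulgA E2 mulgA.
  have sX p p' (i : bool) : Ts * phi p = phi p' * Ts -> Ts * phi (p ^+ i) = phi (p' ^+ i) * Ts.
    by case: i => E; [exact: E | rewrite !expg0 mulhom1 mulg1 mul1g].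
  have [[[i j] k] ->] := q8_word_surj q; eexists.
  exact: sM _ _ _ _ (sM _ _ _ _ (sX _ _ _ (sM _ _ _ _ sx sx)) (sX _ _ _ sx)) (sX _ _ _ sy).
have Ss a : S a -> S (Ts * a).
  move=> [u [k ->]]; have [q E] := s_phi (q8_word u).
  rewrite mulgA E -mulgA; apply: Sphi; rewrite -expgS.
  case: k => [[|[|[|//]]] lt3] /=.
  - by exists 1, (Ordinal (isT : 1 < 3)); rewrite !mulhom1 mul1g.
  - by exists 1, (Ordinal (isT : 2 < 3)); rewrite !mulhom1 mul1g.
  - exists (qmx * qmx), (Ordinal (isT : 0 < 3)); rewrite mulg1.
    have -> : q8_word (qmx * qmx) = q8x * q8x by rewrite /= !mulg1.
    by rewrite gmulfM phx -tstar_sss.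
have SsV a : S a -> S (Ts^-1 * a).
  move=> Sa; have -> : Ts^-1 = phi (q8x * q8x) * Ts * Ts.
    apply: (mulIg Ts); rewrite mulVg -!mulgA tstar_sss gmulfM phx.
    by rewrite tstar_cc.
  by rewrite -!mulgA; apply: Sphi; apply: (Ss); apply: Ss.
have Tt_E : Tt = Ts^-1 * phi q8x by rewrite phx tstar_rE mulKg.
have St a : S a -> S (Tt * a) by move=> Sa; rewrite Tt_E -mulgA; apply/SsV/Sphi.
have StV a : S a -> S (Tt^-1 * a).
  by move=> Sa; rewrite Tt_E invgM invgK -mulhomV -mulgA; apply/Sphi/Ss.
have Sr a : S a -> S (Tr * a) by move=> Sa; rewrite -phx; apply: Sphi.
have SrV a : S a -> S (Tr^-1 * a) by move=> Sa; rewrite -phx -mulhomV; apply: Sphi.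
have Sall a : S a.
  apply: (presented_ind (T := S)).
  - by exists 1, (Ordinal (isT : 0 < 3)); rewrite !mulhom1 mulg1.
  - by move=> [] b; [apply: Sr | apply: Ss | apply: St].
  - by move=> [] b; [apply: SrV | apply: SsV | apply: StV].
have fs : finite_set [set phi (q8_word u) * Ts ^+ k |
    u in [set` q8m_enum] & k in [set` enum 'I_3]].
  exact: finite_image2.
apply: sub_finite_set fs => a _; have [u [k ->]] := Sall a.
by exists u; [exact: mem_q8m_enum | exists k => //=; rewrite mem_enum].
Qed.

Lemma sl2_bool_order4 (m : sl2 bool) : m * m * (m * m) = 1 -> m * m = 1.
Proof.
move=> /eqP E; apply/eqP; move: m E => [[[[a b] c] d] D].
by move: D; case: a b c d => [] [] [] [].
Qed.

(** Parity in the symmetric group of degree 3: [m] and [n] are even, and an even element squaring to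
    1 is trivial. *)
Lemma sl2_bool_even (m n : sl2 bool) : m ^+ 3 = 1 -> n ^+ 3 = 1 ->
  (m * n) * (m * n) = 1 -> m * n = 1.
Proof.
move=> /eqP E1 /eqP E2 /eqP E; apply/eqP; move: m n E1 E2 E.
move=> [[[[a b] c] d] D] [[[[a' b'] c'] d'] D'].
by move: D D'; case: a b c d a' b' c' d' => [] [] [] [] [] [] [] [].
Qed.

Lemma sl2_bool_order3 (m n : sl2 bool) : m <> 1 -> m ^+ 3 = 1 ->
  (exists k : nat, n = m ^+ k) \/ [/\ n <> 1, n * n = 1 & n * m = m^-1 * n].
Proof.
move=> /eqP E1 /eqP E2.
suff /or4P[/eqP->|/eqP->|/eqP->|/and3P[/eqP ? /eqP ? /eqP ?]] :
   [|| n == 1, n == m, n == m * m | [&& n != 1, n * n == 1 & n * m == m^-1 * n]].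
- by left; exists 0%N.
- by left; exists 1%N.
- by left; exists 2.
- by right.
move: m n E1 E2 => [[[[a b] c] d] D] [[[[a' b'] c'] d'] D'].
by move: D D'; case: a b c d a' b' c' d' => [] [] [] [] [] [] [] [].
Qed.

Section TetrahedralSubgroups.
Variable f : {multiplicative Tstar -> B4S2}.
Hypothesis fI : injective f.

(** An element whose cube is [Tc] and whose image lies in the quaternion group has order dividing 4,
    hence equals [Tc]. If this holds for both [Ts] and [Tt], their product [Tr] is trivial. *)
Lemma tstar_image_not_in_kernel : rho (f Ts) = 1 -> rho (f Tt) = 1 -> False.
Proof.
have key a : a * (a * a) = Tc -> rho (f a) = 1 -> a = Tc.
  move=> a3 /rho_kernel[u fu].
  have a4 : a * (a * (a * a)) = 1.
    apply: fI; rewrite !gmulfM fu mulhom1 -!gmulfM -(mulhom1 nuq); congr (nuq _).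
    by case: (u) => [[[] []] []].
  by apply: (mulIg Tc); rewrite tstar_cc -[in LHS]a3.
move=> /(key _ tstar_sss) Ec /(key _ tstar_ttt) Et.
have r1 : Tr = 1 by rewrite tstar_rE Ec Et tstar_cc.
by apply: tstar_c_neq1; rewrite r1 mulg1.
Qed.

Lemma tetrahedral_maximal H : is_subgroup H -> range f = H -> maximal_virtually_cyclic H.
Proof.
move=> sH rH.
have Hf a : H (f a) by rewrite -rH; exists a.
split.
  apply: finite_virtually_cyclic => //; rewrite -rH; exact/finite_image/tstar_finite.
move=> L vcL HL; have sL : is_subgroup L by case: vcL.
have Lf a : L (f a) by apply: HL.
have fc2 : rho (f Tc) * rho (f Tc) = 1 by rewrite -!gmulfM tstar_cc !mulhom1.
have fr2 : rho (f Tr) * rho (f Tr) = rho (f Tc) by rewrite -!gmulfM.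
have fs3 : rho (f Ts) * (rho (f Ts) * rho (f Ts)) = rho (f Tc) by rewrite -!gmulfM tstar_sss.
have ft3 : rho (f Tt) * (rho (f Tt) * rho (f Tt)) = rho (f Tc) by rewrite -!gmulfM tstar_ttt.
have [fL|[w [Lw iw wP]]] := virtually_cyclic_dichotomy vcL; last first.
  (* In an infinite overgroup torsion elements have images squaring to 1. The images of [Ts] and
     [Tt], of order dividing 3 once [Tc] is in the kernel, would be trivial. *)
  have tf g (n : nat) : L g -> 0 < n -> rho g ^+ n = 1 -> rho g * rho g = 1.
    move=> Lg n0 gn; have [[k gk]|[_ //]] := wP g Lg.
    have k0 : k = 0%R.
      move: gn; rewrite gk -[_ ^+ n]/(zexp _ n) -zexpM => /(inf_order_zexp iw); nia.
    by rewrite gk k0 mulg1.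
  have c1 : rho (f Tc) = 1.
    rewrite -fr2; apply: (tf _ 4) => //.
    by rewrite (expgnDr _ 2 2) !expg2 fr2.
  have st1 a : rho (f a) * (rho (f a) * rho (f a)) = rho (f Tc) -> rho (f a) = 1.
    move=> a3; have a2 : rho (f a) * rho (f a) = 1.
      by apply: (tf _ 3) => //; rewrite !expgS expg0 mulg1 a3.
    by rewrite -c1 -a3 a2 mulg1.
  by case: tstar_image_not_in_kernel; apply: st1.
(* In a finite overgroup every image is torsion, so reduction modulo 2 embeds the image of [L] in a
   group of order 6. *)
have tor g : L g -> rho2 g = 1 -> rho g = 1.
  move=> Lg qg.
  have /existsNP[n /not_implyP[n0 /contrapT gn]] := finite_subgroup_torsion sL fL Lg.
  case: n n0 gn => // n _ gn; apply: (@psl_red1_torsion_free _ n) => //.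
  by rewrite -mulhomX gn mulhom1.
have bqE a : rho2 a = psl_red (rho a) by [].
have c1 : rho (f Tc) = 1.
  apply: tor => //; rewrite gmulfM gmulfM; apply: sl2_bool_order4.
  by rewrite -!gmulfM tstar_cc !mulhom1.
rewrite c1 in fs3 ft3 fr2.
have s3 : rho (f Ts) ^+ 3 = 1 by rewrite !expgS expg0 mulg1.
have t3 : rho (f Tt) ^+ 3 = 1 by rewrite !expgS expg0 mulg1.
have r1 : rho (f Tr) = 1.
  apply: tor => //; rewrite tstar_rE !gmulfM; apply: sl2_bool_even.
  - by rewrite !bqE -mulhomX s3 mulhom1.
  - by rewrite !bqE -mulhomX t3 mulhom1.
  - have -> : rho2 (f Ts) * rho2 (f Tt) = rho2 (f Tr) by rewrite tstar_rE !gmulfM.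
    by rewrite bqE -gmulfM fr2 mulhom1.
have s1 : rho (f Ts) <> 1.
  move=> s1; apply: (tstar_image_not_in_kernel s1).
  by move: r1; rewrite tstar_rE !gmulfM s1 mul1g.
(* The images of [Tr] and [Tu] lie in the quaternion group and do not commute, so they generate
   it. *)
have HN u : H (nuq u).
  have [a fa] := rho_kernel r1.
  have [b fb] : exists b, f Tu = nuq b.
    have -> : Tu = Ts^-1 * Tr * Ts by rewrite tstar_rE mulKg.
    by apply: rho_kernel; rewrite !(gmulfM, mulhomV) r1 mulg1 mulVg.
  have ab : a * b <> b * a.
    move=> ab; apply: tstar_c_neq1; apply: (mulIg (Tr * Tu)); rewrite mul1g.
    rewrite -tstar_u_r; apply: fI.
    by rewrite [LHS]gmulfM [RHS]gmulfM fa fb -!gmulfM ab.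
  have [_ _ gen] := q8m_generation ab; have [v ->] := gen u.
  have Ha : H (nuq a) by rewrite -fa.
  have Hb : H (nuq b) by rewrite -fb.
  have HX g (n : nat) : H g -> H (g ^+ n) := fun Hg => subgroupZ n sH Hg.
  rewrite !gmulfM !mulhomX; apply: (subgroupM sH); last exact: HX.
  apply: (subgroupM sH); last exact: HX.
  by apply: HX; rewrite gmulfM; apply: subgroupM.
apply/seteqP; split=> // l Ll.
have qs1 : rho2 (f Ts) <> 1 by move=> /(tor _ (Lf _)).
have qs3 : rho2 (f Ts) ^+ 3 = 1 by rewrite !bqE -mulhomX s3 mulhom1.
have [[k lk]|[l1 l2 ls]] := sl2_bool_order3 (rho2 l) qs1 qs3.
  have [u ->] : exists u, l = nuq u * f Ts ^+ k.
    apply: rho_fiber; apply: divg1_eq; rewrite -mulhomV -gmulfM; apply: tor.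
      by apply: (subgroupM sL) => //; apply: (subgroupV sL); rewrite -mulhomX.
    by rewrite gmulfM mulhomV mulhomX lk mulgV.
  by apply: subgroupM => //; rewrite -mulhomX.
(* The images of [l] and [Ts] would generate a dihedral group of order 6 in PSL(2, Z). *)
exfalso; apply: (@psl_no_dihedral3 (rho (f Ts)) (rho l)) => //.
- by move=> bl; apply: l1; rewrite bqE bl mulhom1.
- by rewrite -gmulfM; apply: tor; [apply: subgroupM | rewrite gmulfM].
have E := tor (l * f Ts * ((f Ts)^-1 * l)^-1).
rewrite !gmulfM !mulhomV !gmulfM !mulhomV in E.
apply: divg1_eq; apply: E; last by rewrite ls mulgV.
by apply: (subgroupM sL); [|apply: (subgroupV sL)]; apply: (subgroupM sL) => //;
  apply: (subgroupV sL).
Qed.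

End TetrahedralSubgroups.

Theorem theorem41 :
  (forall G : set B4S2,
     maximal_virtually_cyclic G -> infinite_set G ->
     (exists j : q8_action, isom_to G (Q8Z j)) \/ isom_to_Q16_amalgam G)
  /\
  (forall G : set B4S2,
     is_subgroup G -> isom_to G Tstar -> maximal_virtually_cyclic G)
  /\
  (forall j : q8_action,
     (exists G : set B4S2,
        isom_to G (Q8Z j) /\ maximal_virtually_cyclic G) /\
     (exists G : set B4S2,
        isom_to G (Q8Z j) /\ nonmaximal_virtually_cyclic G))
  /\
  ((exists G : set B4S2,
      isom_to_Q16_amalgam G /\ maximal_virtually_cyclic G) /\
   (exists G : set B4S2,
      isom_to_Q16_amalgam G /\ nonmaximal_virtually_cyclic G)).
Proof.
split; first exact: maximal_infinite.
split; first by move=> G sG [f fI fG]; apply: tetrahedral_maximal fI _ sG fG.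
split=> [j|].
  have [w [n [[iw rw ninv n1] [isoM isoN]]]] := example_zgroups j; split.
    by exists (zgroup w); split; [|apply: zgroup_maximal].
  by exists (zgroup (w ^+ n)); split; [|apply: zgroup_nonmaximal].
have [w [h [n [[iw rw [hw h2 h1] n1] [isoM isoN]]]]] := example_dgroups; split.
  by exists (dgroup w h); split; [|apply: dgroup_maximal].
by exists (dgroup (w ^+ n) h); split; [|apply: dgroup_nonmaximal].
Qed.
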